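(* Let $A,B_1,B_2,C,D,F$ be $2\times 2$ generic matrices over $\mathbb{Q}$, let $K$ be the field generated over $\mathbb{Q}$ by all their entries and $\overline{K}$ its algebraic closure. (i) The solvability complexity of the equation $$AXB_1X+XB_2X+X^2C+DX+F=0_2\qquad\text{in the unknown }X\in\mathcal{M}_2(\overline{K})$$ is $(16,S_{16})$. (ii) Moreover, the equation $AXB_1X+XB_2X+X^2C=0_2$ in the unknown $X\in\mathcal{M}_2(\overline{K})$ admits the sole solution $X=0_2$, with multiplicity $16$.
   Context: Generic matrices: matrices whose entries, taken all together, are independent commuting indeterminates over $\mathbb{Q}$ (algebraically independent over $\mathbb{Q}$). Solvability complexity (SC): consider a matrix equation over $K$ with a finite number $\nu$ of solutions in $\mathcal{M}_n(\overline{K})$. Assume that finding the entries of each solution is equivalent to finding the roots of a polynomial (over $K$) whose Galois group over $K$ is $G$, in the sense that the extension of $K$ generated by the entries of all the solutions is the splitting field over $K$ of that polynomial. Then the solvability complexity of the equation is the couple $(\nu,G)$. $S_m$ denotes the symmetric group on $m$ letters. Multiplicity: a matrix equation $f(X)=0$ is regarded as a system of polynomial equations $f_{i,j}=0$ in the entries of $X$; the multiplicity of an isolated solution $X_0$ is $\dim_{\overline{K}}\mathcal{O}_{X_0}/((f_{i,j})_{i,j})_{X_0}$, where $\mathcal{O}_{X_0}$ is the local ring of the affine space $\mathcal{M}_2(\overline{K})$ at $X_0$. *)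

(* Defs.v *)
From HB Require Import structures.
From mathcomp Require Import all_boot all_order all_fingroup all_algebra all_field.
From mathcomp Require Import mpoly.

Set Implicit Arguments.
Unset Strict Implicit.
Unset Printing Implicit Defensive.

Import GRing.Theory.
Local Open Scope ring_scope.

(* The subfield F(S) of L, where F is seen inside L through iota. *)
Inductive generated_field (F L : fieldType) (iota : {rmorphism F -> L})
    (S : L -> Prop) : L -> Prop :=
| Gen_base a : generated_field iota S (iota a)
| Gen_mem x : S x -> generated_field iota S x
| Gen_sub x y : generated_field iota S x -> generated_field iota S y ->
    generated_field iota S (x - y)
| Gen_div x y : generated_field iota S x -> generated_field iota S y ->
    generated_field iota S (x / y).

(* All the entries of all the matrices of Ms, listed in one row. *)
Definition entries (R : Type) (m n : nat) (Ms : m.-tuple 'M[R]_n) :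
    'rV[R]_(m * (n * n)) :=
  mxvec (\matrix_(k < m) mxvec (tnth Ms k)).

Definition alg_independent (F L : fieldType) (iota : {rmorphism F -> L})
    (N : nat) (v : 'rV[L]_N) : Prop :=
  forall p : {mpoly F[N]}, mmap iota (v 0) p = 0 -> p = 0.

Definition generic_matrices (K : fieldType) (phi : {rmorphism rat -> K})
    (m n : nat) (Ms : m.-tuple 'M[K]_n) : Prop :=
  alg_independent phi (entries Ms).

Definition generated_by_entries (K : fieldType) (phi : {rmorphism rat -> K})
    (m n : nat) (Ms : m.-tuple 'M[K]_n) : Prop :=
  forall x : K, generated_field phi (fun y => exists k, y = entries Ms 0 k) x.

Definition is_algebraic_closure (K : fieldType) (Kbar : closedFieldType)
    (iota : {rmorphism K -> Kbar}) : Prop :=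
  forall x : Kbar, algebraicOver iota x.

(* A matrix equation f(X) = 0 in an unknown n x n matrix X is given by the
   n x n matrix f of the polynomials f_{i,j} in the n * n entries of X; the
   variable standing for X i j is the one of index mxvec_index i j. *)
Definition unknown_mx (R : comNzRingType) (n : nat) : 'M[{mpoly R[n * n]}]_n :=
  \matrix_(i, j) 'X_(mxvec_index i j).

Definition coef_mx (R : comNzRingType) (n : nat) (A : 'M[R]_n) :
    'M[{mpoly R[n * n]}]_n :=
  map_mx (@mpolyC (n * n) R) A.

Definition solution (K L : fieldType) (iota : {rmorphism K -> L}) (n : nat)
    (f : 'M[{mpoly K[n * n]}]_n) (X : 'M[L]_n) : Prop :=
  map_mx (mmap iota (mxvec X 0)) f = 0.

(* Up to isomorphism of abstract groups; E is the splitting field of p. *)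
Definition has_galois_group (K : fieldType) (p : {poly K})
    (gT : finGroupType) (G : {group gT}) : Prop :=
  exists E : splittingFieldType K,
    splittingFieldFor 1%AS (map_poly (in_alg E) p) {:E} /\
    'Gal({:E} / 1%AS) \isog G.

Definition solvability_complexity (K : fieldType) (Kbar : closedFieldType)
    (iota : {rmorphism K -> Kbar}) (n : nat) (f : 'M[{mpoly K[n * n]}]_n)
    (nu : nat) (gT : finGroupType) (G : {group gT}) : Prop :=
  (exists sols : seq 'M[Kbar]_n,
     [/\ uniq sols, size sols = nu & forall X, X \in sols <-> solution iota f X])
  /\
  (exists p : {poly K},
     has_galois_group p G /\
     forall x : Kbar,
       generated_field iota
         (fun y => exists X i j, solution iota f X /\ y = X i j) x
       <-> generated_field iota (fun y => root (map_poly iota p) y) x).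

(* The local ring of affine N-space at a is seen inside the function field. *)
Definition in_local_ring (L : fieldType) (N : nat) (a : 'rV[L]_N)
    (u : {fraction {mpoly L[N]}}) : Prop :=
  exists p q : {mpoly L[N]}, q.@[a 0] != 0 /\ u = tofrac p / tofrac q.

(* The ideal generated by the f_{i,j} in the local ring, not in the
   polynomial ring. *)
Definition in_local_ideal (L : fieldType) (n N : nat) (a : 'rV[L]_N)
    (f : 'M[{mpoly L[N]}]_n) (u : {fraction {mpoly L[N]}}) : Prop :=
  exists r : 'I_n -> 'I_n -> {fraction {mpoly L[N]}},
    (forall i j, in_local_ring a (r i j)) /\
    u = \sum_i \sum_j r i j * tofrac (f i j).

(* X0 has multiplicity d: the local ring modulo the ideal of the f_{i,j} has
   an L-basis with d elements, namely the classes of the e k. *)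
Definition has_multiplicity (L : fieldType) (n : nat)
    (f : 'M[{mpoly L[n * n]}]_n) (X0 : 'M[L]_n) (d : nat) : Prop :=
  exists e : 'I_d -> {fraction {mpoly L[n * n]}},
    (forall k, in_local_ring (mxvec X0) (e k)) /\
    forall u, in_local_ring (mxvec X0) u ->
      exists! c : 'rV[L]_d,
        in_local_ideal (mxvec X0) f
          (u - \sum_k tofrac (c 0 k)%:MP * e k).

(* Main.v *)
Require Import Defs.
From HB Require Import structures.
From mathcomp Require Import all_boot all_order all_fingroup all_algebra all_field.
From mathcomp Require Import mpoly ring zify.
From Stdlib Require Import Classical ClassicalEpsilon.
Import GRing.Theory Order.TTheory.
Local Open Scope ring_scope.

Set Implicit Arguments.
Unset Strict Implicit.
Unset Printing Implicit Defensive.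

(** Specialize the coefficient matrices at integer points and reduce modulo 3.
    For the chosen A, B1, B2, C the (i, j) entry of g has leading term the square
    of X i j, so the 16 squarefree monomials span every bounded-degree part of
    the quotient by (f). As g is a specialization of the generic one, there is a
    place of K with values in F_3, and by Nakayama the monomials span already
    over its valuation ring; multiplication by b = X 0 1 gets a matrix there.
    The roots of its characteristic polynomial specialize, and Frobenius lifts to
    the Galois group. At three choices of (D, F) the cycle types are (16),
    (1, 15) and (2, 7, 7): the first makes the group transitive, the second
    2-transitive, and the seventh power of the third is a transposition, hence
    the group is S_16.

    The ideal (f) is proper, since F = - (D X + g(X)) is a substitution with
    invertible linear part. As the characteristic polynomial is irreducible, the
    16 monomials are then a basis of the quotient, the entries of a solution are
    polynomials in b, and the solutions correspond to the 16 roots. Comparing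
    forms of top degree, a relation between the monomials modulo (g) gives one
    modulo (f), so they are also a basis modulo (g), which yields the
    multiplicity at 0. *)

(** * Lifting Frobenius to the Galois group *)

(** Four quadrics in four unknowns lead one to expect 2^4 = 16 solutions. When the leading terms are
    the squares of the unknowns, spanning holds whatever [D] and [F] are, so a single place serves
    both [f] and [g]. The module of all polynomials is not finitely generated over the valuation
    ring, so Nakayama is applied in each bounded degree, and the degrees of the multipliers have to
    be carried along. Spanning alone gives no independence: that comes from irreducibility, hence
    from the 16-cycle. Each of the three points has its own place, valuation ring and multiplication
    matrix, and the three matrices can be identified over [K] only once the monomials are known to
    be independent. The 16-cycle must therefore be exploited before the other two. No integral
    closure and no decomposition group is built. A prime above the place is replaced by a matching
    of the roots with their reductions that respects every polynomial relation over the valuation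
    ring. *)

Lemma mmap_comp (R S T : comNzRingType) n (h : {rmorphism S -> T})
    (f : {rmorphism R -> S}) (v : 'I_n -> S) (p : {mpoly R[n]}) :
  h (mmap f v p) = mmap (h \o f) (h \o v) p.
Proof.
rewrite /mmap rmorph_sum; apply: eq_bigr => m _.
by rewrite rmorphM /mmap1 rmorph_prod; congr (_ * _); apply: eq_bigr => i _; rewrite rmorphXn.
Qed.

Lemma mmap_eq (R S : comNzRingType) n (f g : R -> S) (v w : 'I_n -> S) (p : {mpoly R[n]}) :
  f =1 g -> v =1 w -> mmap f v p = mmap g w p.
Proof.
by move=> fg vw; rewrite /mmap; apply: eq_bigr => m _; rewrite fg (mmap1_eq _ vw).
Qed.

Lemma mmap_comp_mpoly (R S : comNzRingType) n k (f : {rmorphism R -> S}) (v : 'I_k -> S)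
    (t : n.-tuple {mpoly R[k]}) (p : {mpoly R[n]}) :
  mmap f v (p \mPo t) = mmap f (fun i => mmap f v (tnth t i)) p.
Proof.
by rewrite /comp_mpoly mmap_comp; apply: mmap_eq => // c; rewrite /= mmapC.
Qed.

Lemma mmap_msym (R S : comNzRingType) n (f : {rmorphism R -> S}) (v : 'I_n -> S)
    (s : 'S_n) (p : {mpoly R[n]}) :
  mmap f v (msym s p) = mmap f (v \o s) p.
Proof.
rewrite /msym mmap_comp; apply: mmap_eq => [c | i] /=; first by rewrite mmapC.
by rewrite mmapX mmap1U.
Qed.

Lemma mmap_map (R S T : comNzRingType) n (h : {rmorphism S -> T})
    (f : {rmorphism R -> S}) (v : 'I_n -> T) (p : {mpoly R[n]}) :
  mmap h v (map_mpoly f p) = mmap (h \o f) v p.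
Proof.
rewrite /map_mpoly mmap_comp; apply: mmap_eq => [c | i] /=; first by rewrite mmapC.
by rewrite mmapX mmap1U.
Qed.

(** By Vieta, both values of [N] are images of one element of [R] computed from the coefficients of
    [p]; injectivity of [a] makes that element zero. *)
Lemma symmetric_transfer (R : comNzRingType) (S S' : idomainType) n
    (a : {rmorphism R -> S}) (a' : {rmorphism R -> S'}) (p : {poly R})
    (x : 'I_n -> S) (y : 'I_n -> S') (N : {mpoly R[n]}) :
    injective a ->
    map_poly a p = \prod_i ('X - (x i)%:P) ->
    map_poly a' p = \prod_i ('X - (y i)%:P) ->
    N \is symmetric -> mmap a x N = 0 -> mmap a' y N = 0.
Proof.
move=> inja Dx Dy /sym_fundamental[t [<- _]].
pose c (k : 'I_n) := (-1) ^+ k.+1 * p`_(n - k.+1).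
have main (T : idomainType) (b : {rmorphism R -> T}) (z : 'I_n -> T) :
    map_poly b p = \prod_i ('X - (z i)%:P) ->
    mmap b z (t \mPo [tuple mesym n R i.+1 | i < n]) = b (t.@[c]).
  move=> Dz; rewrite mmap_comp_mpoly /meval [RHS]mmap_comp.
  apply: mmap_eq => // k; rewrite tnth_mktuple /= /c rmorphM rmorphXn rmorphN1.
  rewrite -coef_map Dz; pose cs := [tuple z i | i < n].
  have -> : \prod_i ('X - (z i)%:P) = \prod_(e <- cs) ('X - e%:P).
    by rewrite big_tuple; apply: eq_bigr => i _; rewrite tnth_mktuple.
  have kn : (k.+1 < n.+1)%N by rewrite ltnS.
  have -> := mroots_coeff cs (Ordinal kn).
  rewrite /= mulrA -exprMn mulrNN mulr1 expr1n mul1r.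
  rewrite /mesym !rmorph_sum; apply: eq_bigr => h _.
  rewrite !rmorph_prod; apply: eq_bigr => i _.
  by rewrite /= mevalXU mmapX mmap1U tnth_mktuple.
rewrite (main _ _ _ Dx) (main _ _ _ Dy) => /eqP.
by rewrite -(rmorph0 a) (inj_eq inja) => /eqP ->; rewrite rmorph0.
Qed.

Lemma mmap_polyC (R S : comNzRingType) n (f : {rmorphism R -> S}) (v : 'I_n -> S)
    (p : {mpoly R[n]}) :
  mmap (map_poly f) (fun i => (v i)%:P) (map_mpoly polyC p) = (mmap f v p)%:P.
Proof.
rewrite mmap_map (mmap_comp polyC); apply: mmap_eq => // c.
by rewrite /= map_polyC.
Qed.

(* If no ordering of the roots worked, each would come with a relation that it
   violates; combining these with powers of a new variable gives one relation
   violated by all orderings, whose symmetrization is a relation between the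
   coefficients of p. *)
Lemma specialization_of_roots (V : comNzRingType) (E L : fieldType) n
    (a : {rmorphism V -> E}) (b : {rmorphism V -> L}) (p : {poly V})
    (alpha : 'I_n -> E) (beta : 'I_n -> L) :
    injective a ->
    map_poly a p = \prod_i ('X - (alpha i)%:P) ->
    map_poly b p = \prod_i ('X - (beta i)%:P) ->
  exists s : 'S_n, forall F : {mpoly V[n]},
    mmap a alpha F = 0 -> mmap b (beta \o s) F = 0.
Proof.
move=> inja Da Db; apply: NNPP => no_s.
have [F HF] : exists F : 'S_n -> {mpoly V[n]}, forall s,
    mmap a alpha (F s) = 0 /\ mmap b (beta \o s) (F s) <> 0.
  refine (@fin_all_exists {perm 'I_n} (fun _ => {mpoly V[n]}) (fun s F =>
    mmap a alpha F = 0 /\ mmap b (beta \o s) F <> 0) _) => s.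
  apply: NNPP => no_F; apply: no_s; exists s => F F0.
  by apply: NNPP => F1; apply: no_F; exists F.
pose G : {mpoly {poly V}[n]} :=
  \sum_s ('X ^+ enum_rank s)%:MP * map_mpoly polyC (F s).
have evG (M : fieldType) (f : {rmorphism V -> M}) (v : 'I_n -> M) :
    mmap (map_poly f) (fun i => (v i)%:P) G
    = \sum_s 'X ^+ enum_rank s * (mmap f v (F s))%:P.
  rewrite rmorph_sum; apply: eq_bigr => s _.
  by rewrite rmorphM /= mmapC mmap_polyC /= map_polyXn.
pose N := \prod_(t : 'S_n) msym t G.
have symN : N \is symmetric.
  apply/issymP => s; rewrite /N rmorph_prod [RHS](reindex_inj (mulIg s)).
  by apply: eq_bigr => t _; rewrite /= msymMm.
have inja' : injective (map_poly a) := map_inj_poly inja (rmorph0 a).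
have lift (M : fieldType) (f : {rmorphism V -> M}) (v : 'I_n -> M) :
    map_poly f p = \prod_i ('X - (v i)%:P) ->
    map_poly (map_poly f) (map_poly polyC p) = \prod_i ('X - ((v i)%:P)%:P).
  move=> Dv; rewrite -map_poly_comp.
  rewrite (eq_map_poly (g := polyC \o f)) => [|c]; last by rewrite /= map_polyC.
  rewrite map_poly_comp Dv rmorph_prod; apply: eq_bigr => i _.
  by rewrite rmorphB /= map_polyX map_polyC.
have evN0 : mmap (map_poly a) (fun i => (alpha i)%:P) N = 0.
  rewrite rmorph_prod (bigD1 1%g) //= msym1m evG big1 ?mul0r // => s _.
  by have [-> _] := HF s; rewrite mulr0.
have := symmetric_transfer inja' (lift _ _ _ Da) (lift _ _ _ Db) symN evN0.
apply/eqP; rewrite rmorph_prod; apply/prodf_neq0 => t _.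
rewrite /= mmap_msym (evG _ b (beta \o t)).
apply/eqP => /(congr1 (fun q : {poly L} => q`_(enum_rank t))).
rewrite coef_sum coef0 (bigD1 t) //= coefMC coefXn eqxx mul1r big1 ?addr0.
  by have [_] := HF t.
move=> s ne_st; rewrite coefMC coefXn.
case: eqP => [/val_inj/enum_rank_inj e|_]; last by rewrite mul0r.
by rewrite e eqxx in ne_st.
Qed.

Lemma distinct_roots_lift (V : comNzRingType) (E L : fieldType) n
    (a : {rmorphism V -> E}) (b : {rmorphism V -> L}) (p : {poly V})
    (alpha : 'I_n -> E) (beta : 'I_n -> L) :
    injective a ->
    map_poly a p = \prod_i ('X - (alpha i)%:P) ->
    map_poly b p = \prod_i ('X - (beta i)%:P) ->
  injective beta -> injective alpha.
Proof.
move=> inja Da Db injb i l eq_il.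
have [s Hs] := specialization_of_roots inja Da Db.
have /Hs : mmap a alpha ('X_i - 'X_l) = 0.
  by rewrite rmorphB /= !mmapX !mmap1U eq_il subrr.
by rewrite rmorphB /= !mmapX !mmap1U => /eqP; rewrite subr_eq0 => /eqP/injb/perm_inj.
Qed.

Lemma gal_perm_roots (K : fieldType) (E : splittingFieldType K) n (q : {poly K})
    (alpha : 'I_n -> E) :
    map_poly (in_alg E) q = \prod_i ('X - (alpha i)%:P) -> injective alpha ->
  exists r : gal_of {:E} -> 'S_n, forall (x : gal_of {:E}) i, x (alpha i) = alpha (r x i).
Proof.
move=> Dq inja.
have im (x : gal_of {:E}) i : exists l, x (alpha i) = alpha l.
  have : root (map_poly (in_alg E) q) (x (alpha i)).
    have -> : map_poly (in_alg E) q = map_poly x (map_poly (in_alg E) q).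
      by rewrite -map_poly_comp; apply: eq_map_poly => c; rewrite /= linearZ rmorph1.
    rewrite fmorph_root Dq rootE horner_prod prodf_seq_eq0.
    by apply/hasP; exists i; rewrite ?mem_index_enum //= hornerXsubC subrr.
  rewrite Dq rootE horner_prod prodf_seq_eq0 => /hasP[l _] /=.
  by rewrite hornerXsubC subr_eq0 => /eqP ->; exists l.
have perm_x (x : gal_of {:E}) : exists r : 'S_n, forall i, x (alpha i) = alpha (r i).
  have [f Hf] : exists f : 'I_n -> 'I_n, forall i, x (alpha i) = alpha (f i).
    exact: fin_all_exists (im x).
  have injf : injective f.
    by move=> i l /(congr1 alpha); rewrite -!Hf => /fmorph_inj/inja.
  by exists (perm injf) => i; rewrite permE.
exact: fin_all_exists perm_x.
Qed.

(** The product over the Galois group of the factors Z - sum_i x(alpha_i) T^i has its coefficients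
    in [K]. They turn out to be finite at the place, so the specialized product has coefficients in
    [k] and is invariant under [fr]. The image by [fr] of the factor at the identity is then again a
    factor, and its index is the automorphism sought. *)
Lemma frobenius_lift (V : comNzRingType) (K k : fieldType)
    (j : {rmorphism V -> K}) (pi : {rmorphism V -> k})
    (E : splittingFieldType K) (L : fieldType) (inc : {rmorphism k -> L})
    (fr : {rmorphism L -> L}) n (p : {poly V})
    (alpha : 'I_n -> E) (beta : 'I_n -> L) (r : gal_of {:E} -> 'S_n) :
    injective j ->
    (forall x : K, (exists v, x = j v) \/ (exists v, x^-1 = j v /\ pi v = 0)) ->
    (forall c, fr (inc c) = inc c) ->
    map_poly (in_alg E \o j) p = \prod_i ('X - (alpha i)%:P) ->
    map_poly (inc \o pi) p = \prod_i ('X - (beta i)%:P) ->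
    galois 1 {:E} -> injective alpha ->
    (forall (x : gal_of {:E}) i, x (alpha i) = alpha (r x i)) ->
  exists (s : 'S_n) (x : gal_of {:E}),
    forall i, fr (beta (s i)) = beta (s (r x i)).
Proof.
move=> injj val_j fr_inc Da Db galE inja Hr.
have injaj : injective (in_alg E \o j).
  by apply: inj_comp injj; apply: fmorph_inj.
have [s Hs] := specialization_of_roots injaj Da Db; exists s.
(* The powers of the inner variable label the roots, so that a value of [lin] determines the whole
   tuple. *)
pose lin (S : comNzRingType) (v : 'I_n -> S) : {poly S} := \sum_i (v i)%:P * 'X^i.
have map_lin (S T : comNzRingType) (f : {rmorphism S -> T}) v :
    map_poly f (lin S v) = lin T (f \o v).
  rewrite rmorph_sum; apply: eq_bigr => i _.
  by rewrite rmorphM /= map_polyC map_polyXn.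
pose G := 'Gal({:E} / 1)%g.
pose P (S : comNzRingType) (v : gal_of {:E} -> 'I_n -> S) : {poly {poly S}} :=
  \prod_(x in G) ('X - (lin S (v x))%:P).
have map_P (S T : comNzRingType) (f : {rmorphism S -> T}) v :
    map_poly (map_poly f) (P S v) = P T (fun x => f \o v x).
  rewrite rmorph_prod; apply: eq_bigr => x _.
  by rewrite rmorphB /= map_polyX map_polyC /= map_lin.
pose N := P _ (fun x i => 'X_(r x i) : {mpoly V[n]}).
pose NE := P E (fun x i => x (alpha i)).
have mapN : map_poly (map_poly (mmap (in_alg E \o j) alpha)) N = NE.
  rewrite map_P; apply: eq_bigr => z _; congr ('X - _%:P).
  by apply: eq_bigr => i _; rewrite /= mmapX mmap1U Hr.
pose NL := P L (fun x i => beta (s (r x i))).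
have mapNL : map_poly (map_poly (mmap (inc \o pi) (beta \o s))) N = NL.
  rewrite map_P; apply: eq_bigr => z _; congr ('X - _%:P).
  by apply: eq_bigr => i _; rewrite /= mmapX mmap1U.
have coef_NL c d : exists e : k, NL`_c`_d = inc e.
  have /vlineP[e De] : NE`_c`_d \in (1 : {vspace E})%VS.
    rewrite -(galois_fixedField galE); apply/fixedFieldP; first exact: memvf.
    move=> x Gx; rewrite -!coef_map /= map_P.
    suff -> : P E (fun z : gal_of {:E} => x \o (fun i => z (alpha i))) = NE by [].
    rewrite /NE /P [RHS](reindex_inj (mulIg x)) /=.
    apply: eq_big => [z|z _]; first by rewrite groupMr.
    congr ('X - _%:P); apply: eq_bigr => i _.
    by rewrite /= galM ?memvf.
  rewrite -mapN !coef_map /= in De; rewrite -mapNL !coef_map /=.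
  have transfer (v : V) : e = j v -> exists e, mmap (inc \o pi) (beta \o s) N`_c`_d = inc e.
    move=> Dv; exists (pi v); apply/eqP; rewrite -subr_eq0; apply/eqP.
    rewrite -[inc (pi v)](mmapC (beta \o s) (inc \o pi)) -rmorphB.
    by apply: Hs; rewrite rmorphB /= De mmapC /= Dv subrr.
  have [[v Dv] | [v [Dv pv0]]] := val_j e; first exact: transfer Dv.
  (* If [e] were infinite at the place, its inverse [v] would have residue 0, and the relation
     saying that [v] times the coefficient is 1 would specialize to -1 = 0. The value 0 is set apart
     because its inverse is 0 by convention. *)
  have [e0 | nz_e] := eqVneq e 0; first by apply: (transfer 0); rewrite rmorph0.
  have : mmap (inc \o pi) (beta \o s) (v%:MP * N`_c`_d - 1) = 0.
    apply: Hs; rewrite rmorphB rmorphM rmorph1 /= mmapC De /= -Dv.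
    by rewrite -scalerAl mul1r scalerA mulVf // scale1r subrr.
  rewrite rmorphB rmorphM rmorph1 /= mmapC /= pv0 rmorph0 mul0r sub0r.
  by move/eqP; rewrite oppr_eq0 oner_eq0.
pose Z0 := lin L (fr \o beta \o s).
have : NL.[Z0] = 0.
  have -> : NL = P L (fun x i => fr (beta (s (r x i)))).
    rewrite -[RHS](map_P _ _ fr (fun x i => beta (s (r x i)))).
    apply/polyP => c; apply/polyP => d; rewrite !coef_map /=.
    by have [e ->] := coef_NL c d; rewrite fr_inc.
  rewrite horner_prod (bigD1 1%g) ?group1 //= hornerXsubC [X in X - _](_ : _ = lin L (fun i => fr (beta (s (r 1%g i))))).
    by rewrite subrr mul0r.
  apply: eq_bigr => i _; congr (_%:P * _); rewrite /=; do 3 congr (_ _).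
  by apply: inja; rewrite -Hr gal_id.
rewrite horner_prod => /eqP; rewrite prodf_seq_eq0 => /hasP[x _ /andP[_]].
rewrite hornerXsubC subr_eq0 => /eqP e; exists x => i.
have coef_lin v : (lin L v)`_i = v i.
  rewrite coef_sum (bigD1 i) //= coefCM coefXn eqxx mulr1 big1 ?addr0 // => l ne_li.
  by rewrite coefCM coefXn eq_sym (inj_eq val_inj) (negbTE ne_li) mulr0.
by have /= := congr1 (fun q : {poly L} => q`_i) e; rewrite !coef_lin.
Qed.

(** * Splitting fields and generation of the symmetric group *)

Lemma irreducible_factor (F : fieldType) (p : {poly F}) :
  (1 < size p)%N -> exists2 r, r %| p & irreducible_poly r.
Proof.
have [m] := ubnP (size p); elim: m p => // m IHm p lt_pm p_gt1.
(* Irreducibility is not decidable over an arbitrary field, whence the classical case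
   distinction. *)
have [irr_p | red_p] := classic (irreducible_poly p); first by exists p.
have [q [q_neq1 q_dv_p neq_qp]] : exists q : {poly F}, [/\ size q != 1%N, q %| p & ~~ (q %= p)].
  apply: NNPP => no_q; apply: red_p; split=> // q q_neq1 q_dv_p.
  by apply: contra_notT no_q => neq_qp; exists q.
have p_neq0 : p != 0 by rewrite -size_poly_gt0 ltnW.
have q_gt1 : (1 < size q)%N.
  rewrite ltn_neqAle eq_sym q_neq1 size_poly_gt0.
  by apply: contraNneq p_neq0 => q0; rewrite q0 dvd0p in q_dv_p.
have lt_qp : (size q < size p)%N.
  by rewrite ltn_neqAle dvdp_leq // andbT dvdp_size_eqp.
have [r r_dv_q irr_r] := IHm q (leq_trans lt_qp lt_pm) q_gt1.
by exists r => //; apply: dvdp_trans q_dv_p.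
Qed.

Local Notation map_alg L := (map_poly (in_alg L)).

Lemma splitting_extension (F : fieldType) (p : {poly F}) : p != 0 ->
  exists (L : fieldExtType F) (zs : seq L),
    map_alg L p %= \prod_(z <- zs) ('X - z%:P).
Proof.
have [m] := ubnP (size p); elim: m => // m IHm in F p * => lt_pm nz_p.
have [Cp|C'p] := leqP (size p) 1.
  exists F^o, [::].
  by rewrite big_nil -size_poly_eq1 size_map_poly eqn_leq Cp size_poly_gt0.
have [r r_dv_p irr_r] := irreducible_factor C'p.
have [K _ [x rx0 defK]] := irredp_FAdjoin irr_r.
have{r rx0 irr_r r_dv_p} /factor_theorem[q Dp] : root (map_alg K p) x.
  by rewrite -(divpK r_dv_p) rmorphM rootM rx0 orbT.
have Dszp : size p = size (q * ('X - x%:P)) by rewrite -Dp size_map_poly.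
have nz_q : q != 0.
  by move: nz_p; rewrite -size_poly_eq0 Dszp size_poly_eq0 mulf_eq0 => /norP[].
have [|L [zs Dq]] := IHm K q _ nz_q.
  by rewrite Dszp size_mul ?polyXsubC_eq0 ?size_XsubC ?addn2 in lt_pm.
suffices Dp' : map_alg L (map_alg K p) %= \prod_(z <- x%:A :: zs) ('X - z%:P).
  exists (baseFieldType L), (x%:A :: zs); move: Dp'.
  by rewrite -map_poly_comp -(eq_map_poly (fun a : F => baseField_scaleE a 1)).
rewrite big_cons Dp mulrC rmorphM /= rmorphB /= map_polyX map_polyC /=.
by rewrite eqp_mull.
Qed.

Lemma splitting_field_exists (F : fieldType) (p : {poly F}) : p != 0 ->
  exists L : splittingFieldType F, splittingFieldFor 1 (map_alg L p) {:L}.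
Proof.
move=> nz_p; have [L [ys Dp]] := splitting_extension nz_p.
suffices [M splitM] : exists M : fieldExtType F, splittingFieldFor 1 (map_alg M p) {:M}.
  have axM : splitting_field_axiom M.
    by exists (map_alg M p) => //; apply/polyOverP => i; rewrite coef_map memvZ // mem1v.
  pose mixM := FieldExt_isSplittingField.Build F M axM.
  pose M' : splittingFieldType F := HB.pack M mixM.
  by exists M'.
(* [L] may be too large; the subfield generated by the roots is the splitting field. *)
pose Lp := subvs_of <<1 & ys>>; pose toL := linfun (vsval : Lp -> L).
have [zs Dys] : {zs | map toL zs = ys}.
  exists (map (vsproj _) ys); rewrite -map_comp map_id_in // => y ys_y.
  by rewrite /= lfunE /= vsprojK ?seqv_sub_adjoin.
exists Lp, zs.
  set lhs := (lhs in lhs %= _); set rhs := (rhs in _ %= rhs).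
  suffices : map_poly toL lhs %= map_poly toL rhs by rewrite eqp_map.
  rewrite -Dys big_map in Dp; apply: etrans Dp; apply: congr2.
    by rewrite -map_poly_comp; apply/eq_map_poly=> x; apply: rmorph_alg.
  rewrite rmorph_prod; apply/eq_bigr=> z _.
  by rewrite /= rmorphB /= map_polyX map_polyC.
set Lzs := LHS; pose Lys := (toL @: Lzs)%VS; apply/vspaceP=> u.
have : val u \in Lys by rewrite /Lys aimg_adjoin_seq aimg1 Dys (valP u).
by case/memv_imgP=> v Lzs_v; rewrite memvf lfunE => /val_inj->.
Qed.

(** Some conjugate of [t] moves [i0]; conjugating it further by the powers of [c] yields every
    transposition of [i0] with another point, and these generate the symmetric group. *)
Lemma symmetric_group_criterion (T : finType) (G : {group {perm T}}) (i0 : T)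
    (c t : {perm T}) :
    (forall i l : T, exists2 g : {perm T}, g \in G & g i = l) ->
    c \in G -> c i0 = i0 ->
    (forall i l : T, i != i0 -> l != i0 -> exists m, (c ^+ m)%g i = l) ->
    t \in G -> (exists a b, a != b /\ t = tperm a b) ->
  G = [set: {perm T}]%G.
Proof.
move=> trG Gc c_i0 c_tr Gt [a [b [neq_ab Dt]]].
have [g Gg g_a] := trG a i0.
have tp0 l : l != i0 -> tperm i0 l \in G.
  move=> l_neq; have gb_neq : g b != i0.
    by apply: contra_neq neq_ab => gb; apply: (@perm_inj _ g); rewrite g_a gb.
  have [m c_l] := c_tr _ _ gb_neq l_neq.
  have c_m : (c ^+ m)%g i0 = i0.
    elim: (m) => [|k IHk]; first by rewrite expg0 perm1.
    by rewrite expgSr permM IHk.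
  have -> : tperm i0 l = ((t ^ g) ^ (c ^+ m))%g.
    by rewrite Dt !tpermJ g_a c_l c_m.
  by rewrite !groupJ ?groupX.
have tp x y : tperm x y \in G.
  have [-> | x_neq] := eqVneq x i0.
    by have [-> | /tp0//] := eqVneq y i0; rewrite tperm1 group1.
  have [-> | y_neq] := eqVneq y i0; first by rewrite tpermC tp0.
  have [-> | neq_xy] := eqVneq x y; first by rewrite tperm1 group1.
  have -> : tperm x y = (tperm i0 y ^ tperm i0 x)%g.
    by rewrite tpermJ tpermL tpermD // eq_sym.
  by rewrite groupJ ?tp0.
apply/val_inj/eqP; rewrite eqEsubset subsetT /=; apply/subsetP => s _.
have [ts -> _] := prod_tpermP s; elim: ts => [|u ts IHts].
  by rewrite big_nil group1.
by rewrite big_cons groupM ?tp.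
Qed.

(** The action on the roots is faithful because an automorphism fixing them fixes the field that
    they generate, which is [E]. *)
Lemma galois_group_symmetric (K : fieldType) (E : splittingFieldType K) n (q : {poly K})
    (alpha : 'I_n -> E) (r : gal_of {:E} -> 'S_n) :
    map_poly (in_alg E) q = \prod_i ('X - (alpha i)%:P) -> injective alpha ->
    splittingFieldFor 1 (map_poly (in_alg E) q) {:E} ->
    (forall (x : gal_of {:E}) i, x (alpha i) = alpha (r x i)) ->
    (forall s : 'S_n, exists x, r x = s) ->
  'Gal({:E} / 1) \isog [set: 'S_n].
Proof.
move=> Dq inja [zs Dzs genE] Hr surj.
have rM : {in 'Gal({:E} / 1)%g &, {morph r : x y / (x * y)%g}}.
  move=> x y _ _; apply/permP => i; apply: inja.
  by rewrite permM -!Hr galM ?memvf.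
pose f := Morphism rM.
have full x : x \in 'Gal({:E} / 1)%g by rewrite gal_kHom ?sub1v // k1HomE ahomWin.
have inj_f : ('injm f)%g.
  apply/injmP => x y _ _ /= eq_r; apply/eqP/gal_eqP => u _.
  pose z := (x * y^-1)%g.
  have z_alpha i : z (alpha i) = alpha i.
    rewrite galM ?memvf // Hr eq_r -Hr -galM ?memvf //.
    by rewrite mulgV gal_id.
  have : u \in fixedSpace z.
    suffices : (<<1 & zs>> <= fixedSpace z)%VS by rewrite genE => /subvP; apply; apply: memvf.
    rewrite -[fixedSpace z]subfield_closed agenvS // subv_add sub1v; apply/span_subvP => v zs_v.
    have : root (map_poly (in_alg E) q) v.
      by rewrite (eqp_root Dzs) root_prod_XsubC.
    rewrite Dq rootE horner_prod prodf_seq_eq0 => /hasP[l _] /=.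
    by rewrite hornerXsubC subr_eq0 => /eqP ->; apply/fixedSpaceP; apply: z_alpha.
  move/fixedSpaceP; rewrite galM ?memvf // => e.
  by rewrite -{2}e -galM ?memvf // mulVg gal_id.
have <- : (f @* 'Gal({:E} / 1))%g = [set: 'S_n].
  apply/eqP; rewrite eqEsubset subsetT; apply/subsetP => s _.
  by have [x <-] := surj s; rewrite -[r x]/(f x) mem_morphim.
exact: sub_isog.
Qed.

(** * Places *)

(** A place is kept as a relation, an element without image being sent to infinity; composites and
    places defined through fractions are then direct to write down. The valuation ring is recovered
    afterwards as the domain of the relation. *)
Record place (K k : fieldType) := Place {
  res : K -> k -> Prop;
  res1 : res 1 1;
  resB : forall x y x' y', res x y -> res x' y' -> res (x - x') (y - y');
  resM : forall x y x' y', res x y -> res x' y' -> res (x * x') (y * y');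
  res_unique : forall x y y', res x y -> res x y' -> y = y';
  res_total : forall x, (exists y, res x y) \/ res x^-1 0
}.

Section PlaceTheory.
Variables (K k : fieldType) (pl : place K k).

Lemma res0 : res pl 0 0.
Proof. by have := resB (res1 pl) (res1 pl); rewrite !subrr. Qed.

Lemma resN x y : res pl x y -> res pl (- x) (- y).
Proof. by move/(resB res0); rewrite !sub0r. Qed.

Lemma resD x y x' y' : res pl x y -> res pl x' y' -> res pl (x + x') (y + y').
Proof. by move=> xy /resN/(resB xy); rewrite !opprK. Qed.

Lemma res_int (n : int) : res pl n%:~R n%:~R.
Proof.
have nat_n m : res pl m%:R m%:R.
  by elim: m => [|m IHm]; rewrite ?mulr0n ?mulrS; [apply: res0 | apply/resD/IHm/res1].
by case: n => n; [apply: nat_n | apply/resN/nat_n].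
Qed.

Lemma resV x y : res pl x y -> y != 0 -> res pl x^-1 y^-1.
Proof.
move=> xy nz_y; have nz_x : x != 0.
  by apply: contraNneq nz_y => x0; rewrite x0 in xy; apply/eqP/(res_unique xy)/res0.
have [[z xz] | x0] := res_total pl x^-1; last first.
  by rewrite invrK in x0; rewrite (res_unique xy x0) eqxx in nz_y.
have e : y * z = 1.
  by apply: res_unique (resM xy xz) _; rewrite mulfV //; apply: res1.
by rewrite -[y^-1]mulr1 -e mulKf.
Qed.

(** Excluded middle makes the domain a boolean predicate, so that the valuation ring can be a
    subtype inheriting its ring structure from [K]. *)
Definition valuation_pred : {pred K} :=
  fun x => if excluded_middle_informative (exists y, res pl x y) then true else false.

Lemma valuation_predP x : reflect (exists y, res pl x y) (x \in valuation_pred).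
Proof.
rewrite unfold_in /=; case: excluded_middle_informative => h; exact: (iffP idP).
Qed.

Lemma valuation_pred_subring : subring_closed valuation_pred.
Proof.
split; first by apply/valuation_predP; exists 1; apply: res1.
  move=> x x' /valuation_predP[y xy] /valuation_predP[y' xy'].
  by apply/valuation_predP; exists (y - y'); apply: resB.
move=> x x' /valuation_predP[y xy] /valuation_predP[y' xy'].
by apply/valuation_predP; exists (y * y'); apply: resM.
Qed.

HB.instance Definition _ :=
  GRing.isSubringClosed.Build K valuation_pred valuation_pred_subring.

Record valuation_ring := ValuationRing {
  valuation_val :> K; _ : valuation_val \in valuation_pred }.

HB.instance Definition _ := [isSub for valuation_val].
HB.instance Definition _ := [Choice of valuation_ring by <:].
HB.instance Definition _ := [SubChoice_isSubComNzRing of valuation_ring by <:].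

Lemma residue_subproof (v : valuation_ring) : exists y, res pl (val v) y.
Proof. exact/valuation_predP/(valP v). Qed.

Definition residue (v : valuation_ring) : k :=
  proj1_sig (constructive_indefinite_description _ (residue_subproof v)).

Lemma residueP v : res pl (val v) (residue v).
Proof. exact: proj2_sig (constructive_indefinite_description _ _). Qed.

Lemma residue_is_zmod_morphism : zmod_morphism residue.
Proof.
move=> v w; apply: res_unique (residueP _) _.
by rewrite rmorphB /=; apply: resB; apply: residueP.
Qed.

Lemma residue_is_monoid_morphism : monoid_morphism residue.
Proof.
split; first by apply: res_unique (residueP _) _; rewrite rmorph1; apply: res1.
move=> v w; apply: res_unique (residueP _) _.
by rewrite rmorphM /=; apply: resM; apply: residueP.
Qed.

HB.instance Definition _ :=
  GRing.isZmodMorphism.Build valuation_ring k residue residue_is_zmod_morphism.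
HB.instance Definition _ :=
  GRing.isMonoidMorphism.Build valuation_ring k residue residue_is_monoid_morphism.

Lemma res_lift x y : res pl x y -> exists v : valuation_ring, x = val v /\ residue v = y.
Proof.
move=> xy; have Vx : x \in valuation_pred by apply/valuation_predP; exists y.
exists (ValuationRing Vx); split=> //.
exact: (res_unique (residueP (ValuationRing Vx)) xy).
Qed.

Lemma valuation_ring_total (x : K) :
  (exists v : valuation_ring, x = val v) \/
  (exists v : valuation_ring, x^-1 = val v /\ residue v = 0).
Proof.
have [[y xy] | x0] := res_total pl x; last by right; apply: res_lift.
by left; have [v [-> _]] := res_lift xy; exists v.
Qed.

End PlaceTheory.

Lemma place_comp (K k k' : fieldType) (pl : place K k) (pl' : place k k') :
  exists q : place K k', forall x y z, res pl x y -> res pl' y z -> res q x z.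
Proof.
pose r x z := exists2 y, res pl x y & res pl' y z.
suffices [q Dq] : exists q : place K k', res q = r.
  by exists q => x y z xy yz; rewrite Dq; exists y.
have r1 : r 1 1 by exists 1; apply: res1.
have rB x y x' y' : r x y -> r x' y' -> r (x - x') (y - y').
  by move=> [z xz zy] [z' xz' zy']; exists (z - z'); apply: resB.
have rM x y x' y' : r x y -> r x' y' -> r (x * x') (y * y').
  by move=> [z xz zy] [z' xz' zy']; exists (z * z'); apply: resM.
have r_unique x y y' : r x y -> r x y' -> y = y'.
  move=> [z xz zy] [z' xz' zy']; rewrite -(res_unique xz xz') in zy'.
  exact: res_unique zy zy'.
suffices r_total x : (exists y, r x y) \/ r x^-1 0 by exists (Place r1 rB rM r_unique r_total).
have [[y xy] | x0] := res_total pl x; last by right; exists 0 => //; apply: res0.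
have [[z yz] | y0] := res_total pl' y; first by left; exists z, y.
(* For [y = 0] the fact [y0] says nothing, since the inverse of 0 is 0. *)
have [y_0 | nz_y] := eqVneq y 0; first by left; exists 0, 0; rewrite -?y_0 // y_0; apply: res0.
by right; exists y^-1 => //; apply: resV.
Qed.

(** This is the p-adic place; its values on integers need not be recorded, since [res_int] forces
    them. *)
Lemma padic_place p : prime p -> exists pl : place rat 'F_p, True.
Proof.
move=> pr_p.
have F0 (n : int) : (n%:~R == 0 :> 'F_p) = (p %| `|n|)%N.
  by rewrite {1}[n]intEsign rmorphM rmorphXn rmorphN1 mulf_eq0 signr_eq0 /= (dvdn_pcharf (pchar_Fp pr_p)).
pose r (x : rat) (y : 'F_p) :=
  exists n m : int, [/\ m%:~R != 0 :> 'F_p, x = n%:~R / m%:~R & y = n%:~R / m%:~R].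
have nzQ (m : int) : m%:~R != 0 :> 'F_p -> m%:~R != 0 :> rat.
  by rewrite intr_eq0; apply: contraNneq => ->.
have r1 : r 1 1 by exists 1, 1; rewrite oner_eq0 !divr1.
have rB x y x' y' : r x y -> r x' y' -> r (x - x') (y - y').
  move=> [n [m [nz_m -> ->]]] [n' [m' [nz_m' -> ->]]].
  exists (n * m' - n' * m), (m * m').
  rewrite rmorphM mulf_neq0 //=; split=> //.
    by rewrite rmorphB !rmorphM /=; field; rewrite !nzQ.
  by rewrite rmorphB !rmorphM /=; field; rewrite nz_m nz_m'.
have rM x y x' y' : r x y -> r x' y' -> r (x * x') (y * y').
  move=> [n [m [nz_m -> ->]]] [n' [m' [nz_m' -> ->]]].
  by exists (n * n'), (m * m'); rewrite !rmorphM /= mulf_neq0 // !mulf_div.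
have r_unique x y y' : r x y -> r x y' -> y = y'.
  move=> [n [m [nz_m -> ->]]] [n' [m' [nz_m' e ->]]].
  apply/eqP; rewrite eqr_div // -!rmorphM; apply/eqP; congr (_%:~R).
  by apply/eqP; rewrite -(eqr_int rat) !rmorphM /= -eqr_div ?nzQ //; apply/eqP.
suffices r_total x : (exists y, r x y) \/ r x^-1 0 by exists (Place r1 rB rM r_unique r_total).
have [nz_d | z_d] := boolP ((denq x)%:~R != 0 :> 'F_p).
  by left; eexists; exists (numq x), (denq x); split=> //; rewrite divq_num_den.
right; exists (denq x), (numq x); move: z_d; rewrite negbK => /eqP z_d.
split; last by rewrite z_d mul0r.
  have := coprime_num_den x; rewrite F0; apply: contraL => dv_n.
  move/eqP: z_d; rewrite F0 => dv_d; apply/negP => /eqP cop.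
  have : (p %| gcdn `|numq x| `|denq x|)%N by rewrite dvdn_gcd dv_n.
  by rewrite cop dvdn1; case: (p) pr_p => [|[]].
by rewrite -{1}[x]divq_num_den invf_div.
Qed.

(** * Lowest terms of polynomials and places of a rational function field *)

Definition low (R : nzRingType) n (m : 'X_{1..n}) (P : {mpoly R[n]}) :=
  forall m' : 'X_{1..n}, (m' < m)%O -> P@_m' = 0.

Section Low.
Variables (R : comNzRingType) (n : nat).
Implicit Types (m : 'X_{1..n}) (P Q : {mpoly R[n]}).

Lemma low_mlast P : low (mlast P) P.
Proof. by move=> m; apply: mcoeff_lt_mlast. Qed.

Lemma low_le m m' P : (m <= m')%O -> low m' P -> low m P.
Proof. by move=> le_mm lowP m1 lt_m1; apply: lowP (lt_le_trans lt_m1 le_mm). Qed.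

Lemma lowB m P Q : low m P -> low m Q -> low m (P - Q).
Proof. by move=> lowP lowQ m' lt_m'; rewrite mcoeffB lowP ?lowQ ?subrr. Qed.

(** The monomial order is compatible with addition, so among monomials above [m1] and [m2] only
    these two add up to [m1 + m2]. As [low] allows the coefficient at [m] to vanish, it is also
    stable under differences. *)
Lemma low_mul m1 m2 P Q : low m1 P -> low m2 Q ->
  low (m1 + m2)%MM (P * Q) /\ (P * Q)@_(m1 + m2) = P@_m1 * Q@_m2.
Proof.
move=> lowP lowQ; split=> [m lt_m|]; rewrite mcoeffM.
  apply: big1 => -[k1 k2] /= /eqP Dm.
  have [lt_k1 | le_k1] := ltP (bmnm k1) m1; first by rewrite lowP ?mul0r.
  have [lt_k2 | le_k2] := ltP (bmnm k2) m2; first by rewrite lowQ ?mulr0.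
  by have := lem_add le_k1 le_k2; rewrite -Dm leNgt lt_m.
have lt1 : (mdeg m1 < (mdeg (m1 + m2)).+1)%N by rewrite ltnS mdegD leq_addr.
have lt2 : (mdeg m2 < (mdeg (m1 + m2)).+1)%N by rewrite ltnS mdegD leq_addl.
rewrite (bigD1 (BMultinom lt1, BMultinom lt2)) //= big1 ?addr0 //.
move=> [k1 k2] /andP[/eqP Dm ne_k] /=; rewrite /= in Dm.
have [lt_k1 | le_k1] := ltP (bmnm k1) m1; first by rewrite lowP ?mul0r.
have [lt_k2 | le_k2] := ltP (bmnm k2) m2; first by rewrite lowQ ?mulr0.
case/negP: ne_k; rewrite xpair_eqE -!val_eqE /=.
have [lt_k1 | eq1] := eqVneq (bmnm k1) m1; last first.
  have lt1' : (m1 < bmnm k1)%O by rewrite lt_neqAle eq_sym eq1.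
  by have := ltmc_le_add lt1' le_k2; rewrite -Dm ltxx.
by move: Dm; rewrite lt_k1 => /addmI <-; rewrite !eqxx.
Qed.

End Low.

Section GenericPlace.
Variables (K : fieldType) (phi : {rmorphism rat -> K}) (n : nat) (w : 'I_n -> K).
Hypothesis indep : forall P : {mpoly rat[n]}, mmap phi w P = 0 -> P = 0.
Hypothesis frac : forall x, exists N M : {mpoly rat[n]},
  M != 0 /\ x = mmap phi w N / mmap phi w M.

Lemma mmap_neq0 (M : {mpoly rat[n]}) : M != 0 -> mmap phi w M != 0.
Proof. by apply: contraNneq => /indep ->. Qed.

(* N / M is sent to the quotient of the coefficients at the lowest monomial of
   M (0 if that of N is larger, infinity if it is smaller). *)
Lemma origin_place : exists pl : place K rat,
  forall P : {mpoly rat[n]}, res pl (mmap phi w P) P@_0%MM.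
Proof.
pose r x y := exists N M m, [/\ low m N, low m M, M@_m = 1,
  N@_m = y & x = mmap phi w N / mmap phi w M].
have nz1 (M : {mpoly rat[n]}) m : M@_m = 1 -> M != 0.
  by move=> M1; apply/eqP => M0; move/eqP: M1; rewrite M0 mcoeff0 eq_sym oner_eq0.
have low0 (P : {mpoly rat[n]}) : low 0%MM P by move=> m; rewrite ltNge le0x.
have low1 : low (0%MM : 'X_{1..n}) (1 : {mpoly rat[n]}) by apply: low0.
have one1 : (1 : {mpoly rat[n]})@_0%MM = 1 by rewrite mcoeff1 eqxx.
have rP P : r (mmap phi w P) P@_0%MM.
  by exists P, 1, 0%MM; split=> //; rewrite rmorph1 divr1.
have r1 : r 1 1 by have := rP 1; rewrite rmorph1 one1.
have rB x y x' y' : r x y -> r x' y' -> r (x - x') (y - y').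
  move=> [N [M [m [lN lM M1 Ny ->]]]] [N' [M' [m' [lN' lM' M1' Ny' ->]]]].
  have [l1 c1] := low_mul lN lM'; have [l2 c2] := low_mul lM lN'.
  have [l3 c3] := low_mul lM lM'.
  exists (N * M' - M * N'), (M * M'), (m + m')%MM; split=> //.
  - exact: lowB.
  - by rewrite c3 M1 M1' mulr1.
  - by rewrite mcoeffB c1 c2 M1 M1' Ny Ny' mulr1 mul1r.
  rewrite rmorphB !rmorphM /=; field.
  by rewrite (mmap_neq0 (nz1 _ _ M1)) (mmap_neq0 (nz1 _ _ M1')).
have rM x y x' y' : r x y -> r x' y' -> r (x * x') (y * y').
  move=> [N [M [m [lN lM M1 Ny ->]]]] [N' [M' [m' [lN' lM' M1' Ny' ->]]]].
  have [l1 c1] := low_mul lN lN'; have [l3 c3] := low_mul lM lM'.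
  exists (N * N'), (M * M'), (m + m')%MM; split=> //.
  - by rewrite c3 M1 M1' mulr1.
  - by rewrite c1 Ny Ny'.
  by rewrite !rmorphM /= mulf_div.
have r_unique x y y' : r x y -> r x y' -> y = y'.
  move=> [N [M [m [lN lM M1 <- ->]]]] [N' [M' [m' [lN' lM' M1' <- /eqP]]]].
  rewrite eqr_div ?(mmap_neq0 (nz1 _ _ M1)) ?(mmap_neq0 (nz1 _ _ M1')) //.
  rewrite -!rmorphM /= -subr_eq0 -rmorphB => /eqP/indep/eqP.
  rewrite subr_eq0 => /eqP e.
  have [_ c1] := low_mul lN lM'; have [_] := low_mul lN' lM.
  by rewrite addmC -e c1 M1 M1' !mulr1.
suffices r_total x : (exists y, r x y) \/ r x^-1 0.
  by exists (Place r1 rB rM r_unique r_total).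
have [N [M [nz_M ->]]] := frac x.
have [-> | nz_N] := eqVneq N 0.
  by left; exists 0; have := rP 0; rewrite rmorph0 mul0r mcoeff0.
(* Dividing by the lowest coefficient of [Q] gives the required normal form as soon as [P] starts no
   lower than [Q]; one of N / M and M / N always qualifies. *)
have step (P Q : {mpoly rat[n]}) : Q != 0 -> (mlast Q <= mlast P)%O ->
    r (mmap phi w P / mmap phi w Q) (P@_(mlast Q) / Q@_(mlast Q)).
  move=> nz_Q le_QP; set m := mlast Q in le_QP *.
  have nz_c : Q@_m != 0 by rewrite -mcoeff_msupp mlast_supp.
  exists ((Q@_m)^-1 *: P), ((Q@_m)^-1 *: Q), m; split.
  - by move=> m1 lt_m1; rewrite mcoeffZ (low_le le_QP (@low_mlast _ _ P)) ?mulr0 //.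
  - by move=> m1 lt_m1; rewrite mcoeffZ [X in _ * X]mcoeff_lt_mlast ?mulr0.
  - by rewrite mcoeffZ mulVf.
  - by rewrite mcoeffZ mulrC.
  by rewrite !mmapZ -mulf_div divff ?mul1r // fmorph_eq0 invr_eq0.
have [le_MN | lt_NM] := leP (mlast M) (mlast N).
  by left; eexists; apply: step.
right; rewrite invf_div; have := step M N nz_N (ltW lt_NM).
by rewrite (mcoeff_lt_mlast lt_NM) mul0r.
Qed.

End GenericPlace.

(** The shifted generators [v i - c i] are again independent and generate the same fractions. Their
    place at the origin sends [v i] to the integer [c i], and the p-adic place follows. *)
Lemma generic_place (K : fieldType) (phi : {rmorphism rat -> K}) n (v : 'I_n -> K)
    (c : 'I_n -> int) p :
    (forall P : {mpoly rat[n]}, mmap phi v P = 0 -> P = 0) ->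
    (forall x, exists N M : {mpoly rat[n]},
      M != 0 /\ x = mmap phi v N / mmap phi v M) ->
    prime p ->
  exists pl : place K 'F_p, forall i, res pl (v i) (c i)%:~R.
Proof.
move=> indep frac pr_p; pose w i := v i - (c i)%:~R.
pose shl : n.-tuple {mpoly rat[n]} := [tuple 'X_i + (c i)%:~R | i < n].
pose shr : n.-tuple {mpoly rat[n]} := [tuple 'X_i - (c i)%:~R | i < n].
have ev_shl (P : {mpoly rat[n]}) : mmap phi w (P \mPo shl) = mmap phi v P.
  rewrite mmap_comp_mpoly; apply: mmap_eq => // i.
  by rewrite tnth_mktuple rmorphD /= mmapX mmap1U rmorph_int subrK.
have ev_shr (P : {mpoly rat[n]}) : mmap phi v (P \mPo shr) = mmap phi w P.
  rewrite mmap_comp_mpoly; apply: mmap_eq => // i.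
  by rewrite tnth_mktuple rmorphB /= mmapX mmap1U rmorph_int.
have shrK (P : {mpoly rat[n]}) : (P \mPo shr) \mPo shl = P.
  rewrite -[RHS]comp_mpoly_id -[LHS]/(mmap (@mpolyC n rat) (tnth shl) (P \mPo shr)).
  rewrite mmap_comp_mpoly; apply: mmap_eq => // i.
  by rewrite !tnth_mktuple rmorphB /= mmapX mmap1U rmorph_int tnth_mktuple addrK.
have indep_w (P : {mpoly rat[n]}) : mmap phi w P = 0 -> P = 0.
  by rewrite -ev_shr => /indep e; rewrite -[P]shrK e rmorph0.
have frac_w x : exists N M : {mpoly rat[n]}, M != 0 /\ x = mmap phi w N / mmap phi w M.
  have [N [M [nz_M ->]]] := frac x; exists (N \mPo shl), (M \mPo shl).
  rewrite !ev_shl; split=> //; apply: contraNneq nz_M => M0.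
  by apply/eqP/indep; rewrite -ev_shl M0 rmorph0.
have [pl1 Hpl1] := origin_place indep_w frac_w.
have [pl2 _] := padic_place pr_p.
have [pl Hpl] := place_comp pl1 pl2; exists pl => i.
apply: Hpl (res_int pl2 (c i)).
have := Hpl1 ('X_i + (c i)%:~R).
rewrite rmorphD /= mmapX mmap1U rmorph_int subrK mcoeffD mcoeffX -(rmorph_int (@mpolyC n rat)).
by rewrite mcoeffC eqxx mulr1 mnm1_eq0 add0r.
Qed.

Lemma generated_frac (K : fieldType) (phi : {rmorphism rat -> K}) n (v : 'I_n -> K) (x : K) :
    (forall P : {mpoly rat[n]}, mmap phi v P = 0 -> P = 0) ->
    generated_field phi (fun y => exists k, y = v k) x ->
  exists N M : {mpoly rat[n]}, M != 0 /\ x = mmap phi v N / mmap phi v M.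
Proof.
move=> indep; have nzev (M : {mpoly rat[n]}) : M != 0 -> mmap phi v M != 0.
  by apply: contraNneq => /indep ->.
have poly P : exists N M : {mpoly rat[n]}, M != 0 /\ mmap phi v P = mmap phi v N / mmap phi v M.
  by exists P, 1; rewrite rmorph1 divr1 oner_neq0.
elim=> [a | y [k ->] | y z _ [N [M [nz_M ->]]] _ [N' [M' [nz_M' ->]]]
       | y z _ [N [M [nz_M ->]]] _ [N' [M' [nz_M' ->]]]].
- by have := poly a%:MP; rewrite mmapC.
- by have := poly 'X_k; rewrite mmapX mmap1U.
- exists (N * M' - N' * M), (M * M'); split; first by rewrite mulf_neq0.
  by rewrite rmorphB !rmorphM /=; field; rewrite !nzev.
have [-> | nz_N'] := eqVneq N' 0.
  by rewrite rmorph0 mul0r invr0 mulr0; have := poly 0; rewrite rmorph0.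
exists (N * M'), (M * N'); split; first by rewrite mulf_neq0.
by rewrite !rmorphM /= invf_div mulf_div.
Qed.

(** * Spanning the quotient by squarefree monomials *)

(** The exponents are the binary digits of [k], so the 16 indices run over the subsets of the four
    variables and the index 0 gives the monomial 1. *)
Definition squarefree_mon (k : 'I_16) : 'X_{1..2 * 2} :=
  [multinom (odd (k %/ 2 ^ i) : nat) | i < 2 * 2].
Notation emon := squarefree_mon.

Lemma emonP (m : 'X_{1..2 * 2}) : (forall i, (m i <= 1)%N) -> exists k, m = emon k.
Proof.
move=> m1; pose b i := odd (m i).
have Dm i : m i = b i :> nat by rewrite /b; case: (m i) (m1 i) => [|[]].
pose o k (h : (k < 4)%N) : 'I_(2 * 2) := Ordinal h.
pose k := (b (@o 0 isT) + 2 * b (@o 1 isT) + 4 * b (@o 2 isT) + 8 * b (@o 3 isT))%N.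
have k16 : (k < 16)%N by rewrite /k; do 4 case: (b _).
exists (Ordinal k16); apply/mnmP => i; rewrite mnmE Dm /= /k.
case: i => [[|[|[|[|i]]]] lt_i] //=; rewrite ?(bool_irrelevance lt_i isT) /o;
  do 4 case: (b _); by [].
Qed.

Section Span.
Variable R : comNzRingType.
Implicit Types (f : 'M[{mpoly R[2 * 2]}]_2) (h : {mpoly R[2 * 2]}).

(** As [msize] is the degree plus one, the multipliers have degree at most d - 2, and vanish when d
    < 2; for quadratic [f] every product then stays in degree at most [d]. This bound makes Nakayama
    applicable and later permits the comparison of top forms. *)
Definition ideal_le f d h := exists r : 'M[{mpoly R[2 * 2]}]_2,
  (forall i j, (msize (r i j) <= d.-1)%N) /\ h = \sum_i \sum_j r i j * f i j.

Definition reduces f d h := exists c : 'I_16 -> R,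
  (forall k, (d < mdeg (emon k))%N -> c k = 0) /\
  ideal_le f d (h - \sum_k c k *: 'X_[emon k]).

Definition spans f := forall d m, (mdeg m <= d)%N -> reduces f d 'X_[m].

Lemma ideal_leP f d a h h' : ideal_le f d h -> ideal_le f d h' -> ideal_le f d (a *: h + h').
Proof.
move=> [r [dr ->]] [r' [dr' ->]]; exists (\matrix_(i, j) (a *: r i j + r' i j)).
split=> [i j|].
  rewrite mxE; apply: leq_trans (msizeD_le _ _) _.
  by rewrite geq_max dr' (leq_trans (msizeZ_le _ _)) ?dr.
rewrite scaler_sumr -big_split; apply: eq_bigr => i _ /=.
rewrite scaler_sumr -big_split; apply: eq_bigr => j _ /=.
by rewrite mxE mulrDl scalerAl.
Qed.

Lemma ideal_le0 f d : ideal_le f d 0.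
Proof.
exists 0; split=> [i j|]; first by rewrite mxE msize0.
by rewrite big1 // => i _; rewrite big1 // => j _; rewrite mxE mul0r.
Qed.

Lemma reducesP f d a h h' : reduces f d h -> reduces f d h' -> reduces f d (a *: h + h').
Proof.
move=> [c [dc hc]] [c' [dc' hc']]; exists (fun k => a * c k + c' k); split=> [k dk|].
  by rewrite dc ?dc' // mulr0 addr0.
rewrite (_ : _ - _ = a *: (h - \sum_k c k *: 'X_[emon k]) + (h' - \sum_k c' k *: 'X_[emon k])).
  exact: ideal_leP.
rewrite scalerBr scaler_sumr addrACA -opprD -big_split /=; congr (_ - _).
by apply: eq_bigr => k _; rewrite scalerDl scalerA.
Qed.

Lemma reduces0 f d : reduces f d 0.
Proof.
exists (fun=> 0); split=> //; rewrite big1 ?subr0; first exact: ideal_le0.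
by move=> k _; rewrite scale0r.
Qed.

Lemma ideal_le_reduces f d h : ideal_le f d h -> reduces f d h.
Proof.
move=> hf; exists (fun=> 0); split=> //.
by rewrite big1 ?subr0 // => k _; rewrite scale0r.
Qed.

Lemma reduces_sum f d (I : eqType) (s : seq I) (a : I -> R) (h : I -> {mpoly R[2 * 2]}) :
  (forall i, i \in s -> reduces f d (h i)) -> reduces f d (\sum_(i <- s) a i *: h i).
Proof.
move=> hs; rewrite big_seq; elim/big_rec: _ => [|i q s_i IHq]; first exact: reduces0.
exact: reducesP (hs i s_i) IHq.
Qed.

Lemma spans_reduces f d h : spans f -> (msize h <= d.+1)%N -> reduces f d h.
Proof.
move=> spf le_h; rewrite [h]mpolyE; apply: reduces_sum => m /msize_mdeg_lt lt_m.
by apply: spf; rewrite -ltnS (leq_trans lt_m).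
Qed.

Definition weight (w : 'I_(2 * 2) -> nat) (m : 'X_{1..2 * 2}) := (\sum_i w i * m i)%N.

Lemma weightD w m m' : weight w (m + m') = (weight w m + weight w m')%N.
Proof. by rewrite -big_split; apply: eq_bigr => i _; rewrite mnmDE mulnDr. Qed.

Lemma weightU w v : weight w U_(v) = w v.
Proof.
rewrite /weight (bigD1 v) //= mnm1E eqxx muln1 big1 ?addn0 // => i ne_iv.
by rewrite mnm1E eq_sym (negbTE ne_iv) muln0.
Qed.

(** A monomial that is not squarefree contains some square, which is replaced by terms of smaller
    weight without raising the degree. Induction on the weight terminates at squarefree
    monomials. *)
Lemma spans_of_squares f (w : 'I_(2 * 2) -> nat) :
    (forall v, exists (r : 'M[R]_2) (q : {mpoly R[2 * 2]}),
      'X_v ^+ 2 = \sum_i \sum_j r i j *: f i j + q /\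
      forall m, m \in msupp q -> (mdeg m <= 2)%N /\ (weight w m < 2 * w v)%N) ->
  spans f.
Proof.
move=> sq d m; have [s] := ubnP (weight w m); elim: s m => // s IHs m lt_ms le_md.
have [[v v_gt1] | no_v] := classic (exists v, (1 < m v)%N); last first.
  have [k Dk] : exists k, m = emon k.
    by apply: emonP => i; rewrite leqNgt; apply/negP => i_gt1; apply: no_v; exists i.
  rewrite Dk in le_md *; exists (fun l => (l == k)%:R); split=> [l lt_l|].
    by case: eqP lt_l => // ->; rewrite ltnNge le_md.
  rewrite (bigD1 k) //= eqxx scale1r big1 ?addr0 ?subrr; first exact: ideal_le0.
  by move=> l /negbTE ->; rewrite scale0r.
pose m' := (m - (U_(v) + U_(v)))%MM.
have Dm : m = (m' + (U_(v) + U_(v)))%MM.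
  rewrite submK //; apply/mnm_lepP => i; rewrite mnmDE mnm1E.
  by case: eqP => [<-|].
have [r [q [Dsq Hq]]] := sq v.
have -> : 'X_[m] = 1 *: (\sum_i \sum_j ('X_[m'] * (r i j)%:MP) * f i j)
    + \sum_(mu <- msupp q) q@_mu *: 'X_[m' + mu].
  rewrite scale1r Dm mpolyXD mpolyXD -expr2 Dsq mulrDr mulr_sumr; congr (_ + _).
    apply: eq_bigr => i _; rewrite mulr_sumr; apply: eq_bigr => j _.
    by rewrite -mulrA mul_mpolyC.
  rewrite {1}[q]mpolyE mulr_sumr; apply: eq_bigr => mu _.
  by rewrite mpolyXD scalerAr.
have dm' : (mdeg m' + 2 = mdeg m)%N by rewrite [in RHS]Dm !mdegD !mdeg1.
apply: reducesP; last first.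
  apply: reduces_sum => mu /Hq[dmu wmu]; apply: IHs.
    by move: lt_ms; rewrite [in weight w m]Dm !weightD !weightU; lia.
  by rewrite mdegD; lia.
apply: ideal_le_reduces; exists (\matrix_(i, j) ('X_[m'] * (r i j)%:MP)); split.
  move=> i j; rewrite mxE mulrC mul_mpolyC; apply: leq_trans (msizeZ_le _ _) _.
  by rewrite msizeX; lia.
by apply: eq_bigr => i _; apply: eq_bigr => j _; rewrite mxE.
Qed.

End Span.

(** The matrix 1 - c has a determinant of residue 1, hence invertible, and multiplying by its
    adjugate expresses each [x i] through elements of [W]. *)
Lemma nakayama (V : comNzRingType) (k : fieldType) (pi : {rmorphism V -> k})
    (U : lmodType V) N (x : 'I_N -> U) (W : U -> Prop) :
    (forall v, pi v != 0 -> exists u, u * v = 1) ->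
    W 0 -> (forall a u u', W u -> W u' -> W (a *: u + u')) ->
    (forall i, exists c : 'I_N -> V, (forall l, pi (c l) = 0) /\ W (x i - \sum_l c l *: x l)) ->
  forall i, W (x i).
Proof.
move=> units W0 WP Hx.
have Wsum (a : 'I_N -> V) u : (forall i, W (u i)) -> W (\sum_i a i *: u i).
  by move=> Wu; elim/big_rec: _ => // i z _ Wz; apply: WP.
have [c Hc] := fin_all_exists Hx.
pose Q : 'M[V]_N := 1%:M - \matrix_(i, l) c i l.
have [u Du] : exists u, u * \det Q = 1.
  apply: units; rewrite -det_map_mx rmorphB /= map_mx1.
  rewrite (_ : map_mx pi _ = 0) ?subr0 ?det1 ?oner_eq0 //.
  by apply/matrixP => i l; rewrite !mxE; have [-> _] := Hc i.
move=> i; have -> : x i = \sum_m (u * (\adj Q) i m) *: \sum_l Q m l *: x l.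
  transitivity (\sum_l (u * (\adj Q *m Q) i l) *: x l).
    rewrite mul_adj_mx (bigD1 i) //= mxE eqxx mulr1n Du scale1r big1 ?addr0 // => l ne_li.
    by rewrite mxE eq_sym (negbTE ne_li) mulr0n mulr0 scale0r.
  under [RHS]eq_bigr do rewrite scaler_sumr.
  rewrite exchange_big; apply: eq_bigr => l _ /=.
  rewrite mxE mulr_sumr scaler_suml; apply: eq_bigr => m _.
  by rewrite scalerA mulrA.
apply: Wsum => m; have [_] := Hc m; congr W.
under [RHS]eq_bigr do rewrite !mxE scalerBl.
rewrite sumrB; congr (_ - _).
rewrite (bigD1 m) //= eqxx scale1r big1 ?addr0 // => l ne_lm.
by rewrite eq_sym (negbTE ne_lm) scale0r.
Qed.

Lemma msizeM_pred (R : comNzRingType) n (p q : {mpoly R[n]}) :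
  (msize (p * q) <= (msize p + msize q).-1)%N.
Proof.
have [->|nz_p] := eqVneq p 0; first by rewrite mul0r msize0.
have [->|nz_q] := eqVneq q 0; first by rewrite mulr0 msize0.
have [->|nz_pq] := eqVneq (p * q) 0; first by rewrite msize0.
rewrite -!mlead_deg // addSn /= addnS ltnS.
by have /lemc_mdeg := mleadM_le p q; rewrite mdegD.
Qed.

Lemma msize_map_le (R S : comNzRingType) n (h : {rmorphism R -> S}) (q : {mpoly R[n]}) :
  (msize (map_mpoly h q) <= msize q)%N.
Proof.
rewrite msizeE; apply/bigmax_leqP_seq => m m_h _; move: m_h; rewrite mcoeff_msupp mcoeff_map_mpoly => nz_q.
by apply: msize_mdeg_lt; rewrite mcoeff_msupp; apply: contraNneq nz_q => /= ->; rewrite rmorph0.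
Qed.

Lemma ideal_le_map (R S : comNzRingType) (h : {rmorphism R -> S})
    (f : 'M[{mpoly R[2 * 2]}]_2) d q :
  ideal_le f d q -> ideal_le (map_mx (map_mpoly h) f) d (map_mpoly h q).
Proof.
move=> [r [dr ->]]; exists (map_mx (map_mpoly h) r); split=> [i j|].
  by rewrite mxE (leq_trans (msize_map_le _ _)).
rewrite rmorph_sum; apply: eq_bigr => i _; rewrite rmorph_sum; apply: eq_bigr => j _.
by rewrite rmorphM !mxE.
Qed.

Lemma spans_map (R S : comNzRingType) (h : {rmorphism R -> S})
    (f : 'M[{mpoly R[2 * 2]}]_2) :
  spans f -> spans (map_mx (map_mpoly h) f).
Proof.
move=> spf d m /(spf d m)[c [dc /(ideal_le_map h)]].
rewrite rmorphB rmorph_sum /= map_mpolyX => hc.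
exists (h \o c); split=> [k /dc /= ->|]; first exact: rmorph0.
move: hc; congr (ideal_le _ _ (_ - _)); apply: eq_bigr => k _.
by rewrite map_mpolyZ map_mpolyX.
Qed.

(** A reduction over [k] is lifted coefficient by coefficient. The error has degree at most [d] and
    coefficients of residue 0, so Nakayama applies to the finitely many monomials of degree at most
    [d]. *)
Lemma spans_lift (V : comNzRingType) (k : fieldType) (pi : {rmorphism V -> k})
    (f : 'M[{mpoly V[2 * 2]}]_2) :
    (forall v, pi v != 0 -> exists u, u * v = 1) ->
    (forall y, exists v, pi v = y) ->
    (forall i j, (msize (f i j) <= 3)%N) ->
  spans (map_mx (map_mpoly pi) f) -> spans f.
Proof.
move=> units surj deg_f spf d m le_md.
(* A set-theoretic section of [pi]; requiring [lam 0 = 0] keeps zero coefficients zero, and so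
   preserves the degree bounds. *)
have [lam [lamK lam0]] : exists lam : k -> V, (forall y, pi (lam y) = y) /\ lam 0 = 0.
  exists (fun y => if y == 0 then 0 else
    proj1_sig (constructive_indefinite_description _ (surj y))).
  split=> [y|]; last by rewrite eqxx.
  case: eqP => [->|_]; first exact: rmorph0.
  by case: constructive_indefinite_description.
pose lift n (q : {mpoly k[n]}) : {mpoly V[n]} := \sum_(m <- msupp q) lam q@_m *: 'X_[m].
have liftK n (q : {mpoly k[n]}) : map_mpoly pi (lift n q) = q.
  rewrite rmorph_sum [RHS]mpolyE; apply: eq_bigr => mu _.
  by rewrite /= map_mpolyZ map_mpolyX lamK.
have msize_lift n (q : {mpoly k[n]}) : (msize (lift n q) <= msize q)%N.
  apply: leq_trans (msize_sum _ _ _) _; apply/bigmax_leqP_seq => mu q_mu _.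
  apply: leq_trans (msizeZ_le _ _) _; rewrite msizeX; exact: msize_mdeg_lt.
pose N := #|{: bmultinom (2 * 2) d.+1}|.
pose mu (i : 'I_N) : bmultinom (2 * 2) d.+1 := enum_val i.
pose x (i : 'I_N) : {mpoly V[2 * 2]} := 'X_[mu i].
have lt_md : (mdeg m < d.+1)%N by [].
suffices /(_ (enum_rank (BMultinom lt_md))) : forall i, reduces f d (x i).
  by rewrite /x /mu enum_rankK.
refine (@nakayama V k pi {mpoly V[2 * 2]} N x (reduces f d) units (reduces0 f d) (@reducesP V f d) _) => i.
have le_mui : (mdeg (mu i) <= d)%N by rewrite -ltnS bmdeg.
have [c [dc [r [dr Dr]]]] := spf d _ le_mui.
pose g := \sum_i \sum_j lift _ (r i j) * f i j.
pose h := x i - \sum_k lam (c k) *: 'X_[emon k] - g.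
have pi_h : map_mpoly pi h = 0.
  rewrite !rmorphB !rmorph_sum /= map_mpolyX; apply/eqP; rewrite subr_eq0; apply/eqP.
  transitivity ('X_[mu i] - \sum_k0 c k0 *: 'X_[emon k0] : {mpoly k[2 * 2]}).
    congr (_ - _); apply: eq_bigr => l _; by rewrite map_mpolyZ map_mpolyX lamK.
  rewrite Dr; apply: eq_bigr => a _; rewrite rmorph_sum; apply: eq_bigr => b _.
  by rewrite rmorphM /= liftK mxE.
have deg_rf a b : (msize (lift _ (r a b) * f a b) <= d.+1)%N.
  have [-> | nz_r] := eqVneq (r a b) 0.
    by rewrite /lift msupp0 big_nil mul0r msize0.
  have r_gt0 : (0 < msize (r a b))%N by rewrite lt0n msize_poly_eq0.
  apply: leq_trans (msizeM_pred _ _) _.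
  move: (msize_lift _ (r a b)) (deg_f a b) (dr a b) r_gt0.
  by move: (msize (lift _ _)) (msize (r a b)) (msize (f a b)) => x1 x2 x3; lia.
have deg_h : (msize h <= d.+1)%N.
  apply: leq_trans (msizeD_le _ _) _; rewrite geq_max; apply/andP; split.
    apply: leq_trans (msizeD_le _ _) _; rewrite geq_max msizeX ltnS le_mui msizeN /=.
    apply: leq_trans (msize_sum _ _ _) _; apply/bigmax_leqP_seq => l _ _.
    have [lt_d | le_d] := ltnP d (mdeg (emon l)).
      by rewrite dc // lam0 scale0r msize0.
    by apply: leq_trans (msizeZ_le _ _) _; rewrite msizeX.
  rewrite msizeN; apply: leq_trans (msize_sum _ _ _) _; apply/bigmax_leqP_seq => a _ _.
  by apply: leq_trans (msize_sum _ _ _) _; apply/bigmax_leqP_seq => b _ _.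
exists (fun l => h@_(mu l)); split=> [l|].
  by rewrite -mcoeff_map_mpoly pi_h mcoeff0.
have -> : \sum_l h@_(mu l) *: x l = h.
  rewrite [RHS](mpolywE deg_h) (reindex (@enum_val _ {: bmultinom (2 * 2) d.+1})) //=.
  by apply: onW_bij; apply: enum_val_bij.
exists (lam \o c); split=> [l /dc /= -> //|].
rewrite (_ : _ - _ = g); last by rewrite /h /=; ring.
exists (map_mx (lift _) r); split=> [a b|].
  by rewrite mxE (leq_trans (msize_lift _ _)).
by apply: eq_bigr => a _; apply: eq_bigr => b _; rewrite mxE.
Qed.

(** * The quadratic system and its specialization *)

Definition mx2 (T : Type) (a b c d : T) : 'M[T]_2 :=
  \matrix_(i, j) if i == 0 then if j == 0 then a else b else if j == 0 then c else d.

Lemma ord2P (P : 'I_2 -> Prop) : P 0 -> P 1 -> forall i, P i.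
Proof.
move=> P0 P1 [[|[|i]] lt_i] //.
  by rewrite (_ : Ordinal lt_i = 0) //; apply: val_inj.
by rewrite (_ : Ordinal lt_i = 1) //; apply: val_inj.
Qed.

Section QuadSys.
Variable R : comNzRingType.

Definition quad_eval A B1 B2 C D F X : 'M[R]_2 :=
  A *m X *m B1 *m X + X *m B2 *m X + X *m X *m C + D *m X + F.

End QuadSys.

Definition quad_sys (R : comNzRingType) (A B1 B2 C D F : 'M[R]_2) :=
  quad_eval (coef_mx A) (coef_mx B1) (coef_mx B2) (coef_mx C) (coef_mx D) (coef_mx F)
    (unknown_mx R 2).

Lemma map_quad_eval (R S : comNzRingType) (h : {rmorphism R -> S}) (A B1 B2 C D F X : 'M[R]_2) :
  map_mx h (quad_eval A B1 B2 C D F X) =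
  quad_eval (map_mx h A) (map_mx h B1) (map_mx h B2) (map_mx h C) (map_mx h D) (map_mx h F)
    (map_mx h X).
Proof. by rewrite /quad_eval !map_mxD !map_mxM. Qed.

Lemma quad_sys_mmap (R S : comNzRingType) (h : {rmorphism R -> S}) (A B1 B2 C D F : 'M[R]_2)
    (X : 'M[S]_2) :
  map_mx (mmap h (mxvec X 0)) (quad_sys A B1 B2 C D F) =
  quad_eval (map_mx h A) (map_mx h B1) (map_mx h B2) (map_mx h C) (map_mx h D) (map_mx h F) X.
Proof.
rewrite map_quad_eval; have e (M : 'M[R]_2) : map_mx (mmap h (mxvec X 0)) (coef_mx M) = map_mx h M.
  by apply/matrixP => i j; rewrite !mxE mmapC.
rewrite !e; congr quad_eval.
by apply/matrixP => i j; rewrite !mxE /= mmapX mmap1U mxvecE.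
Qed.

Lemma map_quad_sys (R S : comNzRingType) (h : {rmorphism R -> S}) (A B1 B2 C D F : 'M[R]_2) :
  map_mx (map_mpoly h) (quad_sys A B1 B2 C D F) =
  quad_sys (map_mx h A) (map_mx h B1) (map_mx h B2) (map_mx h C) (map_mx h D) (map_mx h F).
Proof.
rewrite map_quad_eval.
have e (M : 'M[R]_2) : map_mx (map_mpoly h) (coef_mx M) = coef_mx (map_mx h M).
  by apply/matrixP => i j; rewrite !mxE map_mpolyC.
rewrite !e; congr quad_eval.
by apply/matrixP => i j; rewrite !mxE /= map_mpolyX.
Qed.

Lemma quad_sys_msize (R : comNzRingType) (A B1 B2 C D F : 'M[R]_2) i j :
  (msize (quad_sys A B1 B2 C D F i j) <= 3)%N.
Proof.
have degD (p q : {mpoly R[2 * 2]}) n :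
    (msize p <= n -> msize q <= n -> msize (p + q) <= n)%N.
  by move=> dp dq; apply: leq_trans (msizeD_le _ _) _; rewrite geq_max dp.
have degsum n (p : 'I_2 -> {mpoly R[2 * 2]}) :
    (forall l, msize (p l) <= n)%N -> (msize (\sum_l p l)%R <= n)%N.
  by move=> dp; apply: leq_trans (msize_sum _ _ _) _; apply/bigmax_leqP_seq => l _ _.
have degM (M N : 'M[{mpoly R[2 * 2]}]_2) m n : (forall i j, msize (M i j) <= m.+1)%N ->
    (forall i j, msize (N i j) <= n.+1)%N -> forall i j, (msize ((M *m N) i j) <= (m + n).+1)%N.
  move=> dM dN {}i {}j; rewrite mxE; apply: degsum => l.
  apply: leq_trans (msizeM_pred _ _) _; 
  by move: (msize (M i l)) (msize (N l j)) (dM i l) (dN l j) => x y; lia.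
have degC (M : 'M[R]_2) a b : (msize (coef_mx M a b) <= 0.+1)%N.
  by rewrite mxE msizeC; case: eqP.
have degX a b : (msize (unknown_mx R 2 a b) <= 1.+1)%N.
  by rewrite mxE msizeX mdeg1.
rewrite /quad_sys /quad_eval !(@mxE _ _ _ _ (fun i j => _ + _)).
apply: (degD _ _ _); last by apply: leq_trans (degC _ _ _) _.
apply: (degD _ _ _); last by apply: leq_trans (degM _ _ 0 1 (degC _) degX i j) _.
apply: (degD _ _ _); last exact: (degM _ _ 2 0 (degM _ _ 1 1 degX degX) (degC _)).
apply: (degD _ _ _); last exact: (degM _ _ 1 1 (degM _ _ 1 0 degX (degC _)) degX).
exact: (degM _ _ 1 1 (degM _ _ 1 0 (degM _ _ 0 1 (degC _) degX) (degC _)) degX).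
Qed.

Lemma mul2E (R : comNzRingType) (M N : 'M[R]_2) i j :
  (M *m N) i j = M i 0 * N 0 j + M i 1 * N 1 j.
Proof. by rewrite mxE !big_ord_recl big_ord0 addr0 (_ : lift ord0 ord0 = 1) //; apply: val_inj. Qed.

Section Special.
Variable R : comNzRingType.

(* Chosen so that the (i, j) entry of the quadratic part is, up to sign, the
   square of X i j plus products of smaller weight, X 0 0 and X 1 1 having
   weight 3, X 0 1 and X 1 0 weight 2. *)
Definition A0 : 'M[R]_2 := mx2 0 0 0 1.
Definition B10 : 'M[R]_2 := mx2 (-1) 1 (-1) (-1).
Definition B20 : 'M[R]_2 := mx2 0 0 1 0.
Definition C0 : 'M[R]_2 := mx2 1 0 0 0.

Lemma special_quadE (D F X : 'M[R]_2) :
  let a := X 0 0 in let b := X 0 1 in let c := X 1 0 in let d := X 1 1 in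
  quad_eval A0 B10 B20 C0 D F X = mx2
    (a ^+ 2 + a * b + b * c + D 0 0 * a + D 0 1 * c + F 0 0)
    (b ^+ 2 + D 0 0 * b + D 0 1 * d + F 0 1)
    (c ^+ 2 + D 1 0 * a + D 1 1 * c + F 1 0)
    (c * d - b * c - d ^+ 2 + D 1 0 * b + D 1 1 * d + F 1 1).
Proof.
move=> a b c d; apply/matrixP; rewrite /quad_eval.
apply: ord2P; apply: ord2P.
all: rewrite ![in LHS](@mxE _ _ _ _ (fun i j => _ + _)) !mul2E ![in X in _ = X]mxE /=.
all: rewrite !(@mxE _ _ _ _ (fun i j => if _ then _ else _)) /= -/a -/b -/c -/d.
all: by ring.
Qed.

End Special.

Lemma map_mx2 (S T : Type) (h : S -> T) a b c d :
  map_mx h (mx2 a b c d) = mx2 (h a) (h b) (h c) (h d).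
Proof. by apply/matrixP; apply: ord2P; apply: ord2P; rewrite !mxE. Qed.

Lemma map_special (R S : comNzRingType) (h : {rmorphism R -> S}) :
  [/\ map_mx h (A0 R) = A0 S, map_mx h (B10 R) = B10 S,
      map_mx h (B20 R) = B20 S & map_mx h (C0 R) = C0 S].
Proof. by split; rewrite map_mx2 ?rmorphN ?rmorph0 ?rmorph1. Qed.

Lemma mxvec_idxP (P : 'I_(2 * 2) -> Prop) :
  (forall i j : 'I_2, P (mxvec_index i j)) -> forall v, P v.
Proof. by move=> HP v; case/mxvec_indexP: v. Qed.

Lemma sum_delta_mx (R : comNzRingType) (U : lmodType R) (f : 'I_2 -> 'I_2 -> U) (c : R) i j :
  \sum_k \sum_l (c *: delta_mx i j : 'M_2) k l *: f k l = c *: f i j.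
Proof.
rewrite (bigD1 i) //= (bigD1 j) //= !mxE !eqxx mulr1.
rewrite big1 ?addr0 => [|l /negbTE ne_l]; last by rewrite !mxE ne_l andbF mulr0 scale0r.
rewrite big1 ?addr0 // => k /negbTE ne_k; rewrite big1 // => l _.
by rewrite !mxE ne_k mulr0 scale0r.
Qed.

Lemma special_spans (R : comNzRingType) (D F : 'M[R]_2) :
  spans (quad_sys (A0 R) (B10 R) (B20 R) (C0 R) D F).
Proof.
(* Two conditions fix the weights: [X 0 0] and [X 1 1] must outweigh the other two because of the
   mixed products beside their squares, and every linear term must weigh less than 4, the smallest
   weight of a square. *)
pose W : 'M[nat]_2 := mx2 3 2 2 3; pose w v := mxvec W 0 v.
have wE i j : w (mxvec_index i j) = W i j by rewrite /w mxvecE.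
have [w00 w01 w10 w11] : [/\ W 0 0 = 3%N, W 0 1 = 2%N, W 1 0 = 2%N & W 1 1 = 3%N].
  by rewrite !mxE.
clearbody W; apply: (@spans_of_squares _ _ w).
pose X := unknown_mx R 2.
pose good b (q : {mpoly R[2 * 2]}) :=
  forall m, m \in msupp q -> (mdeg m <= 2)%N /\ (weight w m < b)%N.
have goodD b p q : good b p -> good b q -> good b (p + q).
  by move=> Gp Gq m /msuppD_le; rewrite mem_cat => /orP[/Gp | /Gq].
have goodN b p : good b p -> good b (- p).
  by move=> Gp m; rewrite (perm_mem (msuppN p)) => /Gp.
have goodZ b c m : (mdeg m <= 2)%N -> (weight w m < b)%N -> good b (c *: 'X_[m]).
  by move=> dm wm m' /msuppZ_le; rewrite msuppX inE => /eqP ->.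
have good2 b i j k l : (W i j + W k l < b)%N -> good b (X i j * X k l).
  move=> lt_b; rewrite !mxE -mpolyXD -[X in good _ X]scale1r; apply: goodZ.
    by rewrite mdegD !mdeg1.
  by rewrite weightD !weightU !wE.
have good1 b c i j : (W i j < b)%N -> good b (c%:MP * X i j).
  move=> lt_b; rewrite mxE mul_mpolyC; apply: goodZ; first by rewrite mdeg1.
  by rewrite weightU wE.
have good0 b c : (0 < b)%N -> good b c%:MP.
  move=> lt_b; rewrite -[_%:MP]mulr1 mul_mpolyC -mpolyX0; apply: goodZ; rewrite ?mdeg0 //.
  by rewrite /weight big1 // => i _; rewrite mnmE muln0.
have [eA eB1 eB2 eC] := map_special (@mpolyC (2 * 2) R).
pose f := quad_sys (A0 R) (B10 R) (B20 R) (C0 R) D F.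
have Df : f = quad_eval (A0 _) (B10 _) (B20 _) (C0 _) (coef_mx D) (coef_mx F) X.
  by rewrite /f /quad_sys /coef_mx eA eB1 eB2 eC.
have DD i j : coef_mx D i j = (D i j)%:MP by rewrite mxE.
have DF i j : coef_mx F i j = (F i j)%:MP by rewrite mxE.
suffices sq i j : exists c q, X i j ^+ 2 = c *: f i j + q /\ good (2 * W i j)%N q.
  apply: mxvec_idxP => i j; have [c [q [Dq Gq]]] := sq i j.
  exists (c *: delta_mx i j), q; split; last by move=> m /Gq; rewrite wE.
  have -> : 'X_(mxvec_index i j) = X i j by rewrite mxE.
  rewrite Dq; congr (_ + _).
  by rewrite sum_delta_mx.
move: (Df); rewrite special_quadE => /matrixP Ef.
move: i j; apply: ord2P; apply: ord2P; rewrite Ef [(mx2 _ _ _ _) _ _]mxE /= !DD !DF.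
- exists 1, (- (X 0 0 * X 0 1 + X 0 1 * X 1 0 + (D 0 0)%:MP * X 0 0 + (D 0 1)%:MP * X 1 0
             + (F 0 0)%:MP)).
  split; first by rewrite scale1r; ring.
  by repeat first [apply: (goodN _ _) | apply: (goodD _ _ _)
                  | apply: good2 | apply: good1 | apply: good0]; rewrite ?w00 ?w01 ?w10 ?w11.
- exists 1, (- ((D 0 0)%:MP * X 0 1 + (D 0 1)%:MP * X 1 1 + (F 0 1)%:MP)).
  split; first by rewrite scale1r; ring.
  by repeat first [apply: (goodN _ _) | apply: (goodD _ _ _)
                  | apply: good2 | apply: good1 | apply: good0]; rewrite ?w00 ?w01 ?w10 ?w11.
- exists 1, (- ((D 1 0)%:MP * X 0 0 + (D 1 1)%:MP * X 1 0 + (F 1 0)%:MP)).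
  split; first by rewrite scale1r; ring.
  by repeat first [apply: (goodN _ _) | apply: (goodD _ _ _)
                  | apply: good2 | apply: good1 | apply: good0]; rewrite ?w00 ?w01 ?w10 ?w11.
(* The square of [X 1 1] occurs in its entry with coefficient -1. *)
exists (-1), (X 1 0 * X 1 1 - X 0 1 * X 1 0 + (D 1 0)%:MP * X 0 1 + (D 1 1)%:MP * X 1 1
             + (F 1 1)%:MP).
split; first by rewrite scaleN1r; ring.
by repeat first [apply: (goodN _ _) | apply: (goodD _ _ _)
                | apply: good2 | apply: good1 | apply: good0]; rewrite ?w00 ?w01 ?w10 ?w11.
Qed.

(** * Factorization patterns modulo 3 *)

(** Polynomials over F_3 are coded by lists of naturals, constant term first, so that certificates
    can be checked by [vm_compute]. Values are reduced modulo 3 only in [lnorm] and [lcong], and 2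
    stands for -1. *)
Fixpoint ladd (s t : seq nat) : seq nat :=
  match s, t with
  | a :: s', b :: t' => (a + b)%N :: ladd s' t'
  | [::], _ => t
  | _, [::] => s
  end.
Definition lscale (a : nat) (s : seq nat) : seq nat := map (muln a) s.
Fixpoint lmul (s t : seq nat) : seq nat :=
  if s is a :: s' then ladd (lscale a t) (0%N :: lmul s' t) else [::].
Definition lnorm (s : seq nat) : seq nat := map (fun a => a %% 3)%N s.

(* The remainder modulo 3 and modulo the monic polynomial whose lower
   coefficients are listed by m. *)
Definition lstep (m r : seq nat) : seq nat :=
  if size r == (size m).+1 then
    lnorm (ladd (take (size m) r) (lscale (2 * nth 0 r (size m)) m))
  else lnorm r.
Definition lrem (m s : seq nat) : seq nat := foldr (fun a r => lstep m (a :: r)) [::] s.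
Definition lcong (s t : seq nat) : bool :=
  all (fun a => a %% 3 == 0)%N (ladd s (lscale 2 t)).
(** The class of x^(3^i), by repeated cubing. *)
Fixpoint lfrob (m : seq nat) (i : nat) : seq nat :=
  if i is i'.+1 then
    let h := lfrob m i' in lrem m (lmul h (lrem m (lmul h h)))
  else [:: 0; 1]%N.

Section Eval.
Variables (S : comNzRingType) (x : S).
Hypothesis char3 : 3%:R = 0 :> S.

Definition leval (s : seq nat) : S := foldr (fun a e => a%:R + x * e) 0 s.

Lemma natr_mod3 a : (a %% 3)%:R = a%:R :> S.
Proof. by rewrite [in RHS](divn_eq a 3) natrD natrM char3 mulr0 add0r. Qed.

Lemma leval_add s t : leval (ladd s t) = leval s + leval t.
Proof.
elim: s t => [|a s IHs] [|b t] /=; rewrite ?add0r ?addr0 //.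
by rewrite natrD IHs; ring.
Qed.

Lemma leval_scale a s : leval (lscale a s) = a%:R * leval s.
Proof. by elim: s => [|b s /= ->] /=; rewrite ?mulr0 // natrM; ring. Qed.

Lemma leval_mul s t : leval (lmul s t) = leval s * leval t.
Proof.
elim: s => [|a s IHs] /=; first by rewrite mul0r.
by rewrite leval_add leval_scale /= IHs; ring.
Qed.

Lemma leval_norm s : leval (lnorm s) = leval s.
Proof. by elim: s => //= a s ->; rewrite natr_mod3. Qed.

Lemma leval_cat s t : leval (s ++ t) = leval s + x ^+ size s * leval t.
Proof.
elim: s => [|a s IHs] /=; first by rewrite add0r mul1r.
by rewrite IHs exprS; ring.
Qed.

Lemma leval_cong s t : lcong s t -> leval s = leval t.
Proof.
move=> st; have : leval (ladd s (lscale 2 t)) = 0.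
  move: st; rewrite /lcong; elim: (ladd _ _) => //= a u IHu /andP[/eqP a0 /IHu ->].
  by rewrite -natr_mod3 a0 mulr0 addr0.
rewrite leval_add leval_scale => e.
apply/eqP; rewrite -subr_eq0.
rewrite (_ : _ - _ = leval s + 2%:R * leval t - 3%:R * leval t); last by ring.
by rewrite e char3 mul0r subrr.
Qed.

Definition cube (y : S) : S := y ^+ 3.

Variable m : seq nat.
Hypothesis root_m : x ^+ size m + leval m = 0.

Lemma leval_step r : leval (lstep m r) = leval r.
Proof.
rewrite /lstep; case: eqP => [sz_r|_]; last exact: leval_norm.
rewrite leval_norm leval_add leval_scale.
rewrite -[in RHS](cat_take_drop (size m) r) leval_cat size_take sz_r ltnSn.
rewrite (drop_nth 0%N) ?sz_r // drop_oversize ?sz_r //=.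
rewrite mulr0 addr0; congr (_ + _).
have -> : x ^+ size m = - leval m by apply/eqP; rewrite -addr_eq0 root_m.
set a := nth _ _ _; apply/eqP; rewrite natrM -subr_eq0.
rewrite (_ : _ - _ = 3%:R * (a%:R * leval m)); first by rewrite char3 mul0r.
by ring.
Qed.

Lemma leval_rem s : leval (lrem m s) = leval s.
Proof. by elim: s => //= a s IHs; rewrite leval_step /= IHs. Qed.

Lemma leval_frob i : leval (lfrob m i) = iter i cube x.
Proof.
elim: i => [|i IHi]; first by rewrite /= mulr0 addr0 mulr1 add0r.
by rewrite /= leval_rem leval_mul leval_rem leval_mul IHi /cube; ring.
Qed.

Lemma frob_eq i : lcong (lfrob m i) [:: 0; 1]%N -> iter i cube x = x.
Proof.
by move/leval_cong; rewrite leval_frob => ->; rewrite /= mulr0 addr0 mulr1 add0r.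
Qed.

(** The list [u] is an inverse of x^(3^i) - x modulo [m], which shows that this difference vanishes
    at no root. *)
Lemma frob_neq i u :
  lcong (lrem m (lmul u (ladd (lfrob m i) [:: 0; 2]%N))) [:: 1]%N -> iter i cube x != x.
Proof.
move/leval_cong; rewrite leval_rem leval_mul leval_add leval_frob => e.
apply: contra_eqN (e) => /eqP ->; rewrite /= !mulr0 !addr0 add0r.
rewrite (_ : x + _ = 3%:R * x); last by ring.
by rewrite char3 mul0r mulr0 eq_sym oner_eq0.
Qed.

End Eval.

Definition lpoly (s : seq nat) : {poly 'F_3} := Poly (map (fun a => a%:R) s).

Lemma horner_lpoly (L : fieldType) (inc : {rmorphism 'F_3 -> L}) s x :
  (map_poly inc (lpoly s)).[x] = leval x s.
Proof.
elim: s => [|a s IHs]; first by rewrite /lpoly /= rmorph0 horner0.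
have -> : lpoly (a :: s) = lpoly s * 'X + a%:R%:P by rewrite -cons_poly_def.
rewrite rmorphD rmorphM /= map_polyX map_polyC hornerD hornerMX hornerC IHs.
by rewrite [X in _ + X](rmorph_nat inc a) addrC mulrC.
Qed.

Fixpoint lderiv (s : seq nat) : seq nat :=
  if s is a :: s' then ladd s' (0%N :: lderiv s') else [::].

Lemma horner_lderiv (L : fieldType) (inc : {rmorphism 'F_3 -> L}) s x :
  ((map_poly inc (lpoly s))^`()).[x] = leval x (lderiv s).
Proof.
elim: s => [|a s IHs]; first by rewrite /lpoly /= rmorph0 deriv0 horner0.
have -> : lpoly (a :: s) = lpoly s * 'X + a%:R%:P by rewrite -cons_poly_def.
rewrite rmorphD rmorphM /= map_polyX map_polyC derivD derivM derivX derivC addr0 mulr1.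
rewrite hornerD hornerMX IHs horner_lpoly leval_add /= add0r.
by rewrite addrC mulrC.
Qed.

Definition special_sys (R : comNzRingType) (D F : 'M[R]_2) :=
  quad_eval (A0 R) (B10 R) (B20 R) (C0 R) D F.

Definition nat_mx (R : nzRingType) (a b c d : nat) : 'M[R]_2 := mx2 a%:R b%:R c%:R d%:R.

(* The entry X 0 1 is the generator x, the other three are polynomials in it. *)
Definition lsys (d0 d1 d2 d3 f0 f1 f2 f3 : nat) (a c d : seq nat) : seq (seq nat) :=
  let b := [:: 0; 1]%N in
  [:: ladd (lmul a a) (ladd (lmul a b) (ladd (lmul b c)
        (ladd (lscale d0 a) (ladd (lscale d1 c) [:: f0]))));
      ladd (lmul b b) (ladd (lscale d0 b) (ladd (lscale d1 d) [:: f1]));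
      ladd (lmul c c) (ladd (lscale d2 a) (ladd (lscale d3 c) [:: f2]));
      ladd (lmul c d) (ladd (lscale 2 (lmul b c)) (ladd (lscale 2 (lmul d d))
        (ladd (lscale d2 b) (ladd (lscale d3 d) [:: f3]))))].

Lemma lsys_solution (L : comNzRingType) (x : L) m d0 d1 d2 d3 f0 f1 f2 f3 a c d :
    3%:R = 0 :> L -> x ^+ size m + leval x m = 0 ->
    all (fun e => lcong (lrem m e) [::]) (lsys d0 d1 d2 d3 f0 f1 f2 f3 a c d) ->
  special_sys (nat_mx L d0 d1 d2 d3) (nat_mx L f0 f1 f2 f3)
    (mx2 (leval x a) x (leval x c) (leval x d)) = 0.
Proof.
move=> char3 root_m.
have zero e : lcong (lrem m e) [::] -> leval x e = 0.
  by move/(leval_cong x char3); rewrite leval_rem.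
move=> /and5P[/zero e1 /zero e2 /zero e3 /zero e4 _].
have two (y : L) : 2%:R * y = - y.
  apply/eqP; rewrite -addr_eq0; have -> : 2%:R * y + y = 3%:R * y by ring.
  by rewrite char3 mul0r.
move: e1 e2 e3 e4; do 3 rewrite ?(leval_add, leval_scale, leval_mul) /=; rewrite ?(two, addr0, mulr0, mulr1, add0r, mul0r, mul1r).
move=> e1 e2 e3 e4.
rewrite /special_sys special_quadE; apply/matrixP; apply: ord2P; apply: ord2P; rewrite !mxE /=.
- by rewrite -e1; ring.
- by rewrite -e2; ring.
- by rewrite -e3; ring.
by rewrite -e4; ring.
Qed.

Lemma F3_char (L : fieldType) (inc : {rmorphism 'F_3 -> L}) : 3%:R = 0 :> L.
Proof. by rewrite -(rmorph_nat inc) (_ : 3%:R = 0) ?rmorph0 //; apply: val_inj. Qed.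

Definition monic_list (m : seq nat) : {poly 'F_3} := lpoly (m ++ [:: 1%N]).

Lemma horner_monic_list (L : fieldType) (inc : {rmorphism 'F_3 -> L}) m x :
  (map_poly inc (monic_list m)).[x] = x ^+ size m + leval x m.
Proof. by rewrite horner_lpoly leval_cat /= mulr0 addr0 mulr1 addrC. Qed.

Lemma lpoly_nth s i : (lpoly s)`_i = (nth 0%N s i)%:R.
Proof.
rewrite coef_Poly; have [lt_i | le_i] := ltnP i (size s); first by rewrite (nth_map 0%N).
by rewrite !nth_default ?size_map.
Qed.

Lemma size_monic_list m : size (monic_list m) = (size m).+1.
Proof.
apply/eqP; rewrite eqn_leq; apply/andP; split.
  by apply: leq_trans (size_Poly _) _; rewrite size_map size_cat addn1.
rewrite ltnNge; apply/negP => /leq_sizeP/(_ _ (leqnn _))/eqP.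
by rewrite lpoly_nth nth_cat ltnn subnn /= oner_eq0.
Qed.

Lemma monic_monic_list m : monic_list m \is monic.
Proof.
by rewrite monicE lead_coefE size_monic_list lpoly_nth nth_cat ltnn subnn.
Qed.

(** The inverse [u] of the derivative modulo [m] excludes multiple roots. *)
Lemma split_separable m u :
    lcong (lrem m (lmul u (lderiv (m ++ [:: 1%N])))) [:: 1%N] ->
  exists (L : fieldType) (inc : {rmorphism 'F_3 -> L}) (beta : 'I_(size m) -> L),
    injective beta /\ map_poly inc (monic_list m) = \prod_i ('X - (beta i)%:P).
Proof.
move=> sep; have nz_p := monic_neq0 (monic_monic_list m).
have [L [zs Dp _]] := FinSplittingFieldFor nz_p.
pose inc : {rmorphism 'F_3 -> L} := in_alg L.
have {}Dp : map_poly inc (monic_list m) = \prod_(z <- zs) ('X - z%:P).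
  apply/eqP; rewrite -eqp_monic ?monic_prod_XsubC // monic_map //; exact: monic_monic_list.
have sz_zs : size zs = size m.
  have := size_monic_list m; rewrite -(size_map_poly inc) Dp size_prod_XsubC.
  by case.
have char3 := F3_char inc.
have uniq_zs : uniq zs.
  rewrite -separable_prod_XsubC -Dp separable_poly.unlock [X in coprimep X _]Dp big_seq.
  elim/big_rec: _ => [|z q zs_z IHq]; first exact: coprime1p.
  rewrite coprimepMl IHq andbT coprimep_sym coprimep_XsubC rootE horner_lderiv.
  have root_z : z ^+ size m + leval z m = 0.
    by apply/eqP; rewrite -(horner_monic_list inc) -rootE Dp root_prod_XsubC.
  apply: contra_eqN (leval_cong z char3 sep) => /eqP e.
  by rewrite leval_rem // leval_mul e mulr0 /= mulr0 addr0 eq_sym oner_eq0.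
pose beta (i : 'I_(size m)) := nth 0 zs i.
exists L, inc, beta; split.
  by move=> i l /eqP; rewrite nth_uniq ?sz_zs // => /eqP/val_inj.
by rewrite Dp (big_nth 0) sz_zs big_mkord.
Qed.

Lemma map_nat_mx (R S : nzRingType) (h : {rmorphism R -> S}) a b c d :
  map_mx h (nat_mx R a b c d) = nat_mx S a b c d.
Proof. by rewrite map_mx2 !rmorph_nat. Qed.

(* beta lists the values of X 0 1 at the 16 solutions of the reduction modulo 3;
   Q prescribes the cycles of Frobenius on them. *)
Definition frobenius_point (D F : 'M[int]_2)
    (Q : forall L : fieldType, ('I_16 -> L) -> Prop) : Prop :=
  exists (L : fieldType) (inc : {rmorphism 'F_3 -> L}) (beta : 'I_16 -> L),
    [/\ injective beta,
        forall i, exists2 X : 'M[L]_2, X 0 1 = beta i &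
          special_sys (map_mx intr D) (map_mx intr F) X = 0
      & Q L beta].

(* m lists the lower coefficients of the polynomial of degree 16 satisfied by
   X 0 1, u is the inverse of its derivative, and a, c, d are the other entries
   of X. *)
Lemma frobenius_point_cert d0 d1 d2 d3 f0 f1 f2 f3 m a c d u
    (Q : forall L : fieldType, ('I_16 -> L) -> Prop) :
    size m = 16%N ->
    lcong (lrem m (lmul u (lderiv (m ++ [:: 1%N])))) [:: 1%N] ->
    all (fun e => lcong (lrem m e) [::]) (lsys d0 d1 d2 d3 f0 f1 f2 f3 a c d) ->
    (forall (L : fieldType) (inc : {rmorphism 'F_3 -> L}) (beta : 'I_16 -> L),
      injective beta -> (forall x, (x ^+ size m + leval x m == 0) = [exists i, x == beta i]) ->
      Q L beta) ->
  frobenius_point (nat_mx int d0 d1 d2 d3) (nat_mx int f0 f1 f2 f3) Q.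
Proof.
move=> size_m sep sys HQ; have [L [inc [beta0 [inj0 Dp0]]]] := split_separable sep.
have [beta [inj_beta Dp]] : exists beta : 'I_16 -> L, injective beta /\
    map_poly inc (monic_list m) = \prod_i ('X - (beta i)%:P).
  by move: beta0 inj0 Dp0; rewrite size_m => beta0 ? ?; exists beta0.
have rootE x : (x ^+ size m + leval x m == 0) = [exists i, x == beta i].
  rewrite -(horner_monic_list inc) Dp horner_prod prodf_seq_eq0.
  apply/hasP/existsP => [[i _] /= | [i /eqP ->]].
    by rewrite hornerXsubC subr_eq0; exists i.
  by exists i; rewrite ?mem_index_enum //= hornerXsubC subrr.
exists L, inc, beta; split=> // [i|]; last exact: HQ.
have root_i : beta i ^+ size m + leval (beta i) m = 0.
  by apply/eqP; rewrite rootE; apply/existsP; exists i.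
have := lsys_solution (F3_char inc) root_i sys.
rewrite !map_nat_mx => sol; eexists; last exact: sol.
by rewrite mxE.
Qed.

(** At all three points [D 0 1] and [D 1 0] are nonzero modulo 3. Entry (0, 1) of the system thus
    gives [d] as a quadratic polynomial in b, entry (1, 1) then gives [c] times d - b, entry (1, 0)
    gives [a], and entry (0, 0) an equation of degree 16 for b. Here that equation is irreducible:
    the orbits of Frobenius have lengths dividing 16 but not 8. *)
Lemma point_16 : frobenius_point (nat_mx int 0 1 2 0) (nat_mx int 0 0 2 1)
  (fun L beta => forall i, iter 16 (@cube L) (beta i) = beta i /\ iter 8 (@cube L) (beta i) != beta i).
Proof.
pose m := [:: 1; 2; 1; 1; 2; 0; 2; 1; 1; 0; 2; 2; 2; 2; 0; 0]%N.
apply: (@frobenius_point_cert _ _ _ _ _ _ _ _ m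
  [:: 0; 0; 0; 1; 1; 0; 1; 0; 0; 1; 2; 1; 1; 0; 0; 1]%N
  [:: 0; 2; 0; 0; 0; 1; 1; 1; 2; 2; 2; 2; 2; 1; 2]%N [:: 0; 0; 2]%N
  [:: 1; 2; 2; 2; 2; 2; 1; 1; 0; 1; 0; 2; 0; 2; 2]%N); [by [] | by vm_compute | by vm_compute |].
move=> L inc beta _ Hm i; have char3 := F3_char inc.
have root_i : beta i ^+ size m + leval (beta i) m = 0.
  by apply/eqP; rewrite Hm; apply/existsP; exists i.
split; first by apply: (frob_eq char3 root_i); vm_compute.
by apply: (@frob_neq _ _ char3 _ root_i 8
  [:: 1; 0; 1; 0; 0; 0; 0; 0; 2; 0; 2; 2; 2; 2; 0; 2]%N); vm_compute.
Qed.

(** The constant term of [m] is 0, so 0 is a root fixed by Frobenius. On the roots of the cofactor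
    [q], orbit lengths divide 15 but neither 3 nor 5. *)
Lemma point_15_1 : frobenius_point (nat_mx int 1 2 2 0) (nat_mx int 2 1 0 0)
  (fun L beta => exists2 i0, cube (beta i0) = beta i0 & forall i, i != i0 ->
    [/\ iter 15 (@cube L) (beta i) = beta i, iter 3 (@cube L) (beta i) != beta i
      & iter 5 (@cube L) (beta i) != beta i]).
Proof.
pose m := [:: 0; 2; 1; 0; 0; 0; 2; 2; 0; 1; 0; 2; 1; 0; 0; 2]%N.
apply: (@frobenius_point_cert _ _ _ _ _ _ _ _ m
  [:: 1; 1; 2; 1; 2; 0; 2; 0; 1; 0; 0; 0; 0; 2; 2]%N
  [:: 1; 1; 0; 2; 1; 1; 0; 2; 2; 0; 2; 1; 2; 0; 1; 1]%N [:: 1; 1; 1]%N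
  [:: 2; 1; 0; 1; 1; 1; 2; 2; 0; 0; 1; 2; 2; 1; 1]%N); [by [] | by vm_compute | by vm_compute |].
move=> L inc beta inj_beta Hm; have char3 := F3_char inc.
pose q := [:: 2; 1; 0; 0; 0; 2; 2; 0; 1; 0; 2; 1; 0; 0; 2]%N.
have Dm (x : L) : x ^+ size m + leval x m = x * (x ^+ size q + leval x q).
  by rewrite /= exprS; ring.
have : 0 ^+ size m + leval 0 m == 0 :> L by rewrite Dm mul0r.
rewrite Hm => /existsP[i0 /eqP b0]; exists i0; first by rewrite -b0 /cube expr0n.
move=> i ne_i; have root_q : beta i ^+ size q + leval (beta i) q = 0.
  have : beta i ^+ size m + leval (beta i) m == 0 by rewrite Hm; apply/existsP; exists i.
  by rewrite Dm mulf_eq0 b0 (inj_eq inj_beta) (negbTE ne_i) => /eqP.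
split; first by apply: (frob_eq char3 root_q); vm_compute.
  by apply: (@frob_neq _ _ char3 _ root_q 3 [:: 2; 0; 0; 2; 2; 2; 0; 2; 0; 2; 0; 0; 1; 2; 1]%N).
by apply: (@frob_neq _ _ char3 _ root_q 5 [:: 2; 1; 2; 2; 2; 0; 2; 1; 1; 2; 0; 2; 2]%N); vm_compute.
Qed.

(** Only the seventh power of Frobenius matters: it fixes the roots of a factor of degree 14 and
    exchanges those of a quadratic factor. *)
Lemma point_2_7_7 : frobenius_point (nat_mx int 2 1 1 2) (nat_mx int 2 0 0 1)
  (fun L beta => exists a b, a != b /\
    (forall i, (iter 7 (@cube L) (beta i) != beta i) = (i == a) || (i == b))).
Proof.
pose m := [:: 1; 0; 1; 2; 1; 2; 0; 1; 0; 1; 0; 0; 0; 0; 2; 1]%N.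
apply: (@frobenius_point_cert _ _ _ _ _ _ _ _ m
  [:: 1; 2; 0; 0; 0; 2; 2; 1; 2; 0; 2; 1; 0; 2; 0; 2]%N
  [:: 2; 0; 1; 1; 0; 2; 0; 2; 0; 0; 0; 0; 1; 2; 2]%N [:: 0; 1; 2]%N
  [:: 2; 0; 1; 0; 2; 1; 2; 0; 0; 2; 1; 1; 0; 1; 1; 1]%N); [by [] | by vm_compute | by vm_compute |].
move=> L inc beta inj_beta Hm; have char3 := F3_char inc.
pose q14 := [:: 2; 2; 0; 0; 2; 0; 2; 1; 0; 0; 0; 0; 0; 0]%N.
pose q2 := [:: 2; 1]%N.
have Dm (x : L) : x ^+ size m + leval x m
    = (x ^+ size q14 + leval x q14) * (x ^+ size q2 + leval x q2).
  have e s : x ^+ size s + leval x s = leval x (s ++ [:: 1%N]).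
    by rewrite leval_cat /= mulr0 addr0 mulr1 addrC.
  by rewrite !e -leval_mul; apply: (leval_cong _ char3); vm_compute.
have fix14 i : beta i ^+ size q14 + leval (beta i) q14 = 0 -> iter 7 (@cube L) (beta i) = beta i.
  by move=> root_q; apply: (frob_eq char3 root_q).
have move2 i : beta i ^+ size q2 + leval (beta i) q2 = 0 -> iter 7 (@cube L) (beta i) != beta i.
  by move=> root_q; apply: (@frob_neq _ _ char3 _ root_q 7 [:: 1; 2]%N); vm_compute.
have either i : beta i ^+ size q14 + leval (beta i) q14 = 0 \/
    beta i ^+ size q2 + leval (beta i) q2 = 0.
  have : beta i ^+ size m + leval (beta i) m == 0 by rewrite Hm; apply/existsP; exists i.
  by rewrite Dm mulf_eq0 => /orP[] /eqP; [left | right].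
pose S (q : seq nat) := [set i | beta i ^+ size q + leval (beta i) q == 0].
have card_S q : (#|S q| <= size q)%N.
  have nz_q : map_poly inc (monic_list q) != 0.
    by rewrite map_poly_eq0 monic_neq0 ?monic_monic_list.
  have := @max_poly_roots _ _ [seq beta i | i <- enum (S q)] nz_q.
  rewrite size_map_poly size_monic_list size_map -cardE ltnS; apply.
    apply/allP => _ /mapP[i + ->]; rewrite mem_enum inE.
    by rewrite rootE horner_monic_list.
  by rewrite map_inj_uniq ?enum_uniq.
(* The 16 distinct roots are shared between at most 14 and at most 2, so both bounds are
   attained. *)
have card2 : #|S q2| == 2%N.
  rewrite eqn_leq card_S /= -(leq_add2l 14).
  apply: leq_trans (leq_add (card_S q14) (leqnn _)).
  rewrite -cardsUI; apply: leq_trans (leq_addr _ _).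
  have -> : (14 + 2)%N = #|'I_16| by rewrite card_ord.
  apply/subset_leq_card/subsetP => i _.
  by rewrite !inE; have [/eqP -> | /eqP ->] := either i; rewrite ?orbT.
case/cards2P: card2 => a [b [neq_ab DS]].
exists a, b; split=> // i.
have -> : (i == a) || (i == b) = (i \in S q2) by rewrite DS !inE.
rewrite inE; have [root14 | root2] := either i; last first.
  by rewrite (move2 _ root2) root2 eqxx.
rewrite (fix14 _ root14) eqxx /=; apply/esym/negP => /eqP/move2.
by rewrite (fix14 _ root14) eqxx.
Qed.

(** * Properness of the ideal of the generic system *)

Lemma low_exp (R : comNzRingType) n m (p : {mpoly R[n]}) k :
  low m p -> p@_m = 1 -> low (m *+ k)%MM (p ^+ k) /\ (p ^+ k)@_(m *+ k) = 1.
Proof.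
move=> lp p1; elim: k => [|k [lk ck]].
  by rewrite mulm0n expr0 mcoeff1 eqxx; split=> // m'; rewrite ltNge le0x.
rewrite mulmS exprS; have [l c] := low_mul lp lk; split=> //.
by rewrite c p1 ck mulr1.
Qed.

(** When each variable is replaced by itself plus larger monomials, the lowest term of [P] survives
    with its coefficient. *)
Lemma mmap_low_neq0 (K : fieldType) n (P : {mpoly K[n]}) (h : 'I_n -> {mpoly K[n]}) :
    (forall i, low U_(i)%MM (h i) /\ (h i)@_U_(i) = 1) ->
  P != 0 -> mmap (@mpolyC n K) h P != 0.
Proof.
move=> Hh nz_P.
have low_h m : low m (mmap1 h m) /\ (mmap1 h m)@_m = 1.
  have gen s : low (\sum_(i <- s) U_(i) *+ m i)%MM (\prod_(i <- s) h i ^+ m i)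
      /\ (\prod_(i <- s) h i ^+ m i)@_(\sum_(i <- s) U_(i) *+ m i) = 1.
    elim: s => [|i s [ls cs]].
      by rewrite !big_nil mcoeff1 eqxx; split=> // m'; rewrite ltNge le0x.
    rewrite !big_cons; have [li ci] := Hh i.
    have [lk ck] := low_exp (m i) li ci.
    by have [l c] := low_mul lk ls; split=> //; rewrite c ck cs mulr1.
  by have := gen (index_enum _); rewrite -multinomUE_id.
apply/eqP => /(congr1 (mcoeff (mlast P))); rewrite mcoeff0 /mmap raddf_sum /=.
rewrite (bigD1_seq (mlast P)) ?mlast_supp ?msupp_uniq //= big_seq_cond big1.
  rewrite addr0 mul_mpolyC mcoeffZ (low_h _).2 mulr1 => /eqP.
  by rewrite -[_ == 0]negbK -mcoeff_msupp mlast_supp.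
move=> m /andP[P_m ne_m]; rewrite mul_mpolyC mcoeffZ (low_h m).1 ?mulr0 //.
by rewrite lt_neqAle eq_sym ne_m mlast_lemc.
Qed.

Definition order_ge (R : comNzRingType) n d (q : {mpoly R[n]}) :=
  forall m, (mdeg m < d)%N -> q@_m = 0.

Section OrderGe.
Variables (R : comNzRingType) (n : nat).
Implicit Types q : {mpoly R[n]}.

Lemma order_geD d q q' : order_ge d q -> order_ge d q' -> order_ge d (q + q').
Proof. by move=> oq oq' m lt_m; rewrite mcoeffD oq ?oq' ?addr0. Qed.

Lemma order_ge_sum d (I : finType) (q : I -> {mpoly R[n]}) :
  (forall i, order_ge d (q i)) -> order_ge d (\sum_i q i).
Proof. by move=> oq m lt_m; rewrite raddf_sum big1 //= => i _; apply: oq. Qed.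

Lemma order_geM d d' q q' : order_ge d q -> order_ge d' q' -> order_ge (d + d') (q * q').
Proof.
move=> oq oq' m lt_m; rewrite mcoeffM big1 // => -[k1 k2] /= /eqP Dm.
have [lt1 | le1] := ltnP (mdeg (bmnm k1)) d; first by rewrite oq ?mul0r.
have := congr1 mdeg Dm; rewrite mdegD => dm; rewrite oq' ?mulr0 //.
by move: dm lt_m le1; move: (mdeg m) (mdeg (bmnm k1)) (mdeg (bmnm k2)) => x1 x2 x3; lia.
Qed.

Lemma order_ge_mulmx d d' (M N : 'M[{mpoly R[n]}]_2) :
  (forall i j, order_ge d (M i j)) -> (forall i j, order_ge d' (N i j)) ->
  forall i j, order_ge (d + d') ((M *m N) i j).
Proof. by move=> oM oN i j; rewrite mxE; apply: order_ge_sum => l; apply: order_geM. Qed.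

End OrderGe.

Lemma coef_mx0 (R : comNzRingType) : coef_mx (0 : 'M[R]_2) = 0.
Proof. by apply/matrixP => a b; rewrite !mxE mpolyC0. Qed.

Lemma quadratic_part_order (R : comNzRingType) (A B1 B2 C : 'M[R]_2) i j :
  order_ge 2 (quad_sys A B1 B2 C 0 0 i j).
Proof.
have oC (M : 'M[R]_2) a b : order_ge 0 (coef_mx M a b) by [].
have oX a b : order_ge 1 (unknown_mx R 2 a b).
  move=> m; rewrite ltnS leqn0 mdeg_eq0 => /eqP ->.
  by rewrite mxE mcoeffX mnm1_eq0.
rewrite /quad_sys /quad_eval coef_mx0 mul0mx; set q := (X in X + 0 + 0).
rewrite 2!(addr0 q) /q !(@mxE _ _ _ _ (fun i j => _ + _)).
apply: order_geD; first apply: order_geD.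
- exact: (order_ge_mulmx (order_ge_mulmx (order_ge_mulmx (oC _) oX) (oC _)) oX).
- exact: (order_ge_mulmx (order_ge_mulmx oX (oC _)) oX).
exact: (order_ge_mulmx (order_ge_mulmx oX oX) (oC _)).
Qed.

Lemma quad_eval_linear_part (R : comNzRingType) (A B1 B2 C D X : 'M[R]_2) :
  quad_eval A B1 B2 C D 0 X = quad_eval A B1 B2 C 0 0 X + D *m X.
Proof.
rewrite /quad_eval mul0mx; set q := (X in X + _ *m _ + 0).
by rewrite (addr0 (q + D *m X)) 2!(addr0 q).
Qed.

Lemma quad_sys_linear_part (R : comNzRingType) (A B1 B2 C D : 'M[R]_2) :
  quad_sys A B1 B2 C D 0 = quad_sys A B1 B2 C 0 0 + coef_mx D *m unknown_mx R 2.
Proof. by rewrite /quad_sys coef_mx0 quad_eval_linear_part. Qed.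

(* The lowest form of P stays nonzero under the linear part of the substitution,
   which is invertible. *)
Lemma dominant_substitution (K : fieldType) (A B1 B2 C D : 'M[K]_2) (P : {mpoly K[2 * 2]}) :
    D \in unitmx ->
    mmap (@mpolyC (2 * 2) K) (mxvec (- quad_sys A B1 B2 C D 0) 0) P = 0 ->
  P = 0.
Proof.
move=> uD P0; apply/eqP; apply: contra_eqT P0 => nz_P.
pose Y := unknown_mx K 2; pose N := (2 * 2)%N.
pose sub (M : 'M[{mpoly K[N]}]_2) := mmap (@mpolyC N K) (mxvec M 0).
have subC (c : 'M[K]_2) M : map_mx (sub M) (coef_mx c) = coef_mx c.
  by apply/matrixP => i j; rewrite !mxE /sub mmapC.
have subY M : map_mx (sub M) Y = M.
  by apply/matrixP => i j; rewrite !mxE /sub mmapX mmap1U mxvecE.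
have sub_sub M M' p : sub M (sub M' p) = sub (map_mx (sub M) M') p.
  rewrite {1 2}/sub mmap_comp; apply: mmap_eq => [c | l] /=; first by rewrite mmapC.
  by rewrite -map_mxvec mxE.
have subid p : sub Y p = p.
  rewrite -[RHS]comp_mpoly_id; apply: mmap_eq => // l.
  by case/mxvec_indexP: l => i j; rewrite mxvecE mxE tnth_mktuple.
pose P' := sub (- (coef_mx D *m Y)) P.
pose G := quad_sys A B1 B2 C 0 0.
(* The substitution factors as the linear map [- D Y] followed by [H], which is the identity up to
   terms of order 2. *)
pose H := Y + coef_mx (invmx D) *m G.
have DH : - quad_sys A B1 B2 C D 0 = map_mx (sub H) (- (coef_mx D *m Y)).
  rewrite map_mxN map_mxM subC subY /H mulmxDr mulmxA -map_mxM mulmxV // map_mx1 mul1mx.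
  by rewrite /G -/Y addrC -quad_sys_linear_part.
rewrite -/(sub _ P) DH -sub_sub -/P'.
apply: mmap_low_neq0 => [l|].
  case/mxvec_indexP: l => i j; rewrite mxvecE.
  have oG : order_ge 2 ((coef_mx (invmx D) *m G) i j).
    apply: (@order_ge_mulmx _ _ 0 2) => //; exact: quadratic_part_order.
  rewrite [H i j]mxE [Y i j]mxE; split=> [m lt_m|].
    rewrite mcoeffD mcoeffX eq_sym (lt_eqF lt_m) add0r oG //.
    by apply: leq_ltn_trans (lemc_mdeg (ltW lt_m)) _; rewrite mdeg1.
  by rewrite mcoeffD mcoeffX eqxx oG ?addr0 // mdeg1.
(* [M] inverts the linear substitution. *)
apply: contraNneq nz_P => P'0; pose M := - (coef_mx (invmx D) *m Y).
have eY : map_mx (sub M) (- (coef_mx D *m Y)) = Y.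
  rewrite map_mxN map_mxM subC subY mulmxN opprK mulmxA -map_mxM mulmxV // map_mx1.
  by rewrite mul1mx.
have <- : sub M P' = P by rewrite sub_sub eY subid.
by apply/eqP; rewrite P'0; apply: rmorph0.
Qed.

Lemma entriesE (R : Type) m n (Ms : m.-tuple 'M[R]_n) k i j :
  entries Ms 0 (mxvec_index k (mxvec_index i j)) = tnth Ms k i j.
Proof. by rewrite /entries mxvecE mxE mxvecE. Qed.

Lemma common_denominator (K : fieldType) (phi : {rmorphism rat -> K}) n (v : 'I_n -> K) (s : seq K) :
    (forall P : {mpoly rat[n]}, mmap phi v P = 0 -> P = 0) ->
    (forall x, exists N M : {mpoly rat[n]}, M != 0 /\ x = mmap phi v N / mmap phi v M) ->
  exists2 d : {mpoly rat[n]}, d != 0 &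
    forall x, x \in s -> exists P, mmap phi v d * x = mmap phi v P.
Proof.
move=> indep frac; elim: s => [|x s [d nz_d Hd]]; first by exists 1; rewrite ?oner_neq0.
have [N [M [nz_M Dx]]] := frac x; exists (d * M); first by rewrite mulf_neq0.
have nz_vM : mmap phi v M != 0 by apply: contraNneq nz_M => /indep ->.
move=> y; rewrite inE => /predU1P[-> | /Hd[P DP]].
  by exists (d * N); rewrite !rmorphM /= Dx -mulrA; congr (_ * _); rewrite mulrC divfK.
by exists (P * M); rewrite !rmorphM /= -DP mulrAC.
Qed.

Lemma map_mpoly_inj (R S : comNzRingType) n (h : {rmorphism R -> S}) :
  injective h -> injective (map_mpoly h : {mpoly R[n]} -> {mpoly S[n]}).
Proof.
move=> injh p q /mpolyP e; apply/mpolyP => m; apply: injh.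
by have := e m; rewrite !mcoeff_map_mpoly.
Qed.

Lemma quad_eval_cancel (R : comNzRingType) (A B1 B2 C D X : 'M[R]_2) :
  quad_eval A B1 B2 C D (- quad_eval A B1 B2 C D 0 X) X = 0.
Proof.
rewrite /quad_eval; set q := (X in X + 0); set q' := (X in X - _).
by rewrite (addr0 q) subrr.
Qed.

Section Generic.
Variables (K : fieldType) (phi : {rmorphism rat -> K}) (A B1 B2 C D F : 'M[K]_2).
Let Ms := [tuple A; B1; B2; C; D; F].
Let n := (6 * (2 * 2))%N.
Let v : 'I_n -> K := entries Ms 0.
Hypothesis indep : forall P : {mpoly rat[n]}, mmap phi v P = 0 -> P = 0.
Hypothesis frac : forall x, exists N M : {mpoly rat[n]},
  M != 0 /\ x = mmap phi v N / mmap phi v M.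

Let U (k : 'I_6) : 'M[{mpoly rat[n]}]_2 :=
  \matrix_(i, j) 'X_(mxvec_index k (mxvec_index i j)).

Let map_U (S : comNzRingType) (g : {rmorphism rat -> S}) (Ns : 6.-tuple 'M[S]_2) k :
  map_mx (mmap g (entries Ns 0)) (U k) = tnth Ns k.
Proof. by apply/matrixP => i j; rewrite !mxE mmapX mmap1U entriesE. Qed.

Let o (k : nat) (h : (k < 6)%N) : 'I_6 := Ordinal h.

(** Clearing denominators in a relation 1 = sum r f gives a nonzero polynomial [d] in the 24 entries
    that lies in the ideal of the system with indeterminate coefficients. Substituting -(D X + g(X))
    for [F] kills the system, hence [d]. As this substitution is injective, [d] already vanishes
    with [F] replaced by indeterminates, so it vanishes at the given entries, against genericity. *)
Lemma quad_sys_proper : D \in unitmx ->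
  ~ exists r : 'M[{mpoly K[2 * 2]}]_2,
      1 = \sum_i \sum_j r i j * quad_sys A B1 B2 C D F i j.
Proof.
move=> uD [r Dr].
pose s := flatten [seq [seq (r i.1 i.2)@_m | m <- msupp (r i.1 i.2)] | i : 'I_2 * 'I_2].
have [d nz_d Hd] := common_denominator s indep frac.
have [P HP] : exists P : K -> {mpoly rat[n]}, forall x, x \in s ->
    mmap phi v d * x = mmap phi v (P x).
  exists (fun x => epsilon (inhabits 0) (fun P => mmap phi v d * x = mmap phi v P)) => x s_x.
  exact: epsilon_spec (inhabits 0) _ (Hd x s_x).
pose ev := mmap phi v.
pose r' i j : {mpoly {mpoly rat[n]}[2 * 2]} :=
  \sum_(m <- msupp (r i j)) P (r i j)@_m *: 'X_[m].
have Dr' i j : map_mpoly ev (r' i j) = (ev d)%:MP * r i j.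
  rewrite [in RHS](mpolyE (r i j)) mulr_sumr rmorph_sum big_seq [RHS]big_seq.
  apply: eq_bigr => m r_m; rewrite /= map_mpolyZ map_mpolyX mul_mpolyC scalerA HP //.
  by apply/flatten_mapP; exists (i, j); rewrite ?mem_enum //; apply: map_f.
pose fU := quad_sys (U (@o 0 isT)) (U (@o 1 isT)) (U (@o 2 isT)) (U (@o 3 isT))
  (U (@o 4 isT)) (U (@o 5 isT)).
have Dd : d%:MP = \sum_i \sum_j r' i j * fU i j.
  apply: (@map_mpoly_inj _ _ _ (mmap phi v)) => [p q /eqP|].
    by rewrite -subr_eq0 -rmorphB => /eqP/indep/eqP; rewrite subr_eq0 => /eqP.
  have Df : map_mx (map_mpoly ev) fU = quad_sys A B1 B2 C D F.
    by rewrite map_quad_sys !map_U.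
  rewrite map_mpolyC -[LHS]mulr1 [X in _ * X]Dr mulr_sumr [RHS]rmorph_sum /=.
  apply: eq_bigr => i _.
  rewrite mulr_sumr [RHS]rmorph_sum /=; apply: eq_bigr => j _.
  by rewrite rmorphM /= [map_mpoly _ (r' i j)]Dr' -Df mxE mulrA.
pose Y := unknown_mx K 2; pose FY := - quad_eval (coef_mx A) (coef_mx B1) (coef_mx B2)
  (coef_mx C) (coef_mx D) 0 Y.
have DFY : FY = - quad_sys A B1 B2 C D 0 by rewrite /quad_sys coef_mx0.
pose g : {rmorphism rat -> {mpoly K[2 * 2]}} := @mpolyC (2 * 2) K \o phi.
pose Ns M := [tuple coef_mx A; coef_mx B1; coef_mx B2; coef_mx C; coef_mx D; M].
pose th M := mmap g (entries (Ns M) 0).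
have th0 : th FY d = 0.
  have /(congr1 (mmap (th FY) (mxvec Y 0))) := Dd.
  rewrite mmapC => e; apply: (etrans e); rewrite rmorph_sum big1 // => i _.
  rewrite rmorph_sum big1 // => j _; rewrite rmorphM /=.
  have -> : mmap (th FY) (mxvec Y 0) (fU i j) = 0; last by rewrite mulr0.
  have /matrixP/(_ i j) := quad_sys_mmap (th FY) (U (@o 0 isT)) (U (@o 1 isT))
    (U (@o 2 isT)) (U (@o 3 isT)) (U (@o 4 isT)) (U (@o 5 isT)) Y.
  by rewrite mxE => ->; rewrite !map_U quad_eval_cancel mxE.
(* [Q] is [d] with indeterminates in place of [F] only; specializing them back to [F] recovers the
   value of [d]. *)
pose Q := th Y d.
have Q0 : Q = 0.
  apply: (dominant_substitution (A := A) (B1 := B1) (B2 := B2) (C := C) uD).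
  rewrite -DFY -th0 /Q /th mmap_comp; apply: mmap_eq => [c | l] /=; first by rewrite mmapC.
  case/mxvec_indexP: l => k l; case/mxvec_indexP: l => i j; rewrite !entriesE.
  suffices /matrixP/(_ i j) : map_mx (mmap (@mpolyC (2 * 2) K) (mxvec FY 0)) (tnth (Ns Y) k)
      = tnth (Ns FY) k by rewrite [LHS]mxE.
  have e (M : 'M[K]_2) : map_mx (mmap (@mpolyC (2 * 2) K) (mxvec FY 0)) (coef_mx M) = coef_mx M.
    by apply/matrixP => a b; rewrite mxE [coef_mx M a b]mxE mmapC.
  case: k => [[|[|[|[|[|[|k]]]]]] lt_k] //; rewrite !(tnth_nth 0) //=.
  by apply/matrixP => a b; rewrite mxE [Y a b]mxE mmapX mmap1U mxvecE.
have : ev d = 0.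
  rewrite -(rmorph0 (mmap idfun (mxvec F 0))) -Q0 /Q /th mmap_comp.
  apply: mmap_eq => [c | l] /=; first by rewrite mmapC.
  case/mxvec_indexP: l => k l; case/mxvec_indexP: l => i j; rewrite /v !entriesE.
  suffices /matrixP/(_ i j) : map_mx (mmap idfun (mxvec F 0)) (tnth (Ns Y) k)
      = tnth Ms k by rewrite [LHS]mxE => ->.
  have e (M : 'M[K]_2) : map_mx (mmap idfun (mxvec F 0)) (coef_mx M) = M.
    by apply/matrixP => a b; rewrite mxE [coef_mx M a b]mxE mmapC.
  case: k => [[|[|[|[|[|[|k]]]]]] lt_k] //; rewrite !(tnth_nth 0) //=.
  by apply/matrixP => a b; rewrite mxE [Y a b]mxE mmapX mmap1U mxvecE.
by move/indep => d0; rewrite d0 eqxx in nz_d.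
Qed.

End Generic.

(** * The ideal of the system *)

Section Ideal.
Variables (R : comNzRingType) (f : 'M[{mpoly R[2 * 2]}]_2).
Implicit Types h q : {mpoly R[2 * 2]}.

Definition in_ideal h := exists r : 'M[{mpoly R[2 * 2]}]_2,
  h = \sum_i \sum_j r i j * f i j.

Lemma ideal_le_in d h : ideal_le f d h -> in_ideal h.
Proof. by move=> [r [_ Dh]]; exists r. Qed.

Lemma in_ideal0 : in_ideal 0.
Proof. exact: ideal_le_in (ideal_le0 f 0). Qed.

Lemma in_idealM q h : in_ideal h -> in_ideal (q * h).
Proof.
move=> [r ->]; exists (\matrix_(i, j) (q * r i j)).
rewrite mulr_sumr; apply: eq_bigr => i _; rewrite mulr_sumr; apply: eq_bigr => j _.
by rewrite mxE mulrA.
Qed.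

Lemma in_idealD h h' : in_ideal h -> in_ideal h' -> in_ideal (h + h').
Proof.
move=> [r ->] [r' ->]; exists (\matrix_(i, j) (r i j + r' i j)).
rewrite -big_split; apply: eq_bigr => i _; rewrite -big_split; apply: eq_bigr => j _.
by rewrite mxE mulrDl.
Qed.

Lemma in_idealN h : in_ideal h -> in_ideal (- h).
Proof. by rewrite -mulN1r; apply: in_idealM. Qed.

Lemma in_idealB h h' : in_ideal h -> in_ideal h' -> in_ideal (h - h').
Proof. by move=> Ih /in_idealN; apply: in_idealD. Qed.

Lemma in_idealZ a h : in_ideal h -> in_ideal (a *: h).
Proof. by rewrite -mul_mpolyC; apply: in_idealM. Qed.

Lemma in_ideal_sum (I : Type) (s : seq I) (P : pred I) (h : I -> {mpoly R[2 * 2]}) :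
  (forall i, P i -> in_ideal (h i)) -> in_ideal (\sum_(i <- s | P i) h i).
Proof.
move=> Ih; elim/big_rec: _ => [|i q Pi Iq]; first exact: in_ideal0.
exact: in_idealD (Ih i Pi) Iq.
Qed.

Lemma in_ideal_gen i j : in_ideal (f i j).
Proof.
exists (delta_mx i j); rewrite (bigD1 i) //= (bigD1 j) //= !mxE !eqxx mul1r.
rewrite big1 ?addr0 => [|l /negbTE ne_l]; last by rewrite !mxE ne_l andbF mul0r.
rewrite big1 ?addr0 // => k /negbTE ne_k; rewrite big1 // => l _.
by rewrite !mxE ne_k mul0r.
Qed.

Lemma in_ideal_trans h h' h'' : in_ideal (h - h') -> in_ideal (h' - h'') -> in_ideal (h - h'').
Proof. by move=> I1 I2; rewrite -(subrKA h'); apply: in_idealD. Qed.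

Lemma in_ideal_mulB p p' q q' :
  in_ideal (p - p') -> in_ideal (q - q') -> in_ideal (p * q - p' * q').
Proof.
move=> Ip Iq; rewrite (_ : _ - _ = q * (p - p') + p' * (q - q')); last by ring.
by apply: in_idealD; apply: in_idealM.
Qed.

Lemma in_ideal_subst (v : 'I_(2 * 2) -> {mpoly R[2 * 2]}) q :
    (forall i, in_ideal (v i - 'X_i)) -> in_ideal (mmap (@mpolyC _ R) v q - q).
Proof.
move=> Iv; rewrite {2}(mpolyE q) /mmap -sumrB; apply: in_ideal_sum => m _.
rewrite mul_mpolyC -scalerBr; apply: in_idealZ; rewrite /mmap1 mpolyXE_id.
elim: (index_enum _) => [|i s IHs]; first by rewrite !big_nil subrr; apply: in_ideal0.
rewrite !big_cons; apply: in_ideal_mulB => //.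
elim: (m i) => [|k IHk]; first by rewrite !expr0 subrr; apply: in_ideal0.
by rewrite !exprS; apply: in_ideal_mulB.
Qed.

Definition basis_vec (c : 'cV[R]_16) := \sum_k c k 0 *: ('X_[emon k] : {mpoly R[2 * 2]}).

Lemma basis_vecD c c' : basis_vec (c + c') = basis_vec c + basis_vec c'.
Proof. by rewrite -big_split; apply: eq_bigr => k _; rewrite mxE scalerDl. Qed.

Lemma basis_vecZ a c : basis_vec (a *: c) = a *: basis_vec c.
Proof. by rewrite scaler_sumr; apply: eq_bigr => k _; rewrite mxE scalerA. Qed.

Lemma basis_vecB c c' : basis_vec (c - c') = basis_vec c - basis_vec c'.
Proof. by rewrite -scaleN1r basis_vecD basis_vecZ scaleN1r. Qed.

Lemma basis_vec_delta k : basis_vec (delta_mx k 0) = 'X_[emon k].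
Proof.
rewrite /basis_vec (bigD1 k) //= mxE !eqxx scale1r big1 ?addr0 // => l /negbTE ne_l.
by rewrite mxE ne_l scale0r.
Qed.

Lemma emon0 : emon 0 = 0%MM.
Proof. by apply/mnmP => i; rewrite !mnmE div0n. Qed.

(** This is a relation because spanning provides such a matrix without uniqueness; uniqueness has to
    wait for independence. *)
Definition mult_matrix (l : 'I_(2 * 2)) (M : 'M[R]_16) :=
  forall j, in_ideal ('X_l * 'X_[emon j] - basis_vec (col j M)).

Lemma mult_matrix_exists l : spans f -> exists M, mult_matrix l M.
Proof.
move=> spf; have red j : exists c : 'cV[R]_16, in_ideal ('X_l * 'X_[emon j] - basis_vec c).
  have [c [_ /ideal_le_in Ic]] := spf _ (U_(l) + emon j)%MM (leqnn _).
  exists (\col_k c k); rewrite -mpolyXD; move: Ic; congr in_ideal; congr (_ - _).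
  by apply: eq_bigr => k _; rewrite mxE.
have [c Hc] := fin_all_exists red; exists (\matrix_(k, j) c j k 0) => j.
have -> : col j (\matrix_(k, j) c j k 0) = c j; last exact: Hc.
by apply/colP => k; rewrite !mxE.
Qed.

Section MultMatrix.
Variables (l : 'I_(2 * 2)) (M : 'M[R]_16).
Hypothesis HM : mult_matrix l M.

Lemma mult_matrixP c : in_ideal ('X_l * basis_vec c - basis_vec (M *m c)).
Proof.
have -> : basis_vec (M *m c) = \sum_j c j 0 *: basis_vec (col j M).
  rewrite /basis_vec; under [RHS]eq_bigr do rewrite scaler_sumr.
  rewrite exchange_big; apply: eq_bigr => k _ /=; rewrite mxE scaler_suml.
  by apply: eq_bigr => j _; rewrite scalerA !mxE mulrC.
rewrite /basis_vec mulr_sumr -sumrB; apply: in_ideal_sum => j _.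
by rewrite -scalerAr -scalerBr; apply/in_idealZ/HM.
Qed.

Definition eval_at_var (q : {poly R}) : {mpoly R[2 * 2]} := (map_poly (@mpolyC _ R) q).['X_l].

Lemma mult_matrix_horner (q : {poly R}) c :
  in_ideal (eval_at_var q * basis_vec c - basis_vec (horner_mx M q *m c)).
Proof.
rewrite /eval_at_var; elim/poly_ind: q c => [|q a IHq] c.
  rewrite rmorph0 horner0 mul0r rmorph0 mul0mx /basis_vec big1 ?subrr; first exact: in_ideal0.
  by move=> k _; rewrite mxE scale0r.
rewrite !rmorphD !rmorphM /= map_polyX map_polyC horner_mx_X horner_mx_C.
rewrite hornerD hornerMX hornerC mulmxDl mul_scalar_mx basis_vecD basis_vecZ.
rewrite -mulmxE -mulmxA mulrDl mul_mpolyC opprD addrACA subrr addr0 -mulrA.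
apply: in_ideal_trans (IHq _); rewrite -mulrBr; apply: in_idealM.
exact: mult_matrixP.
Qed.

End MultMatrix.

End Ideal.

(** * Consequences of an irreducible characteristic polynomial *)

Section Irreducible.
Variables (K : fieldType) (f : 'M[{mpoly K[2 * 2]}]_2) (l : 'I_(2 * 2)) (M : 'M[K]_16).
Hypothesis proper : ~ in_ideal f 1.
Hypothesis HM : mult_matrix f l M.
Hypothesis irr : irreducible_poly (char_poly M).

Lemma horner_mx_ker (q : {poly K}) (c : 'cV[K]_16) :
  horner_mx M q *m c = 0 -> c = 0 \/ char_poly M %| q.
Proof.
move=> qc0; have [dv | ndv] := boolP (char_poly M %| q); [by right | left].
have /Bezout_coprimepP[[u v] /= uv1] : coprimep (char_poly M) q.
  apply/coprimepP => d d_dv d_dv_q; rewrite -size_poly_eq1.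
  apply: contraNT ndv => d_neq1; rewrite -(eqp_dvdl _ (irr.2 _ d_neq1 d_dv)) //.
have [a nz_a Da] : exists2 a, a != 0 & u * char_poly M + v * q = a%:P.
  have /size_poly1P[a nz_a Da] : size (u * char_poly M + v * q) == 1%N.
    by rewrite (eqp_size uv1) size_poly1.
  by exists a.
apply: (scalerI nz_a); rewrite scaler0 -mul_scalar_mx -(horner_mx_C M) -Da rmorphD !rmorphM /=.
rewrite -!mulmxE Cayley_Hamilton mulmx0 add0r -mulmxA qc0 mulmx0 //.
Qed.

(** Every nonzero vector is cyclic: a nonzero polynomial of degree below 16 is not a multiple of the
    irreducible characteristic polynomial, so the 16 vectors M^i c are independent. *)
Lemma krylov (c t : 'cV[K]_16) : c != 0 ->
  exists2 q : {poly K}, (size q <= 16)%N & horner_mx M q *m c = t.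
Proof.
move=> nz_c; pose Y := \matrix_(i < 16) (M ^+ i *m c)^T.
have YE (r : 'rV[K]_16) : (r *m Y)^T = horner_mx M (rVpoly r) *m c.
  rewrite [in RHS]/rVpoly poly_def rmorph_sum mulmx_suml mulmx_sum_row raddf_sum.
  apply: eq_bigr => i _; rewrite insubT //= => lt_i.
  rewrite rowK linearZ /= trmxK linearZ /= rmorphXn /= horner_mx_X -scalemxAl.
  by congr (r 0 _ *: _); apply: val_inj.
have uY : Y \in unitmx.
  rewrite -row_free_unit -kermx_eq0; apply/negPn/negP => /rowV0Pn[r /sub_kermxP rY nz_r].
  have nz_q : rVpoly r != 0 by apply: contraNneq nz_r => q0; rewrite -[r]rVpolyK q0 linear0.
  have := YE r; rewrite rY trmx0 => /esym/horner_mx_ker[c0 | /(dvdp_leq nz_q)].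
    by rewrite c0 eqxx in nz_c.
  by rewrite size_char_poly leqNgt ltnS size_poly.
exists (rVpoly (t^T *m invmx Y)); first exact: size_poly.
by rewrite -YE mulmxKV ?trmxK.
Qed.

Let I c := in_ideal f (basis_vec c).

Lemma ideal_horner (q : {poly K}) c : I c -> I (horner_mx M q *m c).
Proof.
move=> Ic; have := in_idealB (in_idealM (eval_at_var l q) Ic) (mult_matrix_horner HM q c).
by rewrite opprB addrC subrK.
Qed.

(** The relations between the monomials form a subspace stable under [M]. By cyclicity a nonzero one
    would produce the vector of the monomial 1, against properness. *)
Lemma basis_independent c : in_ideal f (basis_vec c) -> c = 0.
Proof.
move=> Ic; apply/eqP/negPn/negP => /(krylov (delta_mx 0 0))[q _ qc].
apply: proper; have := ideal_horner q Ic; rewrite qc /I basis_vec_delta emon0.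
by rewrite mpolyX0.
Qed.

(** This identifies over [K] the matrices obtained from different places. *)
Lemma mult_matrix_unique M' : mult_matrix f l M' -> M' = M.
Proof.
move=> HM'; apply/matrixP => i j.
have /basis_independent/colP/(_ i) : in_ideal f (basis_vec (col j M' - col j M)).
  rewrite basis_vecB.
  have := in_idealB (HM j) (HM' j); congr in_ideal.
  by move: (basis_vec _) (basis_vec _) ('X_l * _) => a b c; ring.
by rewrite !mxE => /eqP; rewrite subr_eq0 => /eqP.
Qed.

Lemma eval_in_ideal (q : {poly K}) : in_ideal f (eval_at_var l q) <-> char_poly M %| q.
Proof.
have e1 : basis_vec (delta_mx 0 0 : 'cV[K]_16) = 1 by rewrite basis_vec_delta emon0 mpolyX0.
have := mult_matrix_horner HM q (delta_mx 0 0); rewrite e1 mulr1 => Hq.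
split=> [Iq | /dvdpP[u Dq]].
  have := in_idealB Iq Hq; rewrite opprB addrC subrK => /basis_independent/horner_mx_ker[] //.
  by move/colP/(_ 0)/eqP; rewrite !mxE eqxx oner_eq0.
move: Hq; rewrite Dq rmorphM /= Cayley_Hamilton mulr0 mul0mx.
by rewrite (_ : basis_vec 0 = 0) ?subr0 // /basis_vec big1 // => k _; rewrite mxE scale0r.
Qed.

Lemma basis_poly k : exists2 q : {poly K}, (size q <= 16)%N &
  in_ideal f ('X_[emon k] - eval_at_var l q).
Proof.
have nz1 : delta_mx 0 0 != 0 :> 'cV[K]_16.
  by apply/eqP => /colP/(_ 0)/eqP; rewrite !mxE eqxx oner_eq0.
have [q sz_q Dq] := krylov (delta_mx k 0) nz1; exists q => //.
have := mult_matrix_horner HM q (delta_mx 0 0); rewrite Dq !basis_vec_delta emon0 mpolyX0 mulr1.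
by move/in_idealN; rewrite opprB.
Qed.

Lemma emonU v : exists k, emon k = U_(v)%MM.
Proof.
have [i|k ->] := @emonP U_(v)%MM; last by exists k.
by rewrite mnm1E; case: eqP.
Qed.

Lemma variable_poly : exists Q : 'I_(2 * 2) -> {poly K}, forall v,
  in_ideal f ('X_v - eval_at_var l (Q v)).
Proof.
have var v : exists q : {poly K}, in_ideal f ('X_v - eval_at_var l q).
  by have [k Dk] := emonU v; have [q _] := basis_poly k; rewrite Dk; exists q.
exact: fin_all_exists var.
Qed.

End Irreducible.

Lemma mmap_in_ideal (R S : comNzRingType) (h : {rmorphism R -> S}) (x : 'I_(2 * 2) -> S)
    (f : 'M[{mpoly R[2 * 2]}]_2) q :
  (forall i j, mmap h x (f i j) = 0) -> in_ideal f q -> mmap h x q = 0.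
Proof.
move=> f0 [r ->]; rewrite rmorph_sum big1 // => i _; rewrite rmorph_sum big1 // => j _.
by rewrite rmorphM /= f0 mulr0.
Qed.

Lemma mmap_eval_at_var (R S : comNzRingType) (h : {rmorphism R -> S}) (x : 'I_(2 * 2) -> S) l
    (q : {poly R}) :
  mmap h x (eval_at_var l q) = (map_poly h q).[x l].
Proof.
rewrite /eval_at_var -horner_map /= mmapX mmap1U -map_poly_comp.
by congr horner; apply: eq_map_poly => c; rewrite /= mmapC.
Qed.

Lemma horner_mmap (R S : comNzRingType) (h : {rmorphism R -> S}) (a : S) n
    (Q : 'I_n -> {poly R}) (p : {mpoly R[n]}) :
  (map_poly h (mmap polyC Q p)).[a] = mmap h (fun v => (map_poly h (Q v)).[a]) p.
Proof.
rewrite -[LHS]/((horner_eval a \o map_poly h) _) mmap_comp; apply: mmap_eq => // c.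
by rewrite /= /horner_eval map_polyC hornerC.
Qed.

Section Extension.
Variables (K : fieldType) (f : 'M[{mpoly K[2 * 2]}]_2) (l : 'I_(2 * 2)) (M : 'M[K]_16).
Hypothesis proper : ~ in_ideal f 1.
Hypothesis HM : mult_matrix f l M.
Hypothesis irr : irreducible_poly (char_poly M).
Variable Q : 'I_(2 * 2) -> {poly K}.
Hypothesis HQ : forall v, in_ideal f ('X_v - eval_at_var l (Q v)).

Variables (L : fieldType) (iota : {rmorphism K -> L}).

Lemma solution_is_root (x : 'I_(2 * 2) -> L) :
    (forall i j, mmap iota x (f i j) = 0) ->
  root (map_poly iota (char_poly M)) (x l) /\
  forall v, x v = (map_poly iota (Q v)).[x l].
Proof.
move=> f0; split=> [|v].
  rewrite rootE -mmap_eval_at_var (mmap_in_ideal f0) //.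
  exact/(eval_in_ideal proper HM irr)/dvdpp.
apply/eqP; rewrite -subr_eq0 -mmap_eval_at_var.
have <- : mmap iota x 'X_v = x v by rewrite mmapX mmap1U.
by rewrite -rmorphB; apply/eqP/(mmap_in_ideal f0)/HQ.
Qed.

Lemma root_is_solution (a : L) (x := fun v => (map_poly iota (Q v)).[a]) :
    root (map_poly iota (char_poly M)) a ->
  (forall i j, mmap iota x (f i j) = 0) /\ x l = a.
Proof.
move=> root_a.
have eval0 (q : {poly K}) : in_ideal f (eval_at_var l q) -> (map_poly iota q).[a] = 0.
  move/(eval_in_ideal proper HM irr)/dvdpP => [u ->].
  by rewrite rmorphM hornerM /= (rootP root_a) mulr0.
split=> [i j|].
  rewrite -[LHS](horner_mmap iota a Q); apply: eval0; rewrite /eval_at_var horner_mmap.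
  rewrite -[X in in_ideal _ X](subrK (f i j)); apply: in_idealD (in_ideal_gen _ _ _).
  by apply: in_ideal_subst => v; rewrite -opprB; apply/in_idealN/HQ.
apply/eqP; rewrite -subr_eq0 -oppr_eq0 opprB; apply/eqP.
have := eval0 ('X - Q l); rewrite rmorphB /= map_polyX hornerD hornerX hornerN; apply.
by rewrite /eval_at_var rmorphB /= map_polyX hornerD hornerX hornerN; apply: HQ.
Qed.

(** Over [L] the characteristic polynomial splits, so the cyclic vector argument is lost. A relation
    is evaluated instead at the 16 solutions: it becomes a polynomial of degree below 16 in b with
    16 distinct roots. *)
Lemma extension_independent (a : 'I_16 -> L) (c : 'cV[L]_16) :
    map_poly iota (char_poly M) = \prod_i ('X - (a i)%:P) -> injective a ->
  in_ideal (map_mx (map_mpoly iota) f) (basis_vec c) -> c = 0.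
Proof.
move=> Da inj_a Ic.
have [q Hq] : exists q : 'I_16 -> {poly K}, forall k, (size (q k) <= 16)%N /\
    in_ideal f ('X_[emon k] - eval_at_var l (q k)).
  apply: (@fin_all_exists 'I_16 (fun=> {poly K}) (fun k q => (size q <= 16)%N /\
    in_ideal f ('X_[emon k] - eval_at_var l q))) => k.
  by have [q sz_q Iq] := basis_poly HM irr k; exists q.
(* The change of basis from the monomials to the powers of b, invertible by independence over
   [K]. *)
pose W : 'M[K]_16 := \matrix_(k, m) (q k)`_m.
have uW : W \in unitmx.
  rewrite -row_free_unit -kermx_eq0; apply/negPn/negP => /rowV0Pn[r /sub_kermxP rW /negP[]].
  apply/eqP/trmx_inj; rewrite trmx0; apply: (basis_independent proper HM irr).
  have sum0 : \sum_k r 0 k *: q k = 0.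
    apply/polyP => m; rewrite coef0 coef_sum.
    have [lt_m | le_m] := ltnP m 16.
      have /rowP/(_ (Ordinal lt_m)) := rW; rewrite !mxE => e; rewrite -[RHS]e.
      by apply: eq_bigr => k _; rewrite coefZ mxE.
    rewrite big1 // => k _; rewrite coefZ nth_default ?mulr0 //.
    by apply: leq_trans le_m; case: (Hq k).
  rewrite -[basis_vec _]subr0.
  have <- : eval_at_var l (\sum_k r 0 k *: q k) = 0 by rewrite sum0 /eval_at_var rmorph0 horner0.
  rewrite /eval_at_var rmorph_sum horner_sum -sumrB; apply: in_ideal_sum => k _.
  rewrite mxE /= map_polyZ hornerZ mul_mpolyC -scalerBr.
  by apply: in_idealZ; case: (Hq k).
have : c^T *m map_mx iota W = 0.
  pose p := \sum_k c k 0 *: map_poly iota (q k).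
  have sz_p : (size p <= 16)%N.
    apply: leq_trans (size_sum _ _ _) _; apply/bigmax_leqP => k _.
    by apply: leq_trans (size_scale_leq _ _) _; rewrite size_map_poly; case: (Hq k).
  have p0 : p = 0.
    apply: (@roots_geq_poly_eq0 _ p [seq a i | i : 'I_16]); last by rewrite size_map size_enum_ord.
      apply/allP => _ /mapP[i _ ->].
      have root_i : root (map_poly iota (char_poly M)) (a i).
        rewrite Da rootE horner_prod prodf_seq_eq0; apply/hasP.
        by exists i; rewrite ?mem_index_enum //= hornerXsubC subrr.
      pose x v := (map_poly iota (Q v)).[a i].
      have [f0 xl] : (forall i' j', mmap iota x (f i' j') = 0) /\ x l = a i.
        exact: root_is_solution root_i.
      have f0' i' j' : mmap idfun x (map_mx (map_mpoly iota) f i' j') = 0.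
        by rewrite mxE mmap_map -(f0 i' j').
      have := mmap_in_ideal f0' Ic; rewrite rootE => e; apply/eqP; rewrite -[RHS]e.
      rewrite horner_sum rmorph_sum; apply: eq_bigr => k _.
      rewrite /= mmapZ hornerZ; congr (_ * _).
      have [_ Iq] := Hq k; have := mmap_in_ideal f0 Iq.
      rewrite rmorphB /= mmap_eval_at_var xl => /eqP; rewrite subr_eq0 => /eqP <-.
      by rewrite !mmapX.
    by rewrite map_inj_uniq ?enum_uniq.
  apply/rowP => m; rewrite !mxE; have /polyP/(_ m) := p0; rewrite coef0 coef_sum => e; rewrite -[RHS]e.
  by apply: eq_bigr => k _; rewrite coefZ coef_map !mxE.
rewrite -[_ *m _]trmxK => /(canRL trmxK); rewrite trmx0 trmx_mul trmxK => e.
have uW' : (map_mx iota W)^T \in unitmx by rewrite unitmx_tr map_unitmx.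
by rewrite -[c](mulKmx uW') e mulmx0.
Qed.

End Extension.

Lemma quad_eval_split (R : comNzRingType) (A B1 B2 C D F X : 'M[R]_2) :
  quad_eval A B1 B2 C D F X = quad_eval A B1 B2 C 0 0 X + (D *m X + F).
Proof.
rewrite /quad_eval mul0mx; set q := (X in X + _ *m _ + F).
by rewrite 2!(addr0 q) addrA.
Qed.

(** * The homogeneous equation *)

Section Homogeneous.
Variables (L : fieldType) (A B1 B2 C D F : 'M[L]_2).
Let g := quad_sys A B1 B2 C 0 0.
Let f := quad_sys A B1 B2 C D F.

Lemma quadratic_part_homog i j : g i j \is 2.-homog.
Proof.
apply/dhomogP => m g_m; apply/eqP; rewrite eqn_leq; apply/andP; split.
  by rewrite -ltnS; apply: leq_trans (msize_mdeg_lt g_m) (quad_sys_msize _ _ _ _ _ _ _ _).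
rewrite leqNgt; apply/negP => lt_m; move: g_m; rewrite mcoeff_msupp.
by rewrite (quadratic_part_order A B1 B2 C i j lt_m) eqxx.
Qed.

(** Since [g] is homogeneous of degree 2, it suffices to keep the terms of degree d - 2 in the
    multipliers. *)
Lemma pihomog_ideal d h : in_ideal g h -> ideal_le g d (pihomog mdeg d h).
Proof.
move=> [r ->].
pose r' i j := \sum_(m <- msupp (r i j) | (mdeg m + 2 == d)%N) (r i j)@_m *: ('X_[m] : {mpoly L[2 * 2]}).
exists (\matrix_(i, j) r' i j); split=> [i j|].
  rewrite mxE; apply: leq_trans (msize_sum _ _ _) _; apply/bigmax_leqP_seq => m _ /eqP <-.
  by apply: leq_trans (msizeZ_le _ _) _; rewrite msizeX addn2.
rewrite raddf_sum; apply: eq_bigr => i _; rewrite raddf_sum; apply: eq_bigr => j _ /=.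
rewrite mxE /r' mulr_suml {1}(mpolyE (r i j)) mulr_suml raddf_sum [RHS]big_mkcond.
apply: eq_bigr => m _ /=; rewrite -!scalerAl linearZ /=.
have homXg : 'X_[m] * g i j \is (mdeg m + 2).-homog.
  by apply: dhomogM (quadratic_part_homog i j); rewrite dhomogX.
case: eqP => [<- | /eqP ne_d]; first by rewrite pihomog_dE.
by rewrite (pihomog_ne0 _ homXg) // scaler0.
Qed.

Definition degree_part d (c : 'cV[L]_16) : 'cV[L]_16 :=
  \col_k (if mdeg (emon k) == d then c k 0 else 0).

Lemma pihomog_basis_vec d c : pihomog mdeg d (basis_vec c) = basis_vec (degree_part d c).
Proof.
rewrite /basis_vec raddf_sum; apply: eq_bigr => k _ /=; rewrite linearZ /= pihomogX mxE.
by case: eqP => _; rewrite ?scaler0 ?scale0r.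
Qed.

Hypothesis span_f : spans f.
Hypothesis span_g : spans g.
Hypothesis indep_f : forall c : 'cV[L]_16, in_ideal f (basis_vec c) -> c = 0.

(* Replacing g by f in a homogeneous relation of degree d changes it by terms of
   degree less than d, which can be absorbed into the lower part of the basis. *)
Lemma quadratic_part_independent (c : 'cV[L]_16) : in_ideal g (basis_vec c) -> c = 0.
Proof.
move=> Ic; apply/colP => k0; rewrite mxE; set d := mdeg (emon k0).
have [r [dr Dr]] := pihomog_ideal d Ic; rewrite pihomog_basis_vec in Dr.
have ck : degree_part d c k0 0 = c k0 0 by rewrite mxE eqxx.
pose p := \sum_i \sum_j r i j * (f i j - g i j).
have Dp : p = (\sum_i \sum_j r i j * f i j) - basis_vec (degree_part d c).
  rewrite Dr /p -sumrB; apply: eq_bigr => i _; rewrite -sumrB; apply: eq_bigr => j _.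
  by rewrite mulrBr.
have [d0 | d_gt0] := posnP d.
  have p0 : p = 0.
    rewrite /p big1 // => i _; rewrite big1 // => j _.
    have := dr i j; rewrite d0 leqn0 msize_poly_eq0 => /eqP ->; exact: mul0r.
  rewrite -ck; suff -> : degree_part d c = 0 by rewrite mxE.
  apply: indep_f; exists r; apply/eqP; rewrite eq_sym -subr_eq0 -Dp; exact/eqP.
have deg_fg i j : (msize (f i j - g i j) <= 2)%N.
  have -> : f i j - g i j = (coef_mx D *m unknown_mx L 2 + coef_mx F) i j.
    have -> : f = g + (coef_mx D *m unknown_mx L 2 + coef_mx F).
      by rewrite /f /g /quad_sys quad_eval_split coef_mx0.
    by rewrite [(g + _) i j]mxE (addrC (g i j)) addrK.
  rewrite mxE; apply: leq_trans (msizeD_le _ _) _; rewrite geq_max; apply/andP; split.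
    rewrite mxE; apply: leq_trans (msize_sum _ _ _) _; apply/bigmax_leqP_seq => k _ _.
    rewrite mxE mul_mpolyC; apply: leq_trans (msizeZ_le _ _) _.
    by rewrite mxE msizeX mdeg1.
  by rewrite mxE msizeC; case: eqP.
have : (msize p <= d.-1.+1)%N.
  apply: leq_trans (msize_sum _ _ _) _; apply/bigmax_leqP_seq => i _ _.
  apply: leq_trans (msize_sum _ _ _) _; apply/bigmax_leqP_seq => j _ _.
  apply: leq_trans (msizeM_pred _ _) _.
  by move: (msize (r i j)) (msize (f i j - g i j)) (dr i j) (deg_fg i j) => x y; lia.
move=> /(spans_reduces span_f)[c' [dc' /ideal_le_in Ip]].
have : in_ideal f (basis_vec (degree_part d c + \col_k c' k)).
  have Ir : in_ideal f (\sum_i \sum_j r i j * f i j) by exists r.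
  have := in_idealB Ir Ip; congr in_ideal; rewrite Dp basis_vecD.
  have -> : basis_vec (\col_k c' k) = \sum_k c' k *: 'X_[emon k].
    by apply: eq_bigr => k _; rewrite mxE.
  by move: (\sum_i _) (basis_vec _) (\sum_k _) => x y z; ring.
(* The correction [c'] lives in degrees at most d - 1, so it does not touch the coefficient at
   [k0]. *)
move/indep_f/colP/(_ k0); rewrite mxE ck [(\col_k _) _ _]mxE mxE dc' ?addr0 //.
by rewrite prednK.
Qed.

End Homogeneous.

(** * The local ring at the origin *)

Lemma mdeg_emon k : (mdeg (emon k) <= 4)%N.
Proof.
rewrite mdegE; apply: (@leq_trans (\sum_(i < 2 * 2) 1)%N).
  by apply: leq_sum => i _; rewrite mnmE leq_b1.
by rewrite sum_nat_const card_ord.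
Qed.

Lemma meval_origin (R : comNzRingType) n (v : 'I_n -> R) (q : {mpoly R[n]}) :
  (forall i, v i = 0) -> q.@[v] = q@_0%MM.
Proof.
move=> v0; rewrite [q in LHS]mpolyE rmorph_sum /=.
have ev m : ('X_[m] : {mpoly R[n]}).@[v] = (m == 0%MM)%:R.
  rewrite mevalX; case: eqP => [->|/eqP nz_m].
    by rewrite big1 // => i _; rewrite mnm0E expr0.
  have [i nz_i] : exists i, m i != 0%N.
    apply/existsP; apply: contraNT nz_m; rewrite negb_exists => /forallP m0.
    by apply/eqP/mnmP => i; rewrite mnm0E; apply/eqP; have := m0 i; rewrite negbK.
  by rewrite (bigD1 i) //= v0 expr0n (negbTE nz_i) mul0r.
under eq_bigr do rewrite mevalZ ev.
have [q0 | nq0] := boolP (0%MM \in msupp q).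
  rewrite (bigD1_seq 0%MM) ?msupp_uniq //= eqxx mulr1 big1 ?addr0 // => m /negbTE ->.
  by rewrite mulr0.
rewrite (memN_msupp_eq0 nq0) big_seq big1 // => m q_m.
by case: eqP => [m0|_]; [rewrite m0 (negbTE nq0) in q_m | rewrite mulr0].
Qed.

Lemma fraction_sub_eq (E : fieldType) (p q q' b : E) :
  q != 0 -> p / q - b = (q * (p * q' - b) - p * (q * q' - 1)) / q.
Proof. by move=> nz_q; field. Qed.

Lemma fraction_clear (E : fieldType) (p q b h s : E) :
  q != 0 -> s != 0 -> p / q - b = h / s -> s * p - s * q * b = q * h.
Proof.
move=> nz_q nz_s e; have -> : s * p - s * q * b = s * q * (p / q - b) by field.
by rewrite e; field.
Qed.

Section Multiplicity.
Variables (L : fieldType) (A B1 B2 C : 'M[L]_2).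
Let g := quad_sys A B1 B2 C 0 0.
Hypothesis span_g : spans g.
Hypothesis indep_g : forall c : 'cV[L]_16, in_ideal g (basis_vec c) -> c = 0.

(** In the homogeneous component of a reduction of the monomial, no basis monomial remains, as these
    have degree at most 4. *)
Lemma high_degree_in_ideal m : (5 <= mdeg m)%N -> in_ideal g 'X_[m].
Proof.
move=> m_ge5; have [c [_ Ic]] := span_g (leqnn (mdeg m)).
have := ideal_le_in (pihomog_ideal (mdeg m) (ideal_le_in Ic)).
rewrite raddfB /= pihomogX eqxx.
have -> : pihomog mdeg (mdeg m) (\sum_k c k *: 'X_[emon k]) = 0 :> {mpoly L[2 * 2]}.
  rewrite [LHS]raddf_sum big1 // => k _ /=; rewrite linearZ /= pihomogX.
  case: eqP => [e|_]; last exact: scaler0.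
  by have := mdeg_emon k; rewrite e leqNgt m_ge5.
by rewrite subr0.
Qed.

Lemma order_ge_in_ideal q : order_ge 5 q -> in_ideal g q.
Proof.
move=> oq; rewrite [q]mpolyE big_seq; apply: in_ideal_sum => m q_m; apply: in_idealZ.
apply: high_degree_in_ideal; rewrite leqNgt; apply/negP => /oq/eqP.
by rewrite mcoeff_eq0 q_m.
Qed.

(** Up to a constant [q] is 1 - n with n vanishing at the origin; n^5 lies in the ideal, so the
    geometric series stops. Localizing at the origin thus does not change the quotient. *)
Lemma unit_mod_ideal q : q@_0%MM != 0 -> exists q', in_ideal g (q * q' - 1).
Proof.
move=> nz_q; pose a := q@_0%MM; pose n := 1 - a^-1 *: q.
have on : order_ge 1 n.
  move=> m; rewrite ltnS leqn0 mdeg_eq0 => /eqP ->.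
  by rewrite mcoeffB mcoeff1 eqxx mcoeffZ mulVf ?subrr.
have on5 : order_ge 5 (n * (n * (n * (n * n)))).
  exact: (order_geM on (order_geM on (order_geM on (order_geM on on)))).
exists (a^-1 *: (1 + n + n ^+ 2 + n ^+ 3 + n ^+ 4)).
have := in_idealN (order_ge_in_ideal on5); congr in_ideal.
rewrite -scalerAr scalerAl -mul_mpolyC.
have -> : a^-1%:MP * q = 1 - n by rewrite /n opprB addrC subrK mul_mpolyC.
by ring.
Qed.

Let zero_pt := mxvec (0 : 'M[L]_2).

Let eval_zero (q : {mpoly L[2 * 2]}) : q.@[zero_pt 0] = q@_0%MM.
Proof. by apply: meval_origin => i; rewrite /zero_pt linear0 mxE. Qed.

Lemma local_idealP u : in_local_ideal zero_pt g u <->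
  exists h q, [/\ in_ideal g h, q@_0%MM != 0 & u = tofrac h / tofrac q].
Proof.
have nz_frac q : q@_0%MM != 0 -> tofrac q != 0.
  by move=> nz_q; rewrite tofrac_eq0; apply: contraNneq nz_q => ->; rewrite mcoeff0.
have coef0M (q q' : {mpoly L[2 * 2]}) : (q * q')@_0%MM = q@_0%MM * q'@_0%MM.
  by rewrite -!eval_zero rmorphM.
pose form u := exists h q, [/\ in_ideal g h, q@_0%MM != 0 & u = tofrac h / tofrac q].
have form0 : form 0.
  by exists 0, 1; rewrite mcoeff1 eqxx oner_neq0 rmorph0 mul0r; split=> //; apply: in_ideal0.
have formD x y : form x -> form y -> form (x + y).
  move=> [h [q [Ih nz_q ->]]] [h' [q' [Ih' nz_q' ->]]].
  exists (q' * h + q * h'), (q * q'); rewrite coef0M mulf_neq0 //; split=> //.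
    by apply: in_idealD; apply: in_idealM.
  rewrite addf_div ?nz_frac // rmorphD !rmorphM /=; congr ((_ + _) / _); exact: mulrC.
split=> [[r [Hr ->]] | [h [q [[r ->] nz_q ->]]]].
  rewrite -/(form _); elim/big_rec: _ => // i x _ Fx; apply: (formD _ _ _ Fx).
  elim/big_rec: _ => // j y _ Fy; apply: (formD _ _ _ Fy).
  have [p [q [nz_q ->]]] := Hr i j; rewrite eval_zero in nz_q.
  exists (p * g i j), q; split=> //; first exact/in_idealM/in_ideal_gen.
  by rewrite rmorphM /= mulrAC.
exists (fun i j => tofrac (r i j) / tofrac q); split=> [i j|].
  by exists (r i j), q; rewrite eval_zero.
rewrite rmorph_sum mulr_suml; apply: eq_bigr => i _.
rewrite rmorph_sum mulr_suml; apply: eq_bigr => j _.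
by rewrite rmorphM /= mulrAC.
Qed.

(** A fraction p / q is congruent to [p * q'], where [q'] inverts [q] modulo the ideal, so spanning
    and independence pass from polynomials to the local ring. *)
Lemma quadratic_part_multiplicity : has_multiplicity g 0 16.
Proof.
have nz_frac q : q@_0%MM != 0 -> tofrac q != 0 :> {fraction {mpoly L[2 * 2]}}.
  by move=> nz_q; rewrite tofrac_eq0; apply: contraNneq nz_q => ->; rewrite mcoeff0.
have one0 : (1 : {mpoly L[2 * 2]})@_0%MM != 0 by rewrite mcoeff1 eqxx oner_neq0.
have sumE (c : 'rV[L]_16) : \sum_k tofrac (c 0 k)%:MP * tofrac 'X_[emon k]
    = tofrac (basis_vec c^T) :> {fraction {mpoly L[2 * 2]}}.
  by rewrite rmorph_sum; apply: eq_bigr => k _; rewrite -rmorphM mul_mpolyC mxE.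
exists (fun k => tofrac 'X_[emon k]); split=> [k|u].
  by exists 'X_[emon k], 1; rewrite eval_zero one0 rmorph1 divr1.
move=> [p [q []]]; rewrite eval_zero => nz_q ->.
have [q' Iq'] := unit_mod_ideal nz_q.
have [c [_ /ideal_le_in Ic]] := spans_reduces span_g (leqnSn (msize (p * q'))).
exists (\row_k c k); split=> [|c'].
  apply/local_idealP.
  exists (q * (p * q' - \sum_k c k *: 'X_[emon k]) - p * (q * q' - 1)), q; split=> //.
    by apply: in_idealB; apply: in_idealM.
  rewrite sumE (_ : basis_vec _ = \sum_k c k *: 'X_[emon k]); last first.
    by apply: eq_bigr => k _; rewrite !mxE.
  rewrite rmorphB !rmorphM !rmorphB !rmorphM rmorph1 /=.
  exact/fraction_sub_eq/nz_frac.
move=> /local_idealP[h [s [Ih nz_s]]]; rewrite sumE => Dh.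
have [s' Is'] := unit_mod_ideal nz_s.
apply: trmx_inj; apply/eqP; rewrite -subr_eq0; apply/eqP/indep_g.
have Bc : in_ideal g (p * q' - basis_vec (\row_k c k)^T).
  move: Ic; congr (in_ideal _ (_ - _)).
  by apply: eq_bigr => k _; rewrite !mxE.
have Bc' : in_ideal g (p * q' - basis_vec c'^T).
  have : s * p - s * q * basis_vec c'^T = q * h.
    apply/eqP; rewrite -tofrac_eq; apply/eqP; rewrite rmorphB !rmorphM /=.
    exact: fraction_clear (nz_frac _ nz_q) (nz_frac _ nz_s) Dh.
  move=> e; have Ie : in_ideal g (s * p - s * q * basis_vec c'^T) by rewrite e; apply: in_idealM.
  have := in_idealM (s' * q') Ie; set b := basis_vec _ => Ib.
  have I1 := in_idealM (p * q' - b) Is'; have I2 := in_idealM b Iq'.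
  have I3 := in_idealM (s * s' * b) Iq'.
  (* The inverses [s'] and [q'] undo, modulo the ideal, the multiplication by [s * q] that cleared
     the denominators. *)
  have -> : p * q' - b = s' * q' * (s * p - s * q * b) - (p * q' - b) * (s * s' - 1)
     + s * s' * b * (q * q' - 1) by ring.
  by apply: in_idealD => //; apply: in_idealB.
have := in_idealB Bc' Bc; congr in_ideal.
rewrite basis_vecB.
by move: (basis_vec _) (basis_vec _) (p * q') => x y z; ring.
Qed.

End Multiplicity.

Lemma mult_matrix_map (R S : comNzRingType) (h : {rmorphism R -> S})
    (f : 'M[{mpoly R[2 * 2]}]_2) l M :
  mult_matrix f l M -> mult_matrix (map_mx (map_mpoly h) f) l (map_mx h M).
Proof.
move=> HM j; have [r Dr] := HM j; exists (map_mx (map_mpoly h) r).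
have := congr1 (map_mpoly h) Dr; rewrite rmorphB rmorphM /= !map_mpolyX rmorph_sum /= => e.
transitivity ('X_l * 'X_[emon j] - \sum_i map_mpoly h (col j M i 0 *: 'X_[emon i])).
  congr (_ - _); apply: eq_bigr => k _.
  by rewrite map_mpolyZ map_mpolyX !mxE.
rewrite e rmorph_sum; apply: eq_bigr => a _; rewrite rmorph_sum; apply: eq_bigr => b _.
by rewrite rmorphM !mxE.
Qed.

(** The values of the 16 monomials at a solution form a left eigenvector of [M], nonzero because one
    monomial is 1. Its eigenvalue is the coordinate [l], and 16 distinct eigenvalues exhaust the
    characteristic polynomial. *)
Lemma char_poly_of_solutions (k L : fieldType) (inc : {rmorphism k -> L})
    (f : 'M[{mpoly k[2 * 2]}]_2) l M (x : 'I_16 -> 'I_(2 * 2) -> L) :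
    mult_matrix f l M -> (forall t i j, mmap inc (x t) (f i j) = 0) ->
    injective (fun t => x t l) ->
  map_poly inc (char_poly M) = \prod_t ('X - (x t l)%:P).
Proof.
move=> HM f0 inj_x; rewrite map_char_poly.
have root_t t : root (char_poly (map_mx inc M)) (x t l).
  rewrite -eigenvalue_root_char; apply/eigenvalueP.
  exists (\row_j mmap inc (x t) 'X_[emon j]).
    apply/rowP => j; have := mmap_in_ideal (f0 t) (HM j).
    rewrite rmorphB rmorphM /= mmapX mmap1U => /eqP; rewrite subr_eq0 !mxE => /eqP ->.
    rewrite rmorph_sum; apply: eq_bigr => i _.
    by rewrite /= mmapZ !mxE mulrC.
  apply/eqP => /rowP/(_ 0)/eqP; rewrite !mxE emon0 mpolyX0 rmorph1; exact/negP/oner_neq0.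
pose rs := [seq x t l | t : 'I_16].
have size_rs : size rs = 16%N by rewrite size_map size_enum_ord.
rewrite (@all_roots_prod_XsubC _ (char_poly (map_mx inc M)) rs).
- rewrite (monicP (char_poly_monic _)) scale1r big_map big_enum.
  by [].
- by rewrite size_char_poly size_rs.
- by apply/allP => _ /mapP[t _ ->].
by rewrite uniq_rootsE map_inj_uniq ?enum_uniq.
Qed.

(** * The Galois group of the generic equation *)

Section Model.
Variables (K : fieldType) (phi : {rmorphism rat -> K}) (A B1 B2 C D F : 'M[K]_2).
Hypothesis Hgen : generic_matrices phi [tuple A; B1; B2; C; D; F].
Hypothesis HK : generated_by_entries phi [tuple A; B1; B2; C; D; F].

Lemma entries_frac x : exists N M : {mpoly rat[6 * (2 * 2)]}, M != 0 /\
  x = mmap phi (entries [tuple A; B1; B2; C; D; F] 0) N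
      / mmap phi (entries [tuple A; B1; B2; C; D; F] 0) M.
Proof. exact: generated_frac Hgen (HK x). Qed.

Lemma special_place (Dz Fz : 'M[int]_2) : exists pl : place K 'F_3, forall i j,
  [/\ res pl (A i j) (A0 'F_3 i j), res pl (B1 i j) (B10 'F_3 i j),
      res pl (B2 i j) (B20 'F_3 i j) & res pl (C i j) (C0 'F_3 i j)] /\
  (res pl (D i j) (Dz i j)%:~R /\ res pl (F i j) (Fz i j)%:~R).
Proof.
have [eA eB1 eB2 eC] := map_special (intr : {rmorphism int -> 'F_3}).
pose c := entries [tuple A0 int; B10 int; B20 int; C0 int; Dz; Fz] 0.
have [pl Hpl] := generic_place c Hgen entries_frac (isT : prime 3).
have Hk k i j : res pl (tnth [tuple A; B1; B2; C; D; F] k i j)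
    (tnth [tuple A0 int; B10 int; B20 int; C0 int; Dz; Fz] k i j)%:~R.
  by rewrite -!entriesE; apply: Hpl.
exists pl => i j; rewrite -eA -eB1 -eB2 -eC !(mxE map_mx_key).
split; [split | split].
- exact: (Hk (Ordinal (isT : 0 < 6)%N) i j).
- exact: (Hk (Ordinal (isT : 1 < 6)%N) i j).
- exact: (Hk (Ordinal (isT : 2 < 6)%N) i j).
- exact: (Hk (Ordinal (isT : 3 < 6)%N) i j).
- exact: (Hk (Ordinal (isT : 4 < 6)%N) i j).
exact: (Hk (Ordinal (isT : 5 < 6)%N) i j).
Qed.

Lemma res_lift_mx (k : fieldType) (pl : place K k) (M : 'M[K]_2) (M' : 'M[k]_2) :
    (forall i j, res pl (M i j) (M' i j)) ->
  exists MV : 'M[valuation_ring pl]_2, map_mx val MV = M /\ map_mx (residue (pl := pl)) MV = M'.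
Proof.
move=> HM.
have Hi i : exists w : 'I_2 -> valuation_ring pl, forall j, M i j = val (w j) /\ residue (w j) = M' i j.
  apply: (@fin_all_exists 'I_2 (fun=> valuation_ring pl)
    (fun j w => M i j = val w /\ residue w = M' i j)) => j.
  exact: res_lift.
have [w Hw] := fin_all_exists Hi; exists (\matrix_(i, j) w i j).
by split; apply/matrixP => i j; rewrite !mxE; case: (Hw i j).
Qed.

(** This collects all that one place yields: spanning over its valuation ring, invertibility of [D]
    from its residue, and a matrix over that ring whose characteristic polynomial reduces to the one
    with roots [beta]. *)
Lemma point_model (Dz Fz : 'M[int]_2) (Q : forall L : fieldType, ('I_16 -> L) -> Prop)
    (l := mxvec_index 0 1 : 'I_(2 * 2)) (f := quad_sys A B1 B2 C D F) :
    frobenius_point Dz Fz Q ->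
  [/\ spans f, spans (quad_sys A B1 B2 C 0 0),
      \det (map_mx intr Dz : 'M['F_3]_2) != 0 -> D \in unitmx &
      exists (V : comNzRingType) (j : {rmorphism V -> K}) (pi : {rmorphism V -> 'F_3})
        (M : 'M[V]_16) (L : fieldType) (inc : {rmorphism 'F_3 -> L}) (beta : 'I_16 -> L),
      [/\ injective j,
          forall x : K, (exists v, x = j v) \/ (exists v, x^-1 = j v /\ pi v = 0),
          mult_matrix f l (map_mx j M) /\
          map_poly (inc \o pi) (char_poly M) = \prod_i ('X - (beta i)%:P),
          injective beta & Q L beta]].
Proof.
move=> [L [inc [beta [inj_beta sol Qbeta]]]].
have [pl Hpl] := special_place Dz Fz.
pose V := valuation_ring pl; pose j : {rmorphism V -> K} := val.
pose pi : {rmorphism V -> 'F_3} := residue (pl := pl).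
have [AV [jA piA]] := res_lift_mx (fun a b => let: conj (And4 e _ _ _) _ := Hpl a b in e).
have [B1V [jB1 piB1]] := res_lift_mx (fun a b => let: conj (And4 _ e _ _) _ := Hpl a b in e).
have [B2V [jB2 piB2]] := res_lift_mx (fun a b => let: conj (And4 _ _ e _) _ := Hpl a b in e).
have [CV [jC piC]] := res_lift_mx (fun a b => let: conj (And4 _ _ _ e) _ := Hpl a b in e).
have [DV [jD piD]] : exists DV : 'M[V]_2, map_mx j DV = D /\ map_mx pi DV = map_mx intr Dz.
  by apply: res_lift_mx => a b; rewrite mxE; case: (Hpl a b) => _ [].
have [FV [jF piF]] : exists FV : 'M[V]_2, map_mx j FV = F /\ map_mx pi FV = map_mx intr Fz.
  by apply: res_lift_mx => a b; rewrite mxE; case: (Hpl a b) => _ [].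
rewrite -/j -/pi in jA piA jB1 piB1 jB2 piB2 jC piC.
have injj : injective j by apply: val_inj.
have units (v : V) : pi v != 0 -> exists u, u * v = 1.
  move=> nz_v; have [u [Du _]] := res_lift (resV (residueP v) nz_v).
  exists u; apply: (injj); rewrite rmorphM rmorph1 -[j u]Du mulVf //.
  by apply: contraNneq nz_v => v0; rewrite (_ : v = 0) ?rmorph0 //; apply: (injj); rewrite rmorph0.
have surj (y : 'F_3) : exists v, pi v = y.
  by exists (y : nat)%:R; rewrite rmorph_nat natr_Zp.
(* Spanning at the special point holds for all [D] and [F], so this covers both the full system and
   its quadratic part. *)
have spansV D' F' : spans (quad_sys AV B1V B2V CV D' F').
  apply: (spans_lift units surj) => [a b|]; first exact: quad_sys_msize.
  by rewrite map_quad_sys piA piB1 piB2 piC; apply: special_spans.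
pose fV := quad_sys AV B1V B2V CV DV FV.
have jf : map_mx (map_mpoly j) fV = f by rewrite map_quad_sys jA jB1 jB2 jC jD jF.
split.
- by rewrite -jf; apply/spans_map/spansV.
- have := spans_map j (spansV 0 0); rewrite map_quad_sys jA jB1 jB2 jC.
  by rewrite (map_mx0 j).
- rewrite unitmxE unitfE -jD -piD !det_map_mx => nz_det.
  by apply: contraNneq nz_det => d0; rewrite (_ : \det DV = 0) ?rmorph0 //; apply: (injj); rewrite rmorph0.
have [M HM] := mult_matrix_exists l (spansV DV FV).
exists V, j, pi, M, L, inc, beta; split=> //.
  exact: valuation_ring_total.
split; first by rewrite -jf; apply: mult_matrix_map.
have [X HX] : exists X : 'I_16 -> 'M[L]_2, forall t, X t 0 1 = beta t /\
    special_sys (map_mx intr Dz) (map_mx intr Fz) (X t) = 0.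
  apply: (@fin_all_exists 'I_16 (fun=> 'M[L]_2) (fun t X => X 0 1 = beta t /\
    special_sys (map_mx intr Dz) (map_mx intr Fz) X = 0)) => t.
  by have [X X01 X0] := sol t; exists X.
have Xl t : mxvec (X t) 0 l = beta t by rewrite mxvecE; case: (HX t).
have [eA eB1 eB2 eC] := map_special inc.
have := char_poly_of_solutions (inc := inc) (x := fun t => mxvec (X t) 0) (mult_matrix_map pi HM).
rewrite map_quad_sys piA piB1 piB2 piC piD piF -map_char_poly -map_poly_comp => ->.
- by apply: eq_bigr => t _; rewrite Xl.
- move=> t a b; have [_ X0] := HX t.
  have /matrixP/(_ a b) := quad_sys_mmap inc (A0 _) (B10 _) (B20 _) (C0 _)
    (map_mx intr Dz) (map_mx intr Fz) (X t).
  rewrite mxE => ->; rewrite eA eB1 eB2 eC.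
  have im (N : 'M[int]_2) : map_mx inc (map_mx intr N) = map_mx intr N.
    by apply/matrixP => a' b'; rewrite !mxE rmorph_int.
  by rewrite !im -/(special_sys _ _ _) X0 mxE.
by move=> t t'; rewrite !Xl => /inj_beta.
Qed.

End Model.

(** * From iterates of Frobenius to cycle types *)

Section Porbit.
Variables (T : finType) (s : {perm T}).

Lemma iter_porbit_mod m x : iter (m %% #|porbit s x|) s x = iter m s x.
Proof.
rewrite [in RHS](divn_eq m #|porbit s x|) addnC iterD; congr iter.
elim: (m %/ _)%N => [|q IHq]; first by rewrite mul0n.
by rewrite mulSn iterD -IHq iter_porbit.
Qed.

Lemma dvdn_card_porbit m x : iter m s x = x -> (#|porbit s x| %| m)%N.
Proof.
rewrite -iter_porbit_mod => e; rewrite /dvdn.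
have o_gt0 : (0 < #|porbit s x|)%N by rewrite (cardD1 x) porbit_id.
have lt_m := ltn_pmod m o_gt0; apply: contra_eqT e; move: lt_m.
case: (m %% _)%N => // r lt_r _.
have := uniq_traject_porbit s x; case Do: #|_| lt_r => [|o'] //= lt_r /andP[x_notin _].
apply: contraNneq x_notin => e; apply/trajectP; exists r => //.
by rewrite -iterSr.
Qed.

Lemma iter_card_porbit m x : (#|porbit s x| %| m)%N -> iter m s x = x.
Proof. by rewrite -iter_porbit_mod => /eqP ->. Qed.

Lemma porbit_full x (B : {set T}) : porbit s x \subset B -> #|B| = #|porbit s x| ->
  forall y, y \in B -> exists m, (s ^+ m)%g x = y.
Proof.
move=> sub card_B y; have /eqP <- : porbit s x == B by rewrite eqEcard sub card_B leqnn.
by case/porbitP => m ->; exists m.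
Qed.

Lemma tperm_of_support a b :
  a != b -> (forall x, (s x != x) = (x == a) || (x == b)) -> s = tperm a b.
Proof.
move=> neq_ab supp.
have moved x : s x != x -> s (s x) != s x by rewrite (inj_eq perm_inj).
have sa : s a = b.
  have : s a != a by rewrite supp eqxx.
  by move=> ne_a; have := moved _ ne_a; rewrite supp (negbTE ne_a) => /eqP.
have sb : s b = a.
  have : s b != b by rewrite supp eqxx orbT.
  by move=> ne_b; have := moved _ ne_b; rewrite supp (negbTE ne_b) orbF => /eqP.
apply/permP => x; case: tpermP => [->|->|/eqP/negbTE xa /eqP/negbTE xb] //.
by apply/eqP; rewrite -[_ == _]negbK supp xa xb.
Qed.

End Porbit.

(** A divisor of 16 that does not divide 8 is 16 itself, so each orbit is everything. *)
Lemma cycle_16 (s : {perm 'I_16}) :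
    (forall i, iter 16 s i = i /\ iter 8 s i <> i) ->
  forall i l, exists m, (s ^+ m)%g i = l.
Proof.
move=> Hs i l; have sub : porbit s i \subset [set: 'I_16] by apply/subsetP => y _; rewrite inE.
apply: (porbit_full sub); last by rewrite inE.
have [/dvdn_card_porbit o16 ne8] := Hs i; rewrite cardsT card_ord.
have ndv8 : ~~ (#|porbit s i| %| 8)%N.
  by apply/negP => /iter_card_porbit.
have : #|porbit s i| \in [:: 1; 2; 4; 8; 16]%N by rewrite (_ : [:: _; _; _; _; _] = divisors 16) // -dvdn_divisors.
move: ndv8; move: #|porbit s i| => o; rewrite !inE.
move=> ndv8 o_in; apply/esym/eqP; apply: contraNT ndv8 => ne16; move: o_in.
by rewrite (negbTE ne16) orbF => /or4P[] /eqP->.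
Qed.

Lemma cycle_15 (s : {perm 'I_16}) (i0 : 'I_16) :
    s i0 = i0 ->
    (forall i, i != i0 -> [/\ iter 15 s i = i, iter 3 s i <> i & iter 5 s i <> i]) ->
  forall i l, i != i0 -> l != i0 -> exists m, (s ^+ m)%g i = l.
Proof.
move=> s_i0 Hs i l ne_i ne_l; have sub : porbit s i \subset [set~ i0].
  apply/subsetP => x; rewrite !inE porbit_sym; apply: contraTneq => ->.
  apply/porbitP => -[m Di]; rewrite Di in ne_i; case/eqP: ne_i.
  by elim: m {Di} => [|m IHm]; rewrite ?expg0 ?perm1 // expgSr permM IHm.
apply: (porbit_full sub); last by rewrite !inE.
have [/dvdn_card_porbit o15 ne3 ne5] := Hs i ne_i; rewrite cardsC1 card_ord.
have ndv m : iter m s i <> i -> ~~ (#|porbit s i| %| m)%N.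
  by move=> ne_m; apply/negP => /iter_card_porbit.
have : #|porbit s i| \in [:: 1; 3; 5; 15]%N by rewrite (_ : [:: _; _; _; _] = divisors 15) // -dvdn_divisors.
move: (ndv _ ne3) (ndv _ ne5); move: #|porbit s i| => o; rewrite !inE => ndv3 ndv5 o_in.
apply/esym/eqP; apply: contraNT ndv3 => ne15; move: o_in.
by rewrite (negbTE ne15) orbF => /or3P[] /eqP e; rewrite e // in ndv5 *.
Qed.

Lemma model_frobenius (K : fieldType) (E : splittingFieldType K) (V : comNzRingType)
    (j : {rmorphism V -> K}) (pi : {rmorphism V -> 'F_3}) (M : 'M[V]_16)
    (L : fieldType) (inc : {rmorphism 'F_3 -> L}) (beta : 'I_16 -> L)
    (alpha : 'I_16 -> E) (r : gal_of {:E} -> 'S_16) :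
    injective j ->
    (forall x : K, (exists v, x = j v) \/ (exists v, x^-1 = j v /\ pi v = 0)) ->
    map_poly (inc \o pi) (char_poly M) = \prod_i ('X - (beta i)%:P) ->
    injective beta ->
    map_poly (in_alg E) (char_poly (map_mx j M)) = \prod_i ('X - (alpha i)%:P) ->
    galois 1 {:E} -> injective alpha ->
    (forall (x : gal_of {:E}) i, x (alpha i) = alpha (r x i)) ->
  exists (s : 'S_16) (x : gal_of {:E}),
    (forall i m, iter m (@cube L) (beta (s i)) = beta (s (iter m (r x) i))).
Proof.
move=> injj val_j Db inj_b Da galE inja Hr.
have char3 : 3 \in [pchar L] by rewrite inE /= (F3_char inc) eqxx.
pose fr : {rmorphism L -> L} := pFrobenius_aut char3.
have fr_inc c : fr (inc c) = inc c.
  rewrite /fr /= pFrobenius_autE -rmorphXn; congr (inc _).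
  by have := expf_card c; rewrite card_Fp.
have [|s [x Hx]] := frobenius_lift injj val_j fr_inc _ Db galE inja Hr.
  by rewrite map_poly_comp map_char_poly.
exists s, x => i m; elim: m => //= m ->; exact: Hx.
Qed.

(** A nonconstant factor has some root among the [alpha i], hence by transitivity all of them, and
    these are distinct. *)
Lemma irreducible_of_transitive (K : fieldType) (E : splittingFieldType K) n (q : {poly K})
    (alpha : 'I_n.+1 -> E) :
    map_poly (in_alg E) q = \prod_i ('X - (alpha i)%:P) -> injective alpha ->
    (forall i l, exists x : gal_of {:E}, x (alpha i) = alpha l) ->
  irreducible_poly q.
Proof.
move=> Dq inja tr; have sz_q : size q = n.+2.
  have := size_map_poly (in_alg E) q; rewrite Dq size_prod_XsubC.
  by rewrite /index_enum -enumT size_enum_ord => <-.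
split=> [|d sz_d d_dv]; first by rewrite sz_q.
have nz_q : q != 0 by rewrite -size_poly_eq0 sz_q.
have nz_d : d != 0 by apply: contraNneq nz_q => d0; rewrite d0 dvd0p in d_dv.
rewrite /eqp d_dv -(dvdp_map (in_alg E)) Dq /=.
have [i root_i] : exists i, root (map_poly (in_alg E) d) (alpha i).
  apply: NNPP => no_root; case/negP: sz_d; rewrite -(size_map_poly (in_alg E)) size_poly_eq1.
  have : coprimep (map_poly (in_alg E) d) (map_poly (in_alg E) q).
    rewrite Dq; elim/big_rec: _ => [|i p _ IHp]; first exact: coprimep1.
    rewrite coprimepMr IHp andbT coprimep_XsubC; apply/negP => root_i.
    by apply: no_root; exists i.
  by move/coprimepP/(_ _ (dvdpp _)); rewrite dvdp_map; apply.
have all_roots l : root (map_poly (in_alg E) d) (alpha l).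
  have [x <-] := tr i l.
  have -> : map_poly (in_alg E) d = map_poly x (map_poly (in_alg E) d).
    by rewrite -map_poly_comp; apply: eq_map_poly => c; rewrite /= linearZ rmorph1.
  by rewrite fmorph_root.
rewrite -(big_map alpha predT (fun z => 'X - z%:P)) /=.
apply: uniq_roots_dvdp; first by apply/allP => _ /mapP[l _ ->].
by rewrite uniq_rootsE map_inj_uniq // /index_enum -enumT enum_uniq.
Qed.

Section Final.
Variables (K : fieldType) (phi : {rmorphism rat -> K}) (A B1 B2 C D F : 'M[K]_2).
Hypothesis Hgen : generic_matrices phi [tuple A; B1; B2; C; D; F].
Hypothesis HK : generated_by_entries phi [tuple A; B1; B2; C; D; F].
Let f := quad_sys A B1 B2 C D F.
Let l := mxvec_index 0 1 : 'I_(2 * 2).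

Lemma generic_proper : ~ in_ideal f 1.
Proof.
have [_ _ uD _] := point_model Hgen HK point_15_1.
apply: (quad_sys_proper Hgen (entries_frac Hgen HK)); apply: uD.
rewrite map_nat_mx (expand_det_row _ 0) big_ord_recl big_ord1 /cofactor !det_mx11 !mxE /=.
by [].
Qed.

Lemma generic_galois_group : exists M : 'M[K]_16,
  [/\ mult_matrix f l M, irreducible_poly (char_poly M), separable_poly (char_poly M)
    & has_galois_group (char_poly M) [set: 'S_16]%G].
Proof.
have [_ _ _ [V [j [pi [M [L [inc [beta [injj val_j [HM Db] inj_b Q16]]]]]]]]] :=
  point_model Hgen HK point_16.
have [_ _ _ [V' [j' [pi' [M' [L' [inc' [beta' [injj' val_j' [HM' Db'] inj_b' Q15]]]]]]]]] :=
  point_model Hgen HK point_15_1.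
have [_ _ _ [V2 [j2 [pi2 [M2 [L2 [inc2 [beta2 [injj2 val_j2 [HM2 Db2] inj_b2 Q2]]]]]]]]] :=
  point_model Hgen HK point_2_7_7.
pose MK := map_mx j M; pose q := char_poly MK; exists MK.
have nz_q : q != 0 by rewrite monic_neq0 ?char_poly_monic.
have [E splitE] := splitting_field_exists nz_q.
have [alpha Da] : exists alpha : 'I_16 -> E,
    map_poly (in_alg E) q = \prod_i ('X - (alpha i)%:P).
  have [zs Dzs _] := splitE.
  have {}Dzs : map_poly (in_alg E) q = \prod_(z <- zs) ('X - z%:P).
    by apply/eqP; rewrite -eqp_monic ?monic_prod_XsubC // monic_map ?char_poly_monic.
  have sz_zs : size zs = 16%N.
    have := size_map_poly (in_alg E) q.
    by rewrite Dzs size_prod_XsubC size_char_poly => -[].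
  by exists (fun i => nth 0 zs i); rewrite Dzs (big_nth 0) sz_zs big_mkord.
have Da' : map_poly (in_alg E \o j) (char_poly M) = \prod_i ('X - (alpha i)%:P).
  by rewrite map_poly_comp map_char_poly.
have inja : injective alpha.
  apply: (distinct_roots_lift _ Da' Db inj_b).
  by apply: inj_comp injj; apply: fmorph_inj.
have sep_q : separable_poly q.
  rewrite -(separable_map (in_alg E)) Da -(big_map alpha predT (fun z => 'X - z%:P)).
  by rewrite separable_prod_XsubC map_inj_uniq // /index_enum -enumT enum_uniq.
have galE : galois 1 {:E}.
  apply/splitting_galoisField; exists (map_poly (in_alg E) q); split=> //.
    by apply/polyOverP => i; rewrite coef_map memvZ // mem1v.
  by rewrite separable_map.
have [r Hr] := gal_perm_roots Da inja.
have rM (x y : gal_of {:E}) : r (x * y)%g = (r x * r y)%g.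
  apply/permP => i; apply: inja.
  by rewrite permM -!Hr galM ?memvf.
have rX (x : gal_of {:E}) m : r (x ^+ m)%g = (r x ^+ m)%g.
  elim: m => [|m IHm]; last by rewrite !expgSr rM IHm.
  by apply/permP => i; apply: inja; rewrite -Hr !expg0 gal_id perm1.
have [s [x Hx]] := model_frobenius injj val_j Db inj_b Da galE inja Hr.
have tr := @cycle_16 (r x).
have {}tr i k : exists y : gal_of {:E}, y (alpha i) = alpha k.
  have [|m Dm] := tr _ i k; last by exists (x ^+ m)%g; rewrite Hr rX Dm.
  move=> i1; have [e16 ne8] := Q16 (s i1); split.
    by apply: (@perm_inj _ s); apply: inj_b; rewrite -Hx.
  by move=> e8; case/eqP: ne8; rewrite Hx e8.
have irr : irreducible_poly q by apply: irreducible_of_transitive Da inja tr.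
(* From here on the matrices of the other two points share the roots [alpha], so the three Frobenius
   lifts act on the same set. *)
have uniqM M1 : mult_matrix f l M1 -> M1 = MK by apply: mult_matrix_unique generic_proper HM irr _.
split=> //; exists E; split=> //.
apply: (galois_group_symmetric Da inja splitE Hr).
have rD : {in [set: gal_of {:E}] &, {morph r : y z / (y * z)%g}} by move=> y z _ _; apply: rM.
pose G := (Morphism rD @* [set: gal_of {:E}])%G.
have Gr y : r y \in G by rewrite -[r y]/(Morphism rD y) mem_morphim ?inE.
suffices /setP GT : G = [set: 'S_16]%G :> {set 'S_16}.
  by move=> t; have := GT t; rewrite inE => /morphimP[y _ _ ->]; exists y.
have Da2 : map_poly (in_alg E) (char_poly (map_mx j' M')) = \prod_i ('X - (alpha i)%:P).
  by rewrite (uniqM _ HM').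
have Da3 : map_poly (in_alg E) (char_poly (map_mx j2 M2)) = \prod_i ('X - (alpha i)%:P).
  by rewrite (uniqM _ HM2).
have [s2 [y Hy]] := model_frobenius injj' val_j' Db' inj_b' Da2 galE inja Hr.
have [s3 [z Hz]] := model_frobenius injj2 val_j2 Db2 inj_b2 Da3 galE inja Hr.
have [i0 fix_i0 cyc] := Q15; have [a [b [neq_ab supp]]] := Q2.
(* [s2] and [s3] match the roots with their reductions, so fixed and moved points are pulled back
   through their inverses. *)
congr (gval _); apply: (@symmetric_group_criterion _ G ((s2^-1)%g i0) (r y) (r z ^+ 7)%g).
- by move=> i k; have [u Du] := tr i k; exists (r u) => //; apply: inja; rewrite -Hr.
- exact: Gr.
- apply: (@perm_inj _ s2); apply: inj_b'; rewrite permKV.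
  by have := Hy ((s2^-1)%g i0) 1%N; rewrite /= permKV fix_i0 => <-.
- apply: cycle_15.
    apply: (@perm_inj _ s2); apply: inj_b'; rewrite permKV.
    by have := Hy ((s2^-1)%g i0) 1%N; rewrite /= permKV fix_i0 => <-.
  move=> i ne_i; have [|e15 ne3 ne5] := cyc (s2 i).
    by apply: contraNneq ne_i => <-; rewrite permK.
  split; first by apply: (@perm_inj _ s2); apply: inj_b'; rewrite -Hy.
    by move=> e; case/eqP: ne3; rewrite Hy e.
  by move=> e; case/eqP: ne5; rewrite Hy e.
- by rewrite -rX Gr.
exists ((s3^-1)%g a), ((s3^-1)%g b); split; first by rewrite (inj_eq perm_inj).
apply: tperm_of_support; first by rewrite (inj_eq perm_inj).
move=> i; have e k : (i == (s3^-1)%g k) = (s3 i == k).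
  by rewrite -(inj_eq (@perm_inj _ s3)) permKV.
by rewrite !e -supp Hz (inj_eq inj_b2) (inj_eq perm_inj) permX.
Qed.

End Final.

(** * Solutions over the algebraic closure *)

Lemma generated_field_horner (F L : fieldType) (iota : {rmorphism F -> L}) (S : L -> Prop)
    (p : {poly F}) x :
  generated_field iota S x -> generated_field iota S (map_poly iota p).[x].
Proof.
move=> Sx; have S0 : generated_field iota S 0 by rewrite -(rmorph0 iota); apply: Gen_base.
have SN y : generated_field iota S y -> generated_field iota S (- y).
  by move=> Sy; rewrite -sub0r; apply: Gen_sub.
have SM y z : generated_field iota S y -> generated_field iota S z -> generated_field iota S (y * z).
  move=> Sy Sz; rewrite -[z]invrK; apply: Gen_div => //; rewrite -div1r; apply: Gen_div => //.
  by rewrite -(rmorph1 iota); apply: Gen_base.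
elim/poly_ind: p => [|p c IHp]; first by rewrite rmorph0 horner0.
rewrite rmorphD rmorphM /= map_polyX map_polyC hornerD hornerMX hornerC.
by rewrite -[X in _ + X]opprK; apply: Gen_sub; [apply: SM | apply/SN/Gen_base].
Qed.

Lemma generated_field_sub (F L : fieldType) (iota : {rmorphism F -> L}) (S S' : L -> Prop) x :
  (forall y, S y -> generated_field iota S' y) ->
  generated_field iota S x -> generated_field iota S' x.
Proof.
move=> SS'; elim=> [a | y /SS' // | y z _ Sy _ Sz | y z _ Sy _ Sz]; first exact: Gen_base.
  exact: Gen_sub.
exact: Gen_div.
Qed.

Lemma solutionP (K L : fieldType) (iota : {rmorphism K -> L}) n (f : 'M[{mpoly K[n * n]}]_n)
    (X : 'M[L]_n) :
  solution iota f X <-> forall i j, mmap iota (mxvec X 0) (f i j) = 0.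
Proof.
split=> [/matrixP sol i j | sol]; first by have := sol i j; rewrite !mxE.
by apply/matrixP => i j; rewrite !mxE.
Qed.

Lemma quad_eval_homogeneous (R : comNzRingType) (A B1 B2 C X : 'M[R]_2) :
  A *m X *m B1 *m X + X *m B2 *m X + X *m X *m C = quad_eval A B1 B2 C 0 0 X.
Proof. by rewrite /quad_eval mul0mx; set q := _ + _; rewrite 2!(addr0 q). Qed.

Section Closure.
Variables (K : fieldType) (phi : {rmorphism rat -> K}) (A B1 B2 C D F : 'M[K]_2).
Hypothesis Hgen : generic_matrices phi [tuple A; B1; B2; C; D; F].
Hypothesis HK : generated_by_entries phi [tuple A; B1; B2; C; D; F].
Variables (Kbar : closedFieldType) (iota : {rmorphism K -> Kbar}).
Let f := quad_sys A B1 B2 C D F.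
Let l := mxvec_index 0 1 : 'I_(2 * 2).

Lemma separable_roots (q : {poly K}) n : q \is monic -> size q = n.+1 -> separable_poly q ->
  exists a : 'I_n -> Kbar,
    map_poly iota q = \prod_i ('X - (a i)%:P) /\ injective a.
Proof.
move=> mon_q sz_q sep_q; have [rs Drs] := closed_field_poly_normal (map_poly iota q).
have {}Drs : map_poly iota q = \prod_(z <- rs) ('X - z%:P).
  by rewrite Drs (monicP _) ?monic_map // scale1r.
have sz_rs : size rs = n.
  by have := size_map_poly iota q; rewrite Drs size_prod_XsubC sz_q => -[].
have uniq_rs : uniq rs by rewrite -separable_prod_XsubC -Drs separable_map.
exists (fun i => nth 0 rs i); split; first by rewrite Drs (big_nth 0) sz_rs big_mkord.
by move=> i k /eqP; rewrite nth_uniq ?sz_rs // => /eqP/val_inj.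
Qed.

Lemma generic_solvability : solvability_complexity iota f 16 [set: 'S_16]%G.
Proof.
have [M [HM irr sep galM]] := generic_galois_group Hgen HK.
have proper := generic_proper Hgen HK.
have [Q HQ] := variable_poly HM irr.
have [a [Da inj_a]] := separable_roots (char_poly_monic M) (size_char_poly M) sep.
have root_a b : root (map_poly iota (char_poly M)) b <-> exists i, b = a i.
  rewrite Da rootE horner_prod prodf_seq_eq0; split.
    by case/hasP=> i _ /=; rewrite hornerXsubC subr_eq0 => /eqP ->; exists i.
  by move=> [i ->]; apply/hasP; exists i; rewrite ?mem_index_enum //= hornerXsubC subrr.
(* The inverse of [Y |-> Y 0 1], from roots back to solutions. *)
pose X b : 'M[Kbar]_2 := \matrix_(i, j) (map_poly iota (Q (mxvec_index i j))).[b].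
have mxvecX b v : mxvec (X b) 0 v = (map_poly iota (Q v)).[b].
  by case/mxvec_indexP: v => i j; rewrite mxvecE mxE.
have sol_root b : root (map_poly iota (char_poly M)) b -> solution iota f (X b) /\ X b 0 1 = b.
  move=> root_b; have [f0 xl] := root_is_solution proper HM irr HQ root_b.
  split; last by rewrite mxE.
  by apply/solutionP => i j; rewrite -[RHS](f0 i j); apply: mmap_eq.
have root_sol Y : solution iota f Y -> root (map_poly iota (char_poly M)) (Y 0 1) /\ Y = X (Y 0 1).
  move/solutionP => f0; have [] := solution_is_root proper HM irr HQ f0.
  rewrite mxvecE => root_Y Yv; split=> //.
  by apply/matrixP => i j; rewrite mxE -Yv mxvecE.
split.
  exists [seq X (a i) | i : 'I_16]; split.
  - rewrite map_inj_uniq ?enum_uniq // => i k eX; apply: inj_a.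
    have [_ <-] : solution iota f (X (a i)) /\ X (a i) 0 1 = a i.
      by apply/sol_root/root_a; exists i.
    have [_ <-] : solution iota f (X (a k)) /\ X (a k) 0 1 = a k.
      by apply/sol_root/root_a; exists k.
    by rewrite eX.
  - by rewrite size_map size_enum_ord.
  move=> Y; split=> [/mapP[i _ ->] | /root_sol[/root_a[i Di] ->]].
    by apply: (sol_root _ _).1; apply/root_a; exists i.
  by rewrite Di; apply: map_f; rewrite mem_enum.
exists (char_poly M); split=> // x; split.
  apply: generated_field_sub => _ [Y [i [j [/root_sol[root_Y ->] ->]]]].
  by rewrite mxE; apply/generated_field_horner/Gen_mem.
apply: generated_field_sub => b root_b; apply: Gen_mem.
by have [sol <-] := sol_root b root_b; exists (X b), 0, 1.
Qed.

Let gbar := quad_sys (map_mx iota A) (map_mx iota B1) (map_mx iota B2) (map_mx iota C) 0 0.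

Lemma homogeneous_map : map_mx (map_mpoly iota) (quad_sys A B1 B2 C 0 0) = gbar.
Proof. by rewrite map_quad_sys (map_mx0 iota). Qed.

Lemma homogeneous_spans : spans gbar.
Proof.
have [_ spg _ _] := point_model Hgen HK point_16.
by rewrite -homogeneous_map; apply: spans_map.
Qed.

Lemma homogeneous_solution (X : 'M[Kbar]_2) :
  solution iota (quad_sys A B1 B2 C 0 0) X <-> X = 0.
Proof.
split=> [/solutionP sol | ->].
  have gbar0 i j : mmap idfun (mxvec X 0) (gbar i j) = 0.
    by rewrite -homogeneous_map mxE mmap_map -[RHS](sol i j).
  apply/matrixP => i j; rewrite mxE.
  (* The fifth power of each unknown lies in the ideal, so each entry of a solution is nilpotent. *)
  have deg5 : (5 <= mdeg (U_(mxvec_index i j) *+ 5))%N by rewrite mdegMn mdeg1.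
  have := mmap_in_ideal gbar0 (high_degree_in_ideal homogeneous_spans deg5).
  rewrite -mpolyXn rmorphXn /= mmapX mmap1U mxvecE => /eqP.
  by rewrite expf_eq0 => /andP[_ /eqP].
rewrite /solution quad_sys_mmap /quad_eval !mulmx0 !mul0mx !(map_mx0 iota).
by do 4 rewrite (addr0 (0 : 'M[Kbar]_2)).
Qed.

Lemma homogeneous_multiplicity :
  has_multiplicity (map_mx (map_mpoly iota) (quad_sys A B1 B2 C 0 0)) (0 : 'M[Kbar]_2) 16.
Proof.
rewrite homogeneous_map; apply: quadratic_part_multiplicity homogeneous_spans _.
have [spf _ _ _] := point_model Hgen HK point_16.
have [M [HM irr sep _]] := generic_galois_group Hgen HK.
have proper := generic_proper Hgen HK.
have [Q HQ] := variable_poly HM irr.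
have [a [Da inj_a]] := separable_roots (char_poly_monic M) (size_char_poly M) sep.
apply: (@quadratic_part_independent _ _ _ _ _ (map_mx iota D) (map_mx iota F)).
  by rewrite -map_quad_sys; apply: spans_map.
move=> c; rewrite -map_quad_sys => Ic.
exact: (extension_independent proper HM irr HQ Da inj_a Ic).
Qed.

End Closure.

Theorem theorem4 (K : fieldType) (phi : {rmorphism rat -> K})
    (Kbar : closedFieldType) (iota : {rmorphism K -> Kbar})
    (A B1 B2 C D F : 'M[K]_2)
    (Hgeneric : generic_matrices phi [tuple A; B1; B2; C; D; F])
    (HK : generated_by_entries phi [tuple A; B1; B2; C; D; F])
    (HKbar : is_algebraic_closure iota) :
  let X := unknown_mx K 2 in
  let f := coef_mx A *m X *m coef_mx B1 *m X + X *m coef_mx B2 *m X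
           + X *m X *m coef_mx C + coef_mx D *m X + coef_mx F in
  let g := coef_mx A *m X *m coef_mx B1 *m X + X *m coef_mx B2 *m X
           + X *m X *m coef_mx C in
  solvability_complexity iota f 16 [set: 'S_16]%G
  /\ ((forall X0 : 'M[Kbar]_2, solution iota g X0 <-> X0 = 0)
      /\ has_multiplicity (map_mx (map_mpoly iota) g) (0 : 'M[Kbar]_2) 16).
Proof.
move=> X f g; split; first exact: generic_solvability Hgeneric HK _ iota.
have -> : g = quad_sys A B1 B2 C 0 0.
  by rewrite /quad_sys !coef_mx0; apply: quad_eval_homogeneous.
split=> [X0|]; first exact: homogeneous_solution Hgeneric HK _ iota X0.
exact: homogeneous_multiplicity Hgeneric HK _ iota.
Qed.
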